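(* Let $(P(\theta):\theta\in(a,b))$ be a family of Markov transition kernels on a measurable space $S$, let $\theta_0\in(a,b)$, and let $X$ denote the Markov chain with transition kernel $P(\theta)$. Suppose that there exist a measurable subset $A\subseteq S$, constants $\epsilon,c>0$ and $\lambda,r\in(0,1)$, an integer $m\ge1$, a probability measure $\varphi$ on $S$, and a measurable $w:S\to[1,\infty)$ such that: (a) $(P(\theta_0)w)(x)\le r\,w(x)+c\,\mathbb I(x\in A)$ for $x\in S$; (b) $P^m(\theta,x,dy)\ge\lambda\varphi(dy)$ for $x\in A$, $y\in S$, and $|\theta-\theta_0|<\epsilon$; (c) $P(\cdot)$ is (continuously) differentiable in $\mathcal L_w$ at $\theta_0$. Then $X$ is positive Harris recurrent under $P(\theta)$ for $\theta$ in a neighborhood of $\theta_0$, and the stationary distributions $\pi(\theta)$ belong to $\mathcal M_w$ for $\theta$ in a neighborhood of $\theta_0$ and are (continuously) differentiable in $\mathcal M_w$ at $\theta_0$. Furthermore, if $\Pi(\theta_0)$ is the kernel defined by $\Pi(\theta_0,x,dy)=\pi(\theta_0,dy)$ for $x,y\in S$, then $I-P(\theta_0)+\Pi(\theta_0)$ has an inverse on $\mathcal L_w$ and $$\pi'(\theta_0)=\pi(\theta_0)P'(\theta_0)\big(I-P(\theta_0)+\Pi(\theta_0)\big)^{-1}.$$ If, in addition, $P(\cdot)$ is $n$-times (continuously) differentiable in $\mathcal L_w$ at $\theta_0$, then $\pi(\cdot)$ is $n$-times (continuously) differentiable in $\mathcal M_w$ at $\theta_0$, and $$\pi^{(n)}(\theta_0)=\sum_{j=0}^{n-1}\binom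 nj\pi^{(j)}(\theta_0)P^{(n-j)}(\theta_0)\big(I-P(\theta_0)+\Pi(\theta_0)\big)^{-1}.$$ Here the word ''(continuously)'' is to be read consistently: the theorem asserts both the version with all occurrences omitted and the version with all occurrences included.
   Context: Kernels act and compose in the usual way: $(Qh)(x)=\int h(y)Q(x,dy)$, $(\eta Q)(A)=\int\eta(dx)Q(x,A)$, $(Q_1Q_2)(x,A)=\int Q_1(x,dy)Q_2(y,A)$, $\eta h=\int h\,d\eta$. $I$ is the identity kernel. For measurable $w:S\to[1,\infty)$: $\|h\|_w=\sup_{x\in S}|h(x)|/w(x)$; $L_w$ is the space of measurable $h:S\to\mathbb R$ with $\|h\|_w<\infty$; for a (signed) kernel $Q$ on $S$, $|||Q|||_w=\sup\{\|Qh\|_w/\|h\|_w:h\in L_w,\|h\|_w\ne0\}$, and $\mathcal L_w$ is the space of (signed) kernels with $|||Q|||_w<\infty$; for a (signed) measure $\eta$ on $S$, $\|\eta\|_w=\sup\{|\eta h|:h\in L_w,\|h\|_w\le1\}$, and $\mathcal M_w$ is the space of (signed) measures with $\|\eta\|_w<\infty$. A family $(Q(\theta))$ in $\mathcal L_w$ is differentiable in $\mathcal L_w$ at $\theta_0$ with derivative $Q'(\theta_0)\in\mathcal L_w$ if $|||h^{-1}(Q(\theta_0+h)-Q(\theta_0))-Q'(\theta_0)|||_w\to0$ as $h\to0$; it is continuously differentiable at $\theta_0$ if it is differentiable in a neighborhood of $\theta_0$ and $Q'(\cdot)$ is continuous at $\theta_0$ in $\mathcal L_w$. If $Q(\cdot)$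 is $n$-times differentiable in a neighborhood of $\theta_0$ with $n$th derivative $Q^{(n)}(\cdot)$, it is $(n+1)$-times (continuously) differentiable at $\theta_0$ if $Q^{(n)}(\cdot)$ is (continuously) differentiable at $\theta_0$, and $Q^{(n+1)}$ is the derivative of $Q^{(n)}$; $Q^{(0)}=Q$. The same definitions apply to families in $\mathcal M_w$ with $\|\cdot\|_w$. *)

(* Defs.v *)
From HB Require Import structures.
From mathcomp Require Import all_boot all_order all_algebra.
From mathcomp Require Import all_classical all_reals all_analysis.
From mathcomp Require Import measurable_realfun.

Set Implicit Arguments.
Unset Strict Implicit.
Unset Printing Implicit Defensive.

Import Order.TTheory GRing.Theory Num.Theory.
Import numFieldNormedType.Exports.

Local Open Scope classical_set_scope.
Local Open Scope ring_scope.
Local Open Scope ereal_scope.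

(* Signed measures are the (finite) charges of MathComp-Analysis.  This loses
   nothing: w >= 1, so a finite w-norm forces finiteness.  The value of a
   charge on a non-measurable set is irrelevant, hence [charge_eq]. *)
Section charges.
Context {d : measure_display} {S : measurableType d} {R : realType}.
Implicit Types nu eta : {charge set S -> \bar R}.

Definition charge_eq nu eta := forall B, measurable B -> nu B = eta B.

Definition hahn_pos nu : set S := sval (cid (Hahn_decomposition nu)).

Definition hahn_neg nu : set S :=
  sval (cid (svalP (cid (Hahn_decomposition nu)))).

Definition hahn_posneg nu : hahn_decomposition nu (hahn_pos nu) (hahn_neg nu) :=
  svalP (cid (svalP (cid (Hahn_decomposition nu)))).

(* The result does not depend on the chosen Hahn decomposition
   (Hahn_decomposition_uniq).  In MathComp-Analysis +oo - +oo = -oo. *)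
Definition cintegral nu (f : S -> \bar R) : \bar R :=
  \int[jordan_pos (hahn_posneg nu)]_x f x
    - \int[jordan_neg (hahn_posneg nu)]_x f x.

Definition csub nu eta : {charge set S -> \bar R} := cadd nu (copp eta).

(* The charge agreeing with the set function F on measurable sets, when there
   is one (as is the case for the products of elements of M_w and of the
   algebra of signed kernels on L_w); the zero charge otherwise. *)
Definition charge_of (F : set S -> \bar R) : {charge set S -> \bar R} :=
  match pselect (exists nu : {charge set S -> \bar R},
                   forall B, measurable B -> nu B = F B) with
  | left H => sval (cid H)
  | right _ => czero
  end.

Definition signed_kernel := S -> {charge set S -> \bar R}.
Implicit Types Q : signed_kernel.

Definition skernel_measurable Q :=
  forall B, measurable B -> measurable_fun [set: S] (fun x => Q x B).

Definition skernel_eq Q1 Q2 := forall x, charge_eq (Q1 x) (Q2 x).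

Definition skernel_add Q1 Q2 : signed_kernel := fun x => cadd (Q1 x) (Q2 x).

Definition skernel_sub Q1 Q2 : signed_kernel := fun x => csub (Q1 x) (Q2 x).

Definition skernel_scale (r : R) Q : signed_kernel := fun x => cscale r (Q x).

Definition skernel_id : signed_kernel :=
  fun x => charge_of_finite_measure (\d_x : probability S R).

Definition skernel_cst eta : signed_kernel := fun=> eta.

Definition skernel_fun Q (h : S -> R) (x : S) : \bar R :=
  cintegral (Q x) (EFin \o h).

Definition skernel_act eta Q : {charge set S -> \bar R} :=
  charge_of (fun B => cintegral eta (fun x => Q x B)).

Definition skernel_comp Q1 Q2 : signed_kernel :=
  fun x => skernel_act (Q1 x) Q2.

End charges.
Arguments signed_kernel {d} S R.

Section weighted_norms.
Context {d : measure_display} {S : measurableType d} {R : realType}.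
Variable w : S -> R.

Definition wnorm_fun (g : S -> \bar R) : \bar R :=
  ereal_sup [set `|g x| / (w x)%:E | x in [set: S]].

Definition in_Lw (h : S -> R) :=
  measurable_fun [set: S] h /\ wnorm_fun (EFin \o h) < +oo.

(* If w is not integrable for the variation of eta, then the function equal to
   w on one of the two sets of a Hahn decomposition and to 0 on the other one
   shows that this supremum is +oo. *)
Definition wnorm_charge (eta : {charge set S -> \bar R}) : \bar R :=
  ereal_sup [set `|cintegral eta (EFin \o h)| | h in
    [set h | in_Lw h /\ wnorm_fun (EFin \o h) <= 1]].

Definition wnorm_skernel (Q : signed_kernel S R) : \bar R :=
  ereal_sup [set wnorm_fun (skernel_fun Q h) / wnorm_fun (EFin \o h) | h in
    [set h | in_Lw h /\ wnorm_fun (EFin \o h) != 0]].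

End weighted_norms.

(* The two spaces in which one differentiates are presented through the
   operations occurring in the definition of a derivative; they are not
   zmodTypes because charges are not determined on non-measurable sets. *)
Record normed_space (R : realType) := NormedSpace {
  ns_carrier :> Type ;
  ns_mem : ns_carrier -> Prop ;
  ns_sub : ns_carrier -> ns_carrier -> ns_carrier ;
  ns_scale : R -> ns_carrier -> ns_carrier ;
  ns_norm : ns_carrier -> \bar R }.

Definition Mw {d : measure_display} {S : measurableType d} {R : realType}
    (w : S -> R) : normed_space R :=
  NormedSpace (fun eta => wnorm_charge w eta < +oo) csub
    (fun r eta => cscale r eta : {charge set S -> \bar R}) (wnorm_charge w).

Definition calLw {d : measure_display} {S : measurableType d} {R : realType}
    (w : S -> R) : normed_space R :=
  NormedSpace (fun Q => skernel_measurable Q /\ wnorm_skernel w Q < +oo)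
    skernel_sub skernel_scale (wnorm_skernel w).

Section differentiability.
Context {R : realType} {V : normed_space R}.
Implicit Types (F G : R -> V) (D : nat -> R -> V) (t : R).

Definition diff_at F t (v : V) :=
  [/\ \forall s \near t, ns_mem (F s),
      ns_mem v &
      ns_norm (ns_sub (ns_scale (h^-1)%R (ns_sub (F (t + h)%R) (F t))) v)
        @[h --> (0%R : R)^'] --> 0].

Definition cdiff_at F t G :=
  (\forall s \near t, diff_at F s (G s)) /\
  ns_norm (ns_sub (G s) (G t)) @[s --> t] --> 0.

(* [cont] tells whether the word "continuously" is read *)
Definition deriv_at (cont : bool) F t G :=
  if cont then cdiff_at F t G else diff_at F t (G t).

(* D k is the k-th derivative of D 0 *)
Fixpoint ndiff_at n D t : Prop :=
  if n is k.+1 then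
    (\forall s \near t, ndiff_at k D s) /\ diff_at (D k) t (D k.+1 t)
  else True.

Definition nderiv_at (cont : bool) n D t : Prop :=
  if n is k.+1 then
    (\forall s \near t, ndiff_at k D s) /\ deriv_at cont (D k) t (D k.+1)
  else True.

End differentiability.

Section markov_chains.
Context {d : measure_display} {S : measurableType d} {R : realType}.
Implicit Types (Q : R.-pker S ~> S) (pi : probability S R).

Fixpoint kernel_pow Q (m : nat) (x : S) (B : set S) : \bar R :=
  if m is k.+1 then \int[Q x]_y kernel_pow Q k y B else \d_x B.

Definition stationary Q pi :=
  forall B, measurable B -> \int[pi]_x Q x B = pi B.

Definition history {d' : measure_display} {Omega : measurableType d'}
    (X : nat -> Omega -> S) (n : nat) : set (set Omega) :=
  <<s [set F | exists k B, [/\ (k <= n)%N, measurable B & F = X k @^-1` B]] >>.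

(* X is a Markov chain with transition kernel Q started at x; the last clause
   is P(X_(n+1) \in B | X_0, ..., X_n) = Q(X_n, B) almost surely. *)
Definition markov_chain Q (x : S) {d' : measure_display}
    {Omega : measurableType d'} (Pr : probability Omega R)
    (X : nat -> Omega -> S) :=
  [/\ forall n, measurable_fun [set: Omega] (X n),
      forall B, measurable B -> Pr (X 0%N @^-1` B) = \d_x B &
      forall n F B, history X n F -> measurable B ->
        Pr (F `&` X n.+1 @^-1` B) = \int[Pr]_(o in F) Q (X n o) B].

(* Such chains exist for all Q and x (Ionescu-Tulcea) and all have the same
   law, so that quantifying over all of them is quantifying over "the" chain;
   lim_sup_set is the event "infinitely often". *)
Definition harris_recurrent Q :=
  exists psi : {measure set S -> \bar R},
    [/\ sigma_finite [set: S] psi, psi [set: S] != 0 &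
      forall B, measurable B -> 0 < psi B ->
      forall x (d' : measure_display) (Omega : measurableType d')
        (Pr : probability Omega R) (X : nat -> Omega -> S),
        markov_chain Q x Pr X ->
        Pr (lim_sup_set (fun n => X n @^-1` B)) = 1].

Definition positive_harris_recurrent Q :=
  harris_recurrent Q /\ exists pi : probability S R, stationary Q pi.

Section charge_of_kernel.
Variables (Q : R.-pker S ~> S) (x : S).

Definition charge_of_kernel : set S -> \bar R := Q x.

Let charge_of_kernel_fin B : measurable B -> charge_of_kernel B \is a fin_num.
Proof.
move=> mB; rewrite ge0_fin_numE ?measure_ge0//.
apply: (@le_lt_trans _ _ (Q x [set: S])); last by rewrite prob_kernel ltry.
by apply: le_measure; rewrite ?inE//; exact: measurableT.
Qed.

HB.instance Definition _ := isCharge.Build _ S R charge_of_kernel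
  (measure0 (Q x)) charge_of_kernel_fin (@measure_semi_sigma_additive _ _ _ (Q x)).

End charge_of_kernel.

Definition skernel_of Q : signed_kernel S R := fun x => charge_of_kernel Q x.

Definition charge_of_prob pi : {charge set S -> \bar R} :=
  charge_of_finite_measure pi.

End markov_chains.

(* Main.v *)
Require Import Defs.
From HB Require Import structures.
From mathcomp Require Import all_boot all_order all_algebra.
From mathcomp Require Import all_classical all_reals all_analysis.
From mathcomp Require Import measurable_realfun.
From mathcomp Require Import ring lra.

Set Implicit Arguments.
Unset Strict Implicit.
Unset Printing Implicit Defensive.

Import Order.TTheory GRing.Theory Num.Theory.
Import numFieldNormedType.Exports.

Local Open Scope classical_set_scope.
Local Open Scope ring_scope.

(** Signed measures and kernels of finite w-norm are replaced throughout by the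
    linear forms and the linear operators that they induce on L_w.  Such a form
    comes from a signed measure exactly when it is continuous along dominated
    pointwise limits, so that the products of measures and kernels become
    compositions of functions, and two forms agree as soon as they agree on
    indicator functions.

    One kernel P, with P w <= r w + c 1_A and P^m >= lam phi on A, is treated by
    removing a rank-one part.  Let R be the resolvent sum of the b^k P^k for a
    small b, K = (1 - b) R and s = R 1_A.  Both hypotheses then bear on the same
    function s: K w <= r' w + c' s and K >= lam' s (x) phi.  The operator
    T = K - lam' s (x) phi is positive, and since T 1 = 1 - lam' s it contracts
    the weight w + c' / lam'.  Hence N = (I - T)^-1 is a Neumann series, and
    everything is read off from N: pi is proportional to phi N; b R N solves
    Poisson's equation (I - P) g = h for pi h = 0 and so gives the inverse Z of
    I - P + Pi ([drift_poisson]); a subharmonic function u >= 0 that vanishes on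
    a set B with phi B > 0 satisfies u <= phi u, which forces u = 0
    ([drift_subharmonic_eq0]).  Applied to the probability of never visiting B,
    the last fact is Harris recurrence.

    For a family P(t), closeness of P(t) to P(theta0) in norm preserves the
    drift condition, so that all of this holds near theta0.  If
    mu_s (I - P_s) = rho_s and mu_s 1 does not depend on s, solving the equation
    for P_t gives mu_s - mu_t = (rho_s - rho_t + mu_s (P_s - P_t)) Z_t, so that
    mu inherits the continuity and the differentiability of rho and P.  The
    stationary distribution is the case rho = 0.  The derivative solves an
    equation of the same form, whose right-hand side is given by Leibniz' rule,
    and induction yields the higher derivatives ([derivatives_exist]). *)

(** * Linear forms and operators on weighted function spaces *)
Section weighted_functions.
Import HBNNSimple.
Context {d : measure_display} {S : measurableType d} {R : realType}.
Implicit Types (w h g : S -> R) (C M a : R) (B : set S).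

Definition bnd w C h := measurable_fun [set: S] h /\ forall x, `|h x| <= C * w x.

Definition Lw w h := exists2 C, 0 <= C & bnd w C h.

Lemma LwD w h g : Lw w h -> Lw w g -> Lw w (h \+ g).
Proof.
move=> [C C0 [mh hC]] [D D0 [mg gD]]; exists (C + D); first exact: addr_ge0.
split; first exact: measurable_funD.
by move=> x /=; rewrite mulrDl (le_trans (ler_normD _ _))// lerD.
Qed.

Lemma bndZ w C a h : bnd w C h -> bnd w (`|a| * C) (a \*o h).
Proof.
move=> [mh hC]; split; first by apply: measurable_funM => //; exact: measurable_cst.
by move=> x /=; rewrite normrM -mulrA ler_wpM2l.
Qed.

Lemma LwZ w a h : Lw w h -> Lw w (a \*o h).
Proof. by move=> [C C0 hC]; exists (`|a| * C); [exact: mulr_ge0|exact: bndZ]. Qed.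

Lemma LwB w h g : Lw w h -> Lw w g -> Lw w (h \- g).
Proof.
move=> Lh Lg; have -> : h \- g = h \+ (-1) \*o g by apply/funext => x /=; ring.
by apply: LwD => //; exact: LwZ.
Qed.

Lemma Lw_le w v h : (forall x, w x <= v x) -> Lw w h -> Lw v h.
Proof.
move=> wv [C C0 [mh hC]]; exists C => //; split=> // x.
by rewrite (le_trans (hC x))// ler_wpM2l.
Qed.

Lemma Lw_indic w B : (forall x, 1 <= w x) -> measurable B -> Lw w \1_B.
Proof.
move=> w1 mB; exists 1; rewrite ?ler01//; split; first exact: measurable_indic.
move=> x; rewrite mul1r indicE (le_trans _ (w1 x))//.
by case: (_ \in _); rewrite ?normr1 ?normr0.
Qed.

Lemma Lw_cst w a : (forall x, 1 <= w x) -> Lw w (cst a).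
Proof.
move=> w1; exists `|a| => //; split; first exact: measurable_cst.
by move=> x; rewrite ler_peMr.
Qed.

Lemma Lw_self w : (forall x, 0 <= w x) -> measurable_fun [set: S] w -> Lw w w.
Proof.
move=> w0 mw; exists 1; rewrite ?ler01//; split=> // x.
by rewrite mul1r ger0_norm.
Qed.

Lemma bnd_cvg w C (u : nat -> S -> R) h : (forall n, bnd w C (u n)) ->
  (forall x, u ^~ x @ \oo --> h x) -> bnd w C h.
Proof.
move=> uC uh; split.
  apply: (@measurable_fun_cvg _ _ _ _ u) => [n|x _]; [exact: (uC n).1|exact: uh].
move=> x; rewrite -lee_fin.
have nuh : `|u n x| @[n --> \oo] --> `|h x| by apply: cvg_norm; exact: uh.
have: \forall n \near \oo, `|u n x| <= C * w x by near=> n; exact: (uC n).2.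
by move=> /(limr_le (cvgP _ nuh)); rewrite (cvg_lim _ nuh).
Unshelve. all: by end_near. Qed.

(** A nonnegative function is the limit of simple functions below it, and these
    are nonnegative combinations of indicators. *)
Lemma Lw_ind_ge0 w (Pr : (S -> R) -> Prop) : (forall x, 1 <= w x) ->
  (forall B, measurable B -> Pr \1_B) ->
  (forall a h g, 0 <= a -> Lw w h -> Lw w g -> Pr h -> Pr g -> Pr (a \*o h \+ g)) ->
  (forall (u : nat -> S -> R) h C, 0 <= C -> (forall n, bnd w C (u n)) ->
     (forall n, Pr (u n)) -> (forall x, u ^~ x @ \oo --> h x) -> Pr h) ->
  forall h, Lw w h -> (forall x, 0 <= h x) -> Pr h.
Proof.
move=> w1 Pi Pl Pc h [C C0 [mh hC]] h0.
have w0 x : 0 <= w x by exact: le_trans (w1 x).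
have mEh : measurable_fun [set: S] (EFin \o h) by exact/measurable_EFinP.
pose u n : S -> R := nnsfun_approx measurableT mEh n.
have uh x : u ^~ x @ \oo --> h x.
  have /= := @cvg_nnsfun_approx _ _ _ _ measurableT _ mEh
    (fun x _ => (h0 x : (0 <= (h x)%:E)%E)) x I.
  by move=> /fine_cvg; apply: cvg_trans.
have ule n x : u n x <= h x.
  have ndu : nondecreasing_seq (u ^~ x).
    by move=> i j ij; have /lefP := nd_nnsfun_approx measurableT mEh ij; exact.
  have := nondecreasing_cvgn_le ndu (cvgP _ (uh x)) n.
  by rewrite (cvg_lim _ (uh x)).
apply: (Pc u h C) => //.
  move=> n; split; first by [].
  by move=> x; rewrite ger0_norm ?fun_ge0// (le_trans (ule n x))// -[leLHS]ger0_norm.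
move=> n; rewrite /u; move: (nnsfun_approx measurableT mEh n) => f.
have mf y : measurable (f @^-1` [set y]) by exact: measurable_sfunP.
pose s : seq R := finmap.enum_fset (fset_set (range f)).
have s0 y : y \in s -> 0 <= y.
  rewrite [y \in s]in_fset_set// inE => -[x _ <-].
  exact: fun_ge0.
have -> : (f : S -> R) = (fun x => \sum_(y <- s) y * \1_(f @^-1` [set y]) x).
  by apply/funext => x; rewrite fimfunE fsbig_finite.
suff [] : Lw w (fun x => \sum_(y <- s) y * \1_(f @^-1` [set y]) x) /\
    Pr (fun x => \sum_(y <- s) y * \1_(f @^-1` [set y]) x) by [].
elim: s s0 => [_|y s IH s0].
  have -> : (fun x => \sum_(y <- [::]) y * \1_(f @^-1` [set y]) x) = \1_set0 :> (S -> R).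
    by apply/funext => x; rewrite big_nil indic0.
  by split; [exact: Lw_indic|exact: Pi].
have -> : (fun x => \sum_(y <- y :: s) y * \1_(f @^-1` [set y]) x) =
    y \*o \1_(f @^-1` [set y]) \+ (fun x => \sum_(y <- s) y * \1_(f @^-1` [set y]) x).
  by apply/funext => x; rewrite big_cons.
have [|Ls Ps] := IH; first by move=> z zs; apply: s0; rewrite inE zs orbT.
have Li := Lw_indic w1 (mf y).
split; first by apply: LwD => //; exact: LwZ.
by apply: Pl => //; [apply: s0; rewrite mem_head|exact: Pi].
Unshelve. all: by end_near. Qed.

Lemma Lw_pos w h : Lw w h -> Lw w (fun x => Num.max (h x) 0).
Proof.
move=> [C C0 [mh hC]]; exists C => //; split.
  by apply: measurable_maxr => //; exact: measurable_cst.
by move=> x; have := hC x; case: (leP (h x) 0) => // _ ?; rewrite normr0 (le_trans _ (hC x)).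
Qed.

(** A monotone class principle: a function in L_w is a difference of two dominated
    limits of simple functions. *)
Lemma Lw_ind w (Pr : (S -> R) -> Prop) : (forall x, 1 <= w x) ->
  (forall B, measurable B -> Pr \1_B) ->
  (forall a h g, Lw w h -> Lw w g -> Pr h -> Pr g -> Pr (a \*o h \+ g)) ->
  (forall (u : nat -> S -> R) h C, 0 <= C -> (forall n, bnd w C (u n)) ->
     (forall n, Pr (u n)) -> (forall x, u ^~ x @ \oo --> h x) -> Pr h) ->
  forall h, Lw w h -> Pr h.
Proof.
move=> w1 Pi Pl Pc h Lh.
pose hp x := Num.max (h x) 0; pose hn x := Num.max (((-1) \*o h) x) 0.
have Lhp : Lw w hp by exact: Lw_pos.
have Lhn : Lw w hn by apply: Lw_pos; exact: LwZ.
have Pge0 g : Lw w g -> (forall x, 0 <= g x) -> Pr g.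
  by apply: Lw_ind_ge0 => //; move=> *; exact: Pl.
have -> : h = (-1) \*o hn \+ hp.
  by apply/funext => x /=; rewrite /hn /hp/=; case: (leP (h x) 0) => ?; case: leP => ?; lra.
by apply: Pl => //; apply: Pge0 => // x; rewrite le_max lexx orbT.
Qed.

(** A signed measure of weighted norm at most M, seen as a linear form on L_w.
    The last field plays the role of countable additivity. *)
Record wfun w M (l : (S -> R) -> R) : Prop := WFun {
  wfun_ge0 : 0 <= M ;
  wfun_lin : forall a h g, Lw w h -> Lw w g -> l (a \*o h \+ g) = a * l h + l g ;
  wfun_bnd : forall C h, 0 <= C -> bnd w C h -> `|l h| <= M * C ;
  wfun_cvg : forall (u : nat -> S -> R) h C, 0 <= C -> (forall n, bnd w C (u n)) ->
    (forall x, u ^~ x @ \oo --> h x) -> l (u n) @[n --> \oo] --> l h }.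

Lemma wfun_eq w M M' l l' : (forall x, 1 <= w x) -> wfun w M l -> wfun w M' l' ->
  (forall B, measurable B -> l \1_B = l' \1_B) -> forall h, Lw w h -> l h = l' h.
Proof.
move=> w1 wl wl' ll'; apply: Lw_ind => // [a h g Lh Lg hE gE|u h C C0 uC uE uh].
  by rewrite (wfun_lin wl)// (wfun_lin wl')// hE gE.
have := wfun_cvg wl C0 uC uh; have := wfun_cvg wl' C0 uC uh.
under eq_fun do rewrite -uE.
by move=> /cvg_lim <- // /cvg_lim <-.
Qed.

Lemma wfun_indic_ge0 w M l : (forall x, 1 <= w x) -> wfun w M l ->
  (forall B, measurable B -> 0 <= l \1_B) ->
  forall h, Lw w h -> (forall x, 0 <= h x) -> 0 <= l h.
Proof.
move=> w1 wl l0; apply: Lw_ind_ge0 => // [a h g a0 Lh Lg hE gE|u h C C0 uC u0 uh].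
  by rewrite (wfun_lin wl)// addr_ge0// mulr_ge0.
have lu := wfun_cvg wl C0 uC uh.
by rewrite -(cvg_lim _ lu)//; apply: limr_ge; [exact: cvgP lu|near=> n].
Unshelve. all: by end_near. Qed.

Section wfun_theory.
Variables (w : S -> R) (w1 : forall x, 1 <= w x).
Variables (M : R) (l : (S -> R) -> R) (wl : wfun w M l).

Lemma wfun0 : l \0 = 0.
Proof.
have L0 : Lw w \0 by exact: (Lw_cst 0 w1).
have := wfun_lin wl 1 L0 L0.
have -> : 1 \*o \0 \+ \0 = \0 :> (S -> R) by apply/funext => x /=; ring.
by lra.
Qed.

Lemma wfunD h g : Lw w h -> Lw w g -> l (h \+ g) = l h + l g.
Proof.
move=> Lh Lg; rewrite -[l h]mul1r -(wfun_lin wl)//; congr l.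
by apply/funext => x /=; rewrite mul1r.
Qed.

Lemma wfunZ a h : Lw w h -> l (a \*o h) = a * l h.
Proof.
move=> Lh; have L0 : Lw w \0 by exact: (Lw_cst 0 w1).
rewrite -[RHS]addr0 -wfun0 -(wfun_lin wl)//; congr l.
by apply/funext => x /=; rewrite addr0.
Qed.

Lemma wfunB h g : Lw w h -> Lw w g -> l (h \- g) = l h - l g.
Proof.
move=> Lh Lg; rewrite -[- l g]mulN1r addrC -(wfun_lin wl)//; congr l.
by apply/funext => x /=; ring.
Qed.

Lemma wfun_cst a : l (cst a) = a * l (cst 1).
Proof.
rewrite -wfunZ; last exact: Lw_cst.
by congr l; apply/funext => x /=; rewrite mulr1.
Qed.

Lemma wfun_mono h g : (forall B, measurable B -> 0 <= l \1_B) ->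
  Lw w h -> Lw w g -> (forall x, h x <= g x) -> l h <= l g.
Proof.
move=> l0 Lh Lg hg; rewrite -subr_ge0 -wfunB//.
by apply: (wfun_indic_ge0 w1 wl) => //; [exact: LwB|move=> x /=; rewrite subr_ge0].
Qed.

End wfun_theory.

Lemma wfun_le w M N l : M <= N -> wfun w M l -> wfun w N l.
Proof.
move=> MN [M0 lin b c]; split => //; first exact: le_trans MN.
by move=> C h C0 hC; rewrite (le_trans (b _ _ C0 hC))// ler_wpM2r.
Qed.

Lemma wfun_weight w v k M l : 0 <= k -> (forall x, v x <= k * w x) ->
  wfun w M l -> wfun v (M * k) l.
Proof.
move=> k0 vw [M0 lin b c].
have bvw C h : 0 <= C -> bnd v C h -> bnd w (C * k) h.
  move=> C0 [mh hC]; split=> // x.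
  by rewrite -mulrA (le_trans (hC x))// ler_wpM2l.
split; first exact: mulr_ge0.
- move=> a h g [C C0 hC] [D D0 gD]; apply: lin.
    by exists (C * k); [exact: mulr_ge0|exact: bvw].
  by exists (D * k); [exact: mulr_ge0|exact: bvw].
- by move=> C h C0 hC; rewrite -mulrA [k * _]mulrC; apply: b; [exact: mulr_ge0|exact: bvw].
- move=> u h C C0 uC uh; apply: (c u h (C * k)) => //; first exact: mulr_ge0.
  by move=> n; exact: bvw.
Qed.

Lemma wfun_zero w : wfun w 0 (fun=> 0).
Proof.
split=> //; first by move=> *; rewrite mulr0 addr0.
- by move=> *; rewrite mul0r normr0.
- by move=> *; exact: cvg_cst.
Qed.

Lemma wfunl_lin w M N l k a : wfun w M l -> wfun w N k ->
  wfun w (`|a| * M + N) (fun h => a * l h + k h).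
Proof.
move=> wl wk; split.
- by rewrite addr_ge0 ?mulr_ge0 ?(wfun_ge0 wl) ?(wfun_ge0 wk).
- by move=> b h g Lh Lg; rewrite (wfun_lin wl)// (wfun_lin wk)//; ring.
- move=> C h C0 hC; rewrite (le_trans (ler_normD _ _))// mulrDl normrM -mulrA.
  by rewrite lerD ?(wfun_bnd wk)// ler_wpM2l// (wfun_bnd wl).
- move=> u h C C0 uC uh; apply: cvgD; last exact: (wfun_cvg wk C0 uC uh).
  by apply: cvgMr; exact: (wfun_cvg wl C0 uC uh).
Qed.

Lemma wfunl_sub w M N l k : wfun w M l -> wfun w N k ->
  wfun w (M + N) (fun h => l h - k h).
Proof.
move=> wl wk; have := wfunl_lin (-1) wk wl.
rewrite normrN1 mul1r addrC; congr wfun.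
by apply/funext => h; ring.
Qed.

(** A signed kernel of weighted operator norm at most M, seen as an operator on
    L_w: the form h |-> Q h x is its value at x. *)
Record woper w M (Q : (S -> R) -> S -> R) : Prop := WOper {
  woper_ge0 : 0 <= M ;
  woper_wfun : forall x, wfun w (M * w x) (Q ^~ x) ;
  woper_meas : forall h, Lw w h -> measurable_fun [set: S] (Q h) }.

Lemma woper_bnd w M Q C h : 0 <= C -> woper w M Q -> bnd w C h -> bnd w (M * C) (Q h).
Proof.
move=> C0 wQ hC; split; first by apply: (woper_meas wQ); exists C.
by move=> x; rewrite mulrAC; apply: (wfun_bnd (woper_wfun wQ x)).
Qed.

Lemma woper_Lw w M Q h : woper w M Q -> Lw w h -> Lw w (Q h).
Proof.
move=> wQ [C C0 hC]; exists (M * C); last exact: woper_bnd.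
by rewrite mulr_ge0// (woper_ge0 wQ).
Qed.

Lemma wfun_comp w M N l Q : wfun w M l -> woper w N Q -> wfun w (M * N) (l \o Q).
Proof.
move=> wl wQ; have M0 := wfun_ge0 wl; have N0 := woper_ge0 wQ.
split; first exact: mulr_ge0.
- move=> a h g Lh Lg /=; rewrite -(wfun_lin wl); try exact: (woper_Lw wQ).
  congr l; apply/funext => x /=.
  exact: (wfun_lin (woper_wfun wQ x)).
- move=> C h C0 hC /=; rewrite -mulrA; apply: (wfun_bnd wl); first exact: mulr_ge0.
  exact: (woper_bnd C0 wQ).
- move=> u h C C0 uC uh /=; apply: (wfun_cvg wl (C := N * C)); first exact: mulr_ge0.
    by move=> n; exact: (woper_bnd C0 wQ).
  by move=> x; exact: (wfun_cvg (woper_wfun wQ x) C0 uC uh).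
Qed.

Lemma woper_comp w M N Q Q' : woper w M Q -> woper w N Q' -> woper w (M * N) (Q \o Q').
Proof.
move=> wQ wQ'; split; first by rewrite mulr_ge0 ?(woper_ge0 wQ) ?(woper_ge0 wQ').
  by move=> x; rewrite mulrAC; exact: (wfun_comp (woper_wfun wQ x) wQ').
by move=> h Lh; apply: (woper_meas wQ); exact: (woper_Lw wQ').
Qed.

Lemma woper_lin w M N Q Q' a : woper w M Q -> woper w N Q' ->
  woper w (`|a| * M + N) (fun h => a \*o Q h \+ Q' h).
Proof.
move=> wQ wQ'; split.
- by rewrite addr_ge0 ?mulr_ge0 ?(woper_ge0 wQ) ?(woper_ge0 wQ').
- by move=> x; rewrite mulrDl -mulrA; exact: (wfunl_lin a (woper_wfun wQ x) (woper_wfun wQ' x)).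
- move=> h Lh; apply: measurable_funD; last exact: (woper_meas wQ').
  by apply: measurable_funM; [exact: measurable_cst|exact: (woper_meas wQ)].
Qed.

Lemma woper_le w M N Q : (forall x, 0 <= w x) -> M <= N -> woper w M Q -> woper w N Q.
Proof.
move=> w0 MN [M0 f m]; split => //; first exact: le_trans MN.
by move=> x; apply: wfun_le (f x); rewrite ler_wpM2r.
Qed.

Lemma woper_scale w M Q a : woper w M Q -> woper w (`|a| * M) (fun h => a \*o Q h).
Proof.
move=> [M0 wQ mQ]; split; first exact: mulr_ge0.
  move=> x; have := wfunl_lin a (wQ x) (wfun_zero w); rewrite addr0 mulrA.
  by congr wfun; apply/funext => h; rewrite addr0.
move=> h Lh; apply: measurable_funM; [exact: measurable_cst|exact: mQ].
Qed.

Lemma woper_rank1 w M C s l : 0 <= C -> bnd w C s -> wfun w M l ->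
  woper w (C * M) (fun h => l h \*o s).
Proof.
move=> C0 [ms sC] wl; have M0 := wfun_ge0 wl; split; first exact: mulr_ge0.
  move=> x /=; have := wfunl_lin (s x) wl (wfun_zero w).
  rewrite addr0 => H; apply: (@wfun_le _ (`|s x| * M)).
    by rewrite mulrAC ler_wpM2r.
  by move: H; congr wfun; apply/funext => h; rewrite addr0 mulrC.
by move=> h Lh; apply: measurable_funM => //; exact: measurable_cst.
Qed.

Lemma woper_id w : (forall x, 1 <= w x) -> woper w 1 id.
Proof.
move=> w1; split=> //; last by move=> h [C _ []].
move=> x; split => //.
- by rewrite mul1r (le_trans _ (w1 x)).
- by move=> C h C0 [_ hC]; rewrite mul1r mulrC.
Qed.

Lemma woper_indic_meas w (Q : (S -> R) -> S -> R) M : (forall x, 1 <= w x) ->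
  0 <= M -> (forall x, wfun w (M * w x) (Q ^~ x)) ->
  (forall B, measurable B -> measurable_fun [set: S] (Q \1_B)) -> woper w M Q.
Proof.
move=> w1 M0 wQ mQ; split => //; apply: Lw_ind => //.
- move=> a h g Lh Lg mh mg.
  rewrite (_ : Q _ = a \*o Q h \+ Q g).
    apply: measurable_funD => //.
    by apply: measurable_funM => //; exact: measurable_cst.
  by apply/funext => x; exact: (wfun_lin (wQ x)).
- move=> u h C C0 uC mu uh.
  apply: (@measurable_fun_cvg _ _ _ _ (fun n => Q (u n))) => // x _.
  exact: (wfun_cvg (wQ x) C0 uC uh).
Qed.

End weighted_functions.

(** * Integration against a measure *)
Section measures_as_functionals.
Context {d : measure_display} {S : measurableType d} {R : realType}.
Implicit Types (w h g : S -> R) (C M a : R) (B : set S).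
Implicit Types (mu : {measure set S -> \bar R}).

Definition rint mu h : R := \int[mu]_x h x.

Lemma Lw_integrable mu w h : (forall x, 1 <= w x) -> measurable_fun [set: S] w ->
  (\int[mu]_x (w x)%:E < +oo)%E -> Lw w h -> mu.-integrable [set: S] (EFin \o h).
Proof.
move=> w1 mw woo [C C0 [mh hC]].
have w0 x : 0 <= w x by exact: le_trans (w1 x).
have iw : mu.-integrable [set: S] (EFin \o w).
  apply/integrableP; split; first exact/measurable_EFinP.
  by under eq_integral do rewrite /= ger0_norm//.
apply: (@le_integrable _ _ _ mu _ measurableT _ (fun x => (C * w x)%:E)).
- exact/measurable_EFinP.
- by move=> x _ /=; rewrite lee_fin [leRHS]ger0_norm ?hC// mulr_ge0.
- by under eq_fun do rewrite EFinM; exact: integrableZl.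
Qed.

Lemma rintE mu w h : (forall x, 1 <= w x) -> measurable_fun [set: S] w ->
  (\int[mu]_x (w x)%:E < +oo)%E -> Lw w h -> (\int[mu]_x (h x)%:E = (rint mu h)%:E)%E.
Proof.
move=> w1 mw woo Lh; rewrite /rint /Rintegral fineK//.
by apply: integrable_fin_num => //; exact: Lw_integrable Lh.
Qed.

Lemma rint_indic mu B : measurable B -> rint mu \1_B = fine (mu B).
Proof. by move=> mB; rewrite /rint /Rintegral integral_indic// setIT. Qed.

(** Continuity along dominated limits is the dominated convergence theorem. *)
Lemma wfun_rint mu w M : (forall x, 1 <= w x) -> measurable_fun [set: S] w ->
  (\int[mu]_x (w x)%:E <= M%:E)%E -> wfun w M (rint mu).
Proof.
move=> w1 mw wM.
have w0 x : 0 <= w x by exact: le_trans (w1 x).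
have woo : (\int[mu]_x (w x)%:E < +oo)%E by rewrite (le_lt_trans wM)// ltry.
have iL h : Lw w h -> mu.-integrable [set: S] (EFin \o h) by exact: Lw_integrable.
have Lww : Lw w w by exact: Lw_self.
have M0 : 0 <= M.
  by rewrite -lee_fin (le_trans _ wM)//; apply: integral_ge0 => x _; rewrite lee_fin.
split => //.
- move=> a h g Lh Lg; have iah := iL _ (LwZ a Lh); have ig := iL _ Lg.
  rewrite /rint RintegralD//.
  by rewrite RintegralZl//; exact: iL.
- move=> C h C0 hC; have Lh : Lw w h by exists C.
  rewrite (le_trans (le_normr_Rintegral _ (iL _ Lh)))//.
  apply: (@le_trans _ _ (\int[mu]_x (C * w x))).
    apply: le_Rintegral => //.
    + by have := iL _ Lh => /integrable_norm.
    + by apply: (iL (C \*o w)); exact: LwZ.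
    + by move=> x _; exact: hC.2.
  rewrite RintegralZl//; last exact: iL.
  rewrite mulrC ler_wpM2r//.
  by rewrite -lee_fin -(rintE w1 mw woo Lww).
- move=> u h C C0 uC uh.
  have Lu n : Lw w (u n) by exists C.
  have hC : bnd w C h by exact: bnd_cvg uh.
  have Lh : Lw w h by exists C.
  have [//|//|//|||_ _] := @dominated_convergence _ _ _ mu _ measurableT
    (fun n => EFin \o u n) (EFin \o h) (fun x => (C * w x)%:E).
  + by move=> n; apply/measurable_EFinP; exact: (uC n).1.
  + by apply/measurable_EFinP; exact: hC.1.
  + by apply: aeW => x _ /=; apply/fine_cvgP; split; [exact: nearW|exact: uh].
  + by apply: (iL (C \*o w)); exact: LwZ.
  + by apply: aeW => x n _ /=; rewrite lee_fin; exact: (uC n).2.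
  + by rewrite (rintE w1 mw woo Lh) => /fine_cvg; apply: cvg_trans.
Qed.

(** Integrability of w may be tested on truncations, which a finite measure
    integrates without any prior knowledge. *)
Lemma measure_weight_le mu w M : (forall x, 1 <= w x) -> measurable_fun [set: S] w ->
  (mu [set: S] < +oo)%E ->
  (forall n : nat, rint mu (fun x => Num.min (w x) n%:R) <= M) ->
  (\int[mu]_x (w x)%:E <= M%:E)%E.
Proof.
move=> w1 mw muoo wM.
pose u (n : nat) (x : S) := (Num.min (w x) n%:R)%:E.
have mu_ n : measurable_fun [set: S] (u n).
  by apply/measurable_EFinP; apply: measurable_minr.
have u0 n x : (0 <= u n x)%E.
  by rewrite lee_fin le_min (le_trans _ (w1 x))//=.
have uw x : u ^~ x @ \oo --> (w x)%:E.
  apply/fine_cvgP; split; first exact: nearW.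
  apply: cvg_near_cst; near=> n; rewrite /u/=; apply/min_idPl.
  have : (Num.bound (w x) <= n)%N by near: n; exact: nbhs_infty_ge.
  move=> H; apply: (@le_trans _ _ (Num.bound (w x))%:R); last by rewrite ler_nat.
  by apply/ltW/archi_boundP; exact: le_trans (w1 x).
have ndu x : nondecreasing_seq (u ^~ x).
  by move=> m n mn; rewrite /u lee_fin le_min ge_min lexx/= ge_min ler_nat mn orbT.
have <- : (\int[mu]_x (limn (u ^~ x)) = \int[mu]_x (w x)%:E)%E.
  by apply: eq_integral => x _; apply/cvg_lim => //; exact: uw.
rewrite monotone_convergence//.
apply: lime_le.
  apply: ereal_nondecreasing_is_cvgn => m n mn.
  by apply: ge0_le_integral => // x _; exact: ndu.
near=> n.
have := wM n; rewrite -lee_fin; apply: le_trans.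
rewrite -(@rintE _ (cst 1)) //.
  by rewrite (_ : (fun x => _) = cst 1%E)// integral_cst// mul1e.
exists n%:R => //; split; first exact: measurable_minr.
by move=> x; rewrite mulr1 ger0_norm ?ge_min ?lexx ?orbT// -lee_fin u0.
Unshelve. all: by end_near. Qed.

Lemma woper_mul_indic w B : (forall x, 1 <= w x) -> measurable B ->
  woper w 1 (fun h => \1_B \* h).
Proof.
move=> w1 mB.
have i1 x : `|(\1_B x : R)| <= 1.
  by rewrite indicE; case: (_ \in _); rewrite ?normr1 ?normr0.
split => //; last first.
  by move=> h [C _ [mh _]]; apply: measurable_funM => //; exact: measurable_indic.
move=> x; rewrite mul1r.
split.
- exact: le_trans (w1 x).
- by move=> a h g _ _ /=; ring.
- by move=> C h C0 [_ hC] /=; rewrite normrM [w x * C]mulrC (le_trans _ (hC x))// ler_piMl.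
- by move=> u h C C0 uC uh /=; apply: cvgMr; exact: uh.
Qed.

Lemma indicM B1 B2 : (\1_B1 : S -> R) \* \1_B2 = \1_(B1 `&` B2).
Proof. by apply/funext => x /=; rewrite indicI. Qed.

End measures_as_functionals.

(** * Signed measures and signed kernels of finite weighted norm *)
Section charges_as_functionals.
Context {d : measure_display} {S : measurableType d} {R : realType}.
Implicit Types (w h g : S -> R) (C M a : R) (B : set S).
Implicit Types (nu eta : {charge set S -> \bar R}).

Definition cint nu h : R := fine (cintegral nu (EFin \o h)).

(** Agreement is required on sets only; [represents_cint] extends it to the
    integrals of all the functions in L_w. *)
Definition represents (l : (S -> R) -> R) nu :=
  forall B, measurable B -> nu B = (l \1_B)%:E.

Section hahn.
Variable nu : {charge set S -> \bar R}.
Let p := jordan_pos (hahn_posneg nu).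
Let n := jordan_neg (hahn_posneg nu).

Lemma measurable_hahn_pos : measurable (hahn_pos nu).
Proof. by have [[]] := hahn_posneg nu. Qed.

Lemma measurable_hahn_neg : measurable (hahn_neg nu).
Proof. by have [_ []] := hahn_posneg nu. Qed.

Lemma hahn_posnegI : hahn_pos nu `&` hahn_neg nu = set0.
Proof. by have [] := hahn_posneg nu. Qed.

Lemma jordan_hahn_pos B : measurable B -> p B = nu (B `&` hahn_pos nu).
Proof. by move=> mB; rewrite /p jordan_posE cjordan_posE /crestr0 mem_set. Qed.

Lemma jordan_hahn_neg B : measurable B -> n B = (- nu (B `&` hahn_neg nu))%E.
Proof. by move=> mB; rewrite /n jordan_negE cjordan_negE /crestr0 mem_set. Qed.

Lemma jordan_pos_lty : (p [set: S] < +oo)%E.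
Proof. by rewrite ltey_eq fin_num_measure. Qed.

Lemma jordan_neg_lty : (n [set: S] < +oo)%E.
Proof. by rewrite ltey_eq fin_num_measure. Qed.

Lemma charge_jordan B : measurable B -> nu B = (p B - n B)%E.
Proof.
by move=> mB; rewrite (jordan_decomp (hahn_posneg nu) mB) /cadd/= cscaleN1.
Qed.

(** Integrability of w for the two variations is what makes the integral against
    nu a difference of finite integrals. *)
Lemma wfun_cint_jordan w M N : (forall x, 1 <= w x) -> measurable_fun [set: S] w ->
  (\int[p]_x (w x)%:E <= M%:E)%E -> (\int[n]_x (w x)%:E <= N%:E)%E ->
  [/\ wfun w (M + N) (cint nu), represents (cint nu) nu &
      forall h, Lw w h -> cintegral nu (EFin \o h) = (cint nu h)%:E].
Proof.
move=> w1 mw pM nN.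
have poo : (\int[p]_x (w x)%:E < +oo)%E by rewrite (le_lt_trans pM)// ltry.
have noo : (\int[n]_x (w x)%:E < +oo)%E by rewrite (le_lt_trans nN)// ltry.
have cE h : Lw w h -> cintegral nu (EFin \o h) = (rint p h - rint n h)%:E.
  by move=> Lh; rewrite /cintegral (rintE w1 mw poo Lh) (rintE w1 mw noo Lh).
have ciE h : Lw w h -> cint nu h = rint p h - rint n h.
  by move=> Lh; rewrite /cint cE.
have wpn := wfunl_sub (wfun_rint w1 mw pM) (wfun_rint w1 mw nN).
split.
- case: wpn => MN0 lin b c; split => //.
  + move=> a h g Lh Lg; rewrite !ciE//; first exact: lin.
    by apply: LwD => //; exact: LwZ.
  + by move=> C h C0 hC; rewrite ciE; [exact: b|exists C].
  + move=> u h C C0 uC uh; rewrite ciE; last by exists C => //; exact: bnd_cvg uh.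
    rewrite (_ : (fun n => _) = (fun k => rint p (u k) - rint n (u k))).
      exact: (c u h C C0 uC uh).
    by apply/funext => k; rewrite ciE//; exists C.
- move=> B mB; rewrite ciE; last exact: Lw_indic.
  rewrite !rint_indic// EFinB !fineK ?fin_num_measure//.
  exact: charge_jordan.
- by move=> h Lh; rewrite cE// ciE.
Qed.

End hahn.

Lemma bounded_Lw w h C : (forall x, 1 <= w x) -> measurable_fun [set: S] h ->
  (forall x, `|h x| <= C) -> Lw w h.
Proof.
move=> w1 mh hC; exists `|C| => //; split => // x.
by rewrite (le_trans (hC x))// (le_trans (ler_norm _))// ler_peMr.
Qed.

Lemma min_bounded w (k : nat) : (forall x, 1 <= w x) ->
  forall x, `|Num.min (w x) k%:R| <= k%:R.
Proof.
move=> w1 x; rewrite ger0_norm ?ge_min ?lexx ?orbT// le_min (le_trans _ (w1 x))//=.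
Qed.

(** The form l bounds the integrals of the truncations of w: on bounded functions
    mu and l can be compared through their values on sets. *)
Lemma represented_weight_le w M l (mu : {measure set S -> \bar R}) :
  (forall x, 1 <= w x) -> measurable_fun [set: S] w -> wfun w M l ->
  mu [set: S] \is a fin_num ->
  (forall B, measurable B -> mu B = (l \1_B)%:E) ->
  (\int[mu]_x (w x)%:E <= M%:E)%E.
Proof.
move=> w1 mw wl mufin mul.
have mu_lty : (mu [set: S] < +oo)%E by rewrite ltey_eq mufin.
apply: measure_weight_le => // k.
have mk : measurable_fun [set: S] (fun x => Num.min (w x) k%:R : R).
  by apply: measurable_minr.
have wmu : wfun (cst 1) (fine (mu [set: S])) (rint mu).
  apply: wfun_rint => //.
  by rewrite (_ : (fun x => _) = cst 1%E)// integral_cst// mul1e fineK.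
have wl1 : wfun (cst 1) (M * 1) l by apply: wfun_weight wl => // x; rewrite mul1r.
rewrite (wfun_eq _ wmu wl1) => //; last 2 first.
- by move=> B mB; rewrite rint_indic// mul.
- by apply: (@bounded_Lw _ _ k%:R) => //; exact: min_bounded.
apply: le_trans (ler_norm _) _; rewrite -[leRHS]mulr1.
apply: (wfun_bnd wl) => //; split => // x; rewrite mul1r ger0_norm ?ge_min ?lexx//.
by rewrite le_min (le_trans _ (w1 x))/=.
Qed.

Section wnorm.
Variables (w : S -> R) (w1 : forall x, 1 <= w x) (mw : measurable_fun [set: S] w).

Let w_gt0 x : 0 < w x. Proof. exact: lt_le_trans (w1 x). Qed.

Lemma wnorm_fun_le h C : (forall x, `|h x| <= C * w x) ->
  (wnorm_fun w (EFin \o h) <= C%:E)%E.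
Proof.
move=> hC; apply: ge_ereal_sup => _ [x _ <-] /=.
by rewrite inver gt_eqF//= -EFinM lee_fin ler_pdivrMr.
Qed.

Lemma wnorm_funP (g : S -> \bar R) C : (wnorm_fun w g <= C%:E)%E ->
  forall x, (`|g x| <= (C * w x)%:E)%E.
Proof.
move=> gC x; have : (`|g x| / (w x)%:E <= C%:E)%E.
  by apply: le_trans gC; apply: ereal_sup_ubound; exists x.
by rewrite inver gt_eqF// EFinM lee_pdivrMr.
Qed.

Lemma in_LwE h : in_Lw w h <-> Lw w h.
Proof.
split=> [[mh]|[C C0 [mh hC]]]; last first.
  by split => //; rewrite (le_lt_trans (wnorm_fun_le hC))// ltry.
move=> hoo; exists `|fine (wnorm_fun w (EFin \o h))| => //; split => // x.
rewrite -lee_fin; apply: (@le_trans _ _ (fine (wnorm_fun w (EFin \o h)) * w x)%:E).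
  apply: (wnorm_funP (g := EFin \o h)).
  rewrite fineK// fin_numE; apply/andP; split; last by rewrite lt_eqF.
  rewrite gt_eqF//; apply: lt_le_trans (ereal_sup_ubound _); last by exists x.
  by rewrite inver gt_eqF//= ltNyr.
by rewrite lee_fin ler_wpM2r ?ler_norm// ltW.
Qed.

(** The variations of nu are represented by the restrictions of l to the two
    halves of a Hahn decomposition, hence they integrate w. *)
Lemma represents_cint nu M l : wfun w M l -> represents l nu ->
  forall h, Lw w h -> cintegral nu (EFin \o h) = (l h)%:E.
Proof.
move=> wl lnu.
have mP := measurable_hahn_pos nu; have mN := measurable_hahn_neg nu.
have wlP := wfun_comp wl (woper_mul_indic w1 mP).
have wlN : wfun w M (fun h => - l (\1_(hahn_neg nu) \* h)).
  have := wfunl_sub (wfun_zero w) (wfun_comp wl (woper_mul_indic w1 mN)).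
  by rewrite add0r mulr1; congr wfun; apply/funext => h; rewrite sub0r.
have pM : (\int[jordan_pos (hahn_posneg nu)]_x (w x)%:E <= M%:E)%E.
  rewrite -[M]mulr1; apply: represented_weight_le wlP _ _ => //.
    exact: fin_num_measure.
  move=> B mB; apply: (etrans (jordan_hahn_pos nu mB)).
  by rewrite lnu /= ?indicM 1?setIC//; exact: measurableI.
have nM : (\int[jordan_neg (hahn_posneg nu)]_x (w x)%:E <= M%:E)%E.
  apply: represented_weight_le wlN _ _ => //.
    exact: fin_num_measure.
  move=> B mB; apply: (etrans (jordan_hahn_neg nu mB)).
  by rewrite lnu /= ?indicM 1?setIC//; exact: measurableI.
have [wc rc cE] := wfun_cint_jordan w1 mw pM nM.
move=> h Lh; rewrite cE//; congr EFin; apply: (wfun_eq w1 wc wl) => // B mB.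
by apply/EFin_inj; rewrite -rc// -lnu.
Qed.

Lemma wnorm_charge_le nu M l : wfun w M l -> represents l nu ->
  (wnorm_charge w nu <= M%:E)%E.
Proof.
move=> wl lnu; apply: ge_ereal_sup => _ [h [/in_LwE Lh h1] <-].
rewrite (represents_cint wl lnu Lh) lee_fin -[leRHS]mulr1.
apply: (wfun_bnd wl) => //; split; first by case: Lh => C _ [].
by move=> x; have := wnorm_funP h1 x; rewrite lee_fin.
Qed.

Lemma wnorm_charge_bound nu M : (wnorm_charge w nu <= M%:E)%E ->
  forall h, bnd w 1 h -> (`|cintegral nu (EFin \o h)| <= M%:E)%E.
Proof.
move=> nuM h h1; apply: le_trans nuM; apply: ereal_sup_ubound; exists h => //.
split; first by apply/in_LwE; exists 1.
by apply: wnorm_fun_le => x; exact: h1.2.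
Qed.

(** Testing against the truncations of w on the two halves of a Hahn
    decomposition bounds the integral of w for the two variations. *)
Lemma wnorm_charge_wfun nu M : 0 <= M -> (wnorm_charge w nu <= M%:E)%E ->
  wfun w M (cint nu) /\ represents (cint nu) nu.
Proof.
move=> M0 nuM.
have mP := measurable_hahn_pos nu; have mN := measurable_hahn_neg nu.
pose p := jordan_pos (hahn_posneg nu); pose n := jordan_neg (hahn_posneg nu).
have c1 (mu : {finite_measure set S -> \bar R}) : (\int[mu]_x (cst 1 x : R)%:E < +oo)%E.
  rewrite (_ : (fun x => _) = cst 1%E)// integral_cst// mul1e ltey_eq.
  by rewrite fin_num_measure.
have wr (mu : {finite_measure set S -> \bar R}) :
    wfun (cst 1) (fine (mu [set: S])) (rint mu).
  apply: wfun_rint => //.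
  rewrite (_ : (fun x => _) = cst 1%E)// integral_cst// mul1e fineK//.
  exact: fin_num_measure.
have i1 B x : `|(\1_B x : R)| <= 1.
  by rewrite indicE; case: (_ \in _); rewrite ?normr1 ?normr0.
have ci B g : measurable B -> measurable_fun [set: S] g -> (exists C, forall x, `|g x| <= C) ->
    cintegral nu (EFin \o (\1_B \* g)) = (rint p (\1_B \* g) - rint n (\1_B \* g))%:E.
  move=> mB mg [C gC].
  have L : Lw (cst 1) (\1_B \* g).
    apply: (@bounded_Lw _ _ C) => //.
      by apply: measurable_funM => //; exact: measurable_indic.
    by move=> x /=; rewrite normrM (le_trans _ (gC x))// ler_piMl.
  by rewrite /cintegral (rintE _ _ (c1 p) L)// (rintE _ _ (c1 n) L).
have rE (mu : {finite_measure set S -> \bar R}) B B' g : measurable B -> measurable B' ->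
    measurable_fun [set: S] g -> (exists C, forall x, `|g x| <= C) ->
    (forall A, measurable A -> mu (B `&` A) = mu (B' `&` A)) ->
    rint mu (\1_B \* g) = rint mu (\1_B' \* g).
  move=> mB mB' mg [C gC] muE.
  have Lg : Lw (cst 1) g by exact: (@bounded_Lw _ _ C).
  have u (A : set S) := fun mA : measurable A =>
    wfun_comp (wr mu) (woper_mul_indic (w := cst 1) (fun=> lexx 1) mA).
  apply: (wfun_eq _ (u _ mB) (u _ mB')) => // A mA /=.
  have mBA := measurableI _ _ mB mA; have mB'A := measurableI _ _ mB' mA.
  by rewrite !indicM !rint_indic//; congr fine; exact: muE.
have wk k : measurable_fun [set: S] (fun x => Num.min (w x) k%:R : R).
  by apply: measurable_minr.
have bk k : exists C, forall x, `|Num.min (w x) k%:R : R| <= C.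
  by exists k%:R; exact: min_bounded.
have b1 B k : measurable B -> bnd w 1 (\1_B \* (fun x => Num.min (w x) k%:R)).
  move=> mB; split; first by apply: measurable_funM => //; exact: measurable_indic.
  move=> x /=; rewrite mul1r normrM ger0_norm ?indic_ge0//.
  rewrite (@le_trans _ _ (`|Num.min (w x) k%:R|))//.
    by rewrite ler_piMl// (le_trans (ler_norm _))// i1.
  by rewrite ger0_norm ?ge_min ?lexx// le_min (le_trans _ (w1 x))/=.
have mT1 g : \1_[set: S] \* g = g by apply/funext => x /=; rewrite indicE in_setT mul1r.
have m01 g : (\1_(set0 : set S) : S -> R) \* g = cst 0.
  by apply/funext => x /=; rewrite indic0 mul0r.
have PN := hahn_posnegI nu.
have pP B : measurable B -> p (hahn_pos nu `&` B) = p B.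
  move=> mB; rewrite /p !jordan_hahn_pos//; last exact: measurableI.
  by rewrite setIAC setIid setIC.
have nN B : measurable B -> n (hahn_neg nu `&` B) = n B.
  move=> mB; rewrite /n !jordan_hahn_neg//; last exact: measurableI.
  by rewrite setIAC setIid setIC.
have pN B : measurable B -> p (hahn_neg nu `&` B) = 0%E.
  move=> mB; rewrite /p !jordan_hahn_pos//; last exact: measurableI.
  by rewrite setIAC [_ `&` hahn_pos _]setIC PN set0I charge0.
have nP B : measurable B -> n (hahn_pos nu `&` B) = 0%E.
  move=> mB; rewrite /n !jordan_hahn_neg//; last exact: measurableI.
  by rewrite setIAC PN set0I charge0 oppe0.
have r0 (mu : {finite_measure set S -> \bar R}) : rint mu (cst 0) = 0 by exact: (wfun0 _ (wr mu)).
have pM : (\int[p]_x (w x)%:E <= M%:E)%E.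
  apply: measure_weight_le => //; first exact: jordan_pos_lty.
  move=> k; have := wnorm_charge_bound nuM (b1 _ k mP).
  rewrite ci//= lee_fin.
  rewrite (rE p _ setT)//; last by move=> A mA; rewrite setTI; exact: pP.
  rewrite (rE n _ set0)//; last by move=> A mA; rewrite set0I; exact: etrans (nP A mA) (esym (measure0 n)).
  by rewrite mT1 m01 r0 subr0; apply: le_trans; exact: ler_norm.
have nM : (\int[n]_x (w x)%:E <= M%:E)%E.
  apply: measure_weight_le => //; first exact: jordan_neg_lty.
  move=> k; have := wnorm_charge_bound nuM (b1 _ k mN).
  rewrite ci//= lee_fin.
  rewrite (rE n _ setT)//; last by move=> A mA; rewrite setTI; exact: nN.
  rewrite (rE p _ set0)//; last by move=> A mA; rewrite set0I; exact: etrans (pN A mA) (esym (measure0 p)).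
  by rewrite mT1 m01 r0 sub0r normrN; apply: le_trans; exact: ler_norm.
have [wc rc cE] := wfun_cint_jordan w1 mw pM nM; have [_ lin b c] := wc.
split => //; split => //.
move=> C h C0 hC; have [C00|C_gt0] := eqVneq C 0.
  have := b C h C0 hC; rewrite C00 !mulr0//.
have Cp : 0 < C by rewrite lt_def C_gt0.
have Lh : Lw w h by exists C.
(* the supremum defining the norm ranges over functions of norm at most 1 *)
have h1 : bnd w 1 (C^-1 \*o h).
  by have := bndZ C^-1 hC; rewrite ger0_norm ?invr_ge0// mulVf.
have := wnorm_charge_bound nuM h1; rewrite cE; last by exists 1.
rewrite lee_fin (wfunZ w1 wc)// normrM.
by rewrite ger0_norm ?invr_ge0// mulrC ler_pdivrMr.
Qed.

Definition kint (Q : signed_kernel S R) h x : R := cint (Q x) h.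

Definition krepresents (T : (S -> R) -> S -> R) (Q : signed_kernel S R) :=
  forall x, represents (T ^~ x) (Q x).

Lemma wnorm_fun_ge0 (x0 : S) (g : S -> \bar R) : (0 <= wnorm_fun w g)%E.
Proof.
apply: (@le_trans _ _ (`|g x0| / (w x0)%:E)%E); last by apply: ereal_sup_ubound; exists x0.
by rewrite mule_ge0// inver gt_eqF// lee_fin invr_ge0 ltW.
Qed.

Lemma wnorm_fun_fin_num (x0 : S) h : Lw w h -> wnorm_fun w (EFin \o h) \is a fin_num.
Proof. by move=> /in_LwE[_ hoo]; rewrite ge0_fin_numE// wnorm_fun_ge0. Qed.

Lemma bnd_wnorm_fun (x0 : S) h : Lw w h -> bnd w (fine (wnorm_fun w (EFin \o h))) h.
Proof.
move=> Lh; split=> [|x]; first by case: Lh => C _ [].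
rewrite -lee_fin; apply: (wnorm_funP (g := EFin \o h)).
by rewrite fineK//; exact: wnorm_fun_fin_num.
Qed.

Lemma wnorm_skernel_le (x0 : S) Q M T : woper w M T -> krepresents T Q ->
  (wnorm_skernel w Q <= M%:E)%E.
Proof.
move=> wT TQ; apply: ge_ereal_sup => _ [h [/in_LwE Lh h0] <-].
have hfin := wnorm_fun_fin_num x0 Lh; have hb := bnd_wnorm_fun x0 Lh.
have h_gt0 : 0 < fine (wnorm_fun w (EFin \o h)).
  by rewrite -lte_fin fineK// lt_def h0 wnorm_fun_ge0.
rewrite -(fineK hfin) inver gt_eqF// lee_pdivrMr//.
rewrite -EFinM (_ : skernel_fun Q h = EFin \o T h); last first.
  by apply/funext => x; exact: (represents_cint (woper_wfun wT x) (TQ x) Lh).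
by apply: wnorm_fun_le; apply: (woper_bnd _ wT hb).2; exact: ltW.
Qed.

Lemma krepresents_measurable Q M T : woper w M T -> krepresents T Q -> skernel_measurable Q.
Proof.
move=> wT TQ B mB; rewrite (_ : (fun x => _) = EFin \o T \1_B).
  by apply/measurable_EFinP; apply: (woper_meas wT); exact: Lw_indic.
by apply/funext => x; exact: TQ.
Qed.

(** The operator norm of Q bounds the norms of the measures Q x, one point x at a
    time, and measurability of Q h is inherited from indicators. *)
Lemma wnorm_skernel_woper (x0 : S) Q M : 0 <= M -> skernel_measurable Q ->
  (wnorm_skernel w Q <= M%:E)%E -> woper w M (kint Q) /\ krepresents (kint Q) Q.
Proof.
move=> M0 mQ QM.
have wQ x : wfun w (M * w x) (kint Q ^~ x) /\ represents (kint Q ^~ x) (Q x).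
  apply: wnorm_charge_wfun; first by rewrite mulr_ge0// ltW.
  apply: ge_ereal_sup => _ [h [/in_LwE Lh h1] <-].
  have hfin := wnorm_fun_fin_num x0 Lh; have hb := bnd_wnorm_fun x0 Lh.
  have [h0|h0] := eqVneq (wnorm_fun w (EFin \o h)) 0%E.
    have -> : h = cst 0.
      apply/funext => y; apply/normr0_eq0/eqP; rewrite eq_le normr_ge0 andbT.
      by rewrite (le_trans (hb.2 y))// h0 mul0r.
    rewrite /cintegral (_ : EFin \o cst 0 = cst 0%E)//.
    by rewrite !integral0 sube0 abse0 lee_fin mulr_ge0// ltW.
  have h_gt0 : 0 < fine (wnorm_fun w (EFin \o h)).
    by rewrite -lte_fin fineK// lt_def h0 wnorm_fun_ge0.
  apply: (wnorm_funP (g := skernel_fun Q h)).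
  have : (wnorm_fun w (skernel_fun Q h) / wnorm_fun w (EFin \o h) <= M%:E)%E.
    apply: le_trans QM; apply: ereal_sup_ubound; exists h => //.
    by split => //; exact/in_LwE.
  rewrite -{1}(fineK hfin) inver gt_eqF// lee_pdivrMr// => /le_trans; apply.
  by rewrite fineK// -[leRHS]mule1 lee_wpmul2l.
split; last by move=> x; exact: (wQ x).2.
apply: woper_indic_meas => // [x|B mB]; first exact: (wQ x).1.
have -> : kint Q \1_B = fine \o (Q ^~ B).
  by apply/funext => x /=; rewrite ((wQ x).2 B mB).
by apply: measurableT_comp => //; exact: mQ.
Qed.

(** Conversely every form comes from a signed measure: the indicators of the
    partial unions of disjoint sets form a dominated convergent sequence. *)
Lemma exists_charge M l : wfun w M l -> exists nu, represents l nu.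
Proof.
move=> wl.
pose F B := if B \in measurable then (l \1_B)%:E else 0%E.
have FE B : measurable B -> F B = (l \1_B)%:E by move=> mB; rewrite /F mem_set.
have l0 : l (\1_(set0 : set S)) = 0.
  by rewrite indic0; exact: (wfun0 w1 wl).
have F0 : F set0 = 0%E by rewrite FE// l0.
have Ffin B : measurable B -> F B \is a fin_num by move=> mB; rewrite FE.
have FS : semi_sigma_additive F.
  move=> A mA tA mUA.
  have mU n : measurable (\big[setU/set0]_(i < n) A i) by exact: bigsetU_measurable.
  have -> : (fun n => \sum_(0 <= i < n) F (A i))%E =
      EFin \o (fun n => l \1_(\big[setU/set0]_(i < n) A i)).
    apply/funext => n /=; elim: n => [|n IH]; first by rewrite big_geq// big_ord0 l0.
    rewrite big_nat_recr//= IH big_ord_recr/= FE// -EFinD -(wfunD wl (Lw_indic w1 (mU n)) (Lw_indic w1 (mA n))).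
    congr (_%:E); congr l; apply/funext => x.
    rewrite /= !indicE in_setU; case: (boolP (x \in A n)) => [xA|]; last first.
      by rewrite orbF addr0.
    rewrite orbT memNset ?add0r//.
    rewrite -bigcup_mkord => -[i /= ni Ai].
    have := tA i n I I; rewrite ?(ltn_eqF ni) => H.
    have : i = n by apply: H; exists x; split=> //; exact: set_mem.
    by move=> e; rewrite e ltnn in ni.
  rewrite FE//; apply: cvg_EFin; first exact: nearW.
  apply: (wfun_cvg wl (C := 1)) => // [n|x].
    split; first exact: measurable_indic.
    move=> x; rewrite mul1r indicE (le_trans _ (w1 x))//.
    by case: (_ \in _); rewrite ?normr1 ?normr0.
  have [[k _ Ak]|nA] := pselect ((\bigcup_n A n) x); last first.
    rewrite [X in _ --> X]indicE memNset// (_ : (fun n => _) = cst 0); first exact: cvg_cst.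
    apply/funext => n; rewrite indicE memNset// -bigcup_mkord => -[i _ Ai].
    by apply: nA; exists i.
  rewrite [X in _ --> X]indicE mem_set; last by exists k.
  apply: cvg_near_cst; near=> n; rewrite indicE mem_set// -bigcup_mkord; exists k => //=.
  by near: n; exact: nbhs_infty_gt.
pose nuC := isCharge.Build _ S R F F0 Ffin FS.
pose nu : {charge set S -> \bar R} := HB.pack F nuC.
by exists nu => B mB; exact: FE.
Unshelve. all: by end_near. Qed.

Lemma charge_ofP M l (F : set S -> \bar R) : wfun w M l ->
  (forall B, measurable B -> F B = (l \1_B)%:E) -> represents l (charge_of F).
Proof.
move=> wl Fl B mB; rewrite /charge_of; case: pselect => [H|]; last first.
  move=> H; exfalso; apply: H; have [nu nul] := exists_charge wl.
  by exists nu => A mA; rewrite nul// Fl.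
by case: (cid H) => nu /= ->//; exact: Fl.
Qed.

Lemma represents_act M N l T nu Q : wfun w M l -> woper w N T ->
  represents l nu -> krepresents T Q -> represents (l \o T) (skernel_act nu Q).
Proof.
move=> wl wT lnu TQ; apply: charge_ofP; first exact: wfun_comp wl wT.
move=> B mB.
rewrite (_ : (fun x => Q x B) = EFin \o T \1_B); last by apply/funext => x; exact: TQ.
apply: (represents_cint wl lnu); apply: woper_Lw wT _; exact: Lw_indic.
Qed.

Lemma krepresents_comp M N T U Q Q' : woper w M T -> woper w N U ->
  krepresents T Q -> krepresents U Q' -> krepresents (T \o U) (skernel_comp Q Q').
Proof. by move=> wT wU TQ UQ x; exact: (represents_act (woper_wfun wT x) wU). Qed.

Lemma exists_skernel M T : woper w M T -> exists Q, krepresents T Q.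
Proof.
move=> wT; have H x := cid (exists_charge (woper_wfun wT x)).
by exists (fun x => sval (H x)) => x; case: (H x).
Qed.

Lemma exists_probability M l : wfun w M l ->
  (forall B, measurable B -> 0 <= l \1_B) -> l (cst 1) = 1 ->
  exists mu : probability S R, forall B, measurable B -> mu B = (l \1_B)%:E.
Proof.
move=> wl l_ge0 l1; have [nu0 nu0l] := exists_charge wl.
pose nu : {charge set S -> \bar R} := crestr0 nu0 (@measurableT _ S).
have nuE B : measurable B -> nu B = (l \1_B)%:E.
  by move=> mB; rewrite /nu/= /crestr0 mem_set// /crestr/= setIT nu0l.
have nu_ge0 E : (0 <= nu E)%E.
  rewrite /nu/= /crestr0; case: ifPn => // /set_mem mE.
  by rewrite /crestr/= setIT nu0l// lee_fin l_ge0.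
pose mu : {measure set S -> \bar R} := measure_of_charge nu nu_ge0.
have muT : mu [set: S] = 1%E.
  by apply: (etrans (nuE _ measurableT)); rewrite indicT l1.
pose muP := Measure_isProbability.Build _ _ _ mu muT.
pose P : probability S R := HB.pack (mu : set S -> \bar R) mu muP.
by exists P => B mB; exact: nuE.
Qed.

End wnorm.

Lemma represents_sub l k nu eta : represents l nu -> represents k eta ->
  represents (fun h => l h - k h) (csub nu eta).
Proof. by move=> lnu keta B mB; rewrite (_ : csub nu eta B = nu B - eta B)%E// lnu// keta. Qed.

Lemma represents_add l k nu eta : represents l nu -> represents k eta ->
  represents (fun h => l h + k h) (cadd nu eta).
Proof. by move=> lnu keta B mB; apply: (@etrans _ _ (nu B + eta B)%E) => //; rewrite lnu// keta. Qed.

Lemma represents_scale l nu a : represents l nu -> represents (fun h => a * l h) (cscale a nu).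
Proof. by move=> lnu B mB; apply: (@etrans _ _ (a%:E * nu B)%E) => //; rewrite lnu. Qed.

End charges_as_functionals.

(** * Neumann series *)
Section neumann.
Context {d : measure_display} {S : measurableType d} {R : realType}.
Implicit Types (w v h g : S -> R) (C M a q : R) (B : set S).
Implicit Types (T Q : (S -> R) -> S -> R).

Definition pos_oper w T :=
  forall h, Lw w h -> (forall x, 0 <= h x) -> forall x, 0 <= T h x.

Section woper_theory.
Variables (w : S -> R) (w1 : forall x, 1 <= w x).
Variables (M : R) (T : (S -> R) -> S -> R) (wT : woper w M T).

Lemma woperD h g : Lw w h -> Lw w g -> T (h \+ g) = T h \+ T g.
Proof. by move=> Lh Lg; apply/funext => x; exact: (wfunD (woper_wfun wT x)). Qed.

Lemma woperB h g : Lw w h -> Lw w g -> T (h \- g) = T h \- T g.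
Proof. by move=> Lh Lg; apply/funext => x; exact: (wfunB (woper_wfun wT x)). Qed.

Lemma woperZ a h : Lw w h -> T (a \*o h) = a \*o T h.
Proof. by move=> Lh; apply/funext => x; exact: (wfunZ w1 (woper_wfun wT x)). Qed.

Lemma woper0 : T (cst 0) = cst 0.
Proof. by apply/funext => x; exact: (wfun0 w1 (woper_wfun wT x)). Qed.

Lemma pos_oper_mono h g : pos_oper w T -> Lw w h -> Lw w g ->
  (forall x, h x <= g x) -> forall x, T h x <= T g x.
Proof.
move=> T0 Lh Lg hg x; rewrite -subr_ge0.
have := T0 (g \- h) (LwB Lg Lh); rewrite woperB//; apply.
by move=> y; rewrite subr_ge0.
Qed.

Lemma woper_weight v k k' : 0 <= k -> 0 <= k' -> (forall x, v x <= k * w x) ->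
  (forall x, w x <= k' * v x) -> woper v (M * k' * k) T.
Proof.
move=> k0 k'0 vw wv; have M0 := woper_ge0 wT.
split; first by rewrite !mulr_ge0.
- move=> x; have := wfun_weight k0 vw (woper_wfun wT x).
  apply: wfun_le; rewrite (_ : M * k' * k * v x = M * (k' * v x) * k); last by ring.
  by rewrite ler_wpM2r// ler_wpM2l.
- move=> h [C C0 [mh hC]]; apply: (woper_meas wT).
  exists (C * k); first exact: mulr_ge0.
  by split => // x; rewrite (le_trans (hC x))// -mulrA ler_wpM2l.
Qed.

(** For a positive operator the norm is read off its value at the weight. *)
Lemma pos_woper q : measurable_fun [set: S] w -> pos_oper w T -> 0 <= q ->
  (forall x, T w x <= q * w x) -> woper w q T.
Proof.
move=> mw T0 q0 Tq.
have w0 x : 0 <= w x by exact: le_trans (w1 x).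
have Lww : Lw w w by exact: Lw_self.
split => //; last exact: (woper_meas wT).
move=> x; have [_ lin b c] := woper_wfun wT x.
split => //; first exact: mulr_ge0.
move=> C h C0 hC; have Lh : Lw w h by exists C.
have hle y : h y <= (C \*o w) y by exact: le_trans (ler_norm _) (hC.2 y).
have hge y : ((- C) \*o w) y <= h y.
  by have := hC.2 y; rewrite ler_norml => /andP[+ _]; rewrite /= mulNr.
have := pos_oper_mono T0 Lh (LwZ C Lww) hle x.
have := pos_oper_mono T0 (LwZ (- C) Lww) Lh hge x.
rewrite !woperZ//= => H1 H2; rewrite ler_norml.
have CT : C * T w x <= q * w x * C by rewrite mulrC ler_wpM2r.
by lra.
Qed.

End woper_theory.

Section neumann_series.
Variables (w : S -> R) (w1 : forall x, 1 <= w x).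
Variables (q : R) (T : (S -> R) -> S -> R) (wT : woper w q T) (q1 : q < 1).

Let w0 x : 0 <= w x. Proof. exact: le_trans (w1 x). Qed.
Let q0 : 0 <= q. Proof. exact: woper_ge0 wT. Qed.
Let D := (1 - q)^-1.
Let D0 : 0 <= D. Proof. by rewrite invr_ge0 subr_ge0 ltW. Qed.

(** The partial sum of the T^k h over k < n. *)
Fixpoint neumann_sum n h : S -> R :=
  if n is k.+1 then h \+ T (neumann_sum k h) else cst 0.
Local Notation Sn := neumann_sum.

Lemma woper_neumann_sum n : woper w D (Sn n).
Proof.
elim: n => [|n IH] /=.
  by split => // x; apply: wfun_le (wfun_zero w); rewrite mulr_ge0.
have := woper_lin 1 (woper_id w1) (woper_comp wT IH).
rewrite normr1 mul1r (_ : 1 + q * D = D); last first.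
  have q1' : 1 - q != 0 by rewrite gt_eqF// subr_gt0.
  by rewrite /D; field.
by congr woper; apply/funext => h; apply/funext => x /=; rewrite mul1r.
Qed.

Lemma neumann_sumS n h : Lw w h -> Sn n.+1 h = h \+ Sn n (T h).
Proof.
move=> Lh; have LTh := woper_Lw wT Lh.
elim: n => [|n IH]; first by rewrite /= (woper0 w1 wT).
rewrite [LHS]/= -/(Sn n.+1 h) IH (woperD wT)//.
exact: woper_Lw (woper_neumann_sum n) LTh.
Qed.

(** The difference is T^n applied to the k-th partial sum. *)
Lemma neumann_sum_tail n k C h : 0 <= C -> bnd w C h ->
  bnd w (q ^+ n * (D * C)) (Sn (n + k) h \- Sn n h).
Proof.
move=> C0 hC; have Lh : Lw w h by exists C.
elim: n => [|n IH].
  rewrite expr0 mul1r add0n (_ : _ \- _ = Sn k h); first exact: woper_bnd (woper_neumann_sum k) hC.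
  by apply/funext => x /=; rewrite subr0.
rewrite addSn exprS -mulrA.
have -> : Sn (n + k).+1 h \- Sn n.+1 h = T (Sn (n + k) h \- Sn n h).
  rewrite (woperB wT); [|exact: woper_Lw (woper_neumann_sum _) Lh..].
  by apply/funext => x /=; ring.
by apply: woper_bnd wT IH; rewrite !mulr_ge0// exprn_ge0.
Qed.

Definition neumann h : S -> R := fun x => limn (fun n => Sn n h x).
Local Notation N := neumann.

Lemma cvg_geom e a : 0 < e -> exists n, q ^+ n * a <= e.
Proof.
move=> e0.
have : q ^+ n * a @[n --> \oo] --> 0 * a.
  by apply: cvgMl; apply: cvg_expr; rewrite ger0_norm.
rewrite mul0r => /cvgrPdist_le /(_ e e0) [n _ /(_ n (leqnn n))] /=.
rewrite sub0r normrN => H; exists n; exact: le_trans (ler_norm _) H.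
Qed.

Lemma neumann_cvg h : Lw w h -> forall x, Sn n h x @[n --> \oo] --> N h x.
Proof.
move=> [C C0 hC] x; apply: cauchy_cvg; apply: cauchy_exP => e e0.
have [n0 Hn] := cvg_geom (D * C * w x) (divr_gt0 e0 (ltr0Sn R 1)).
exists (Sn n0 h x).
suff: \forall n \near \oo, ball (Sn n0 h x) e (Sn n h x) by [].
near=> n; have n0n : (n0 <= n)%N by near: n; exact: nbhs_infty_ge.
rewrite /= -ball_normE /= distrC.
have := (neumann_sum_tail n0 (n - n0) C0 hC).2 x; rewrite subnKC//= => H.
rewrite (le_lt_trans H)// -mulrA; apply: le_lt_trans Hn _.
by lra.
Unshelve. all: by end_near. Qed.

Lemma neumann_tail n C h x : 0 <= C -> bnd w C h ->
  `|N h x - Sn n h x| <= q ^+ n * (D * C) * w x.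
Proof.
move=> C0 hC; have Lh : Lw w h by exists C.
have H : `|Sn k h x - Sn n h x| @[k --> \oo] --> `|N h x - Sn n h x|.
  apply: cvg_norm; apply: cvgB; last exact: cvg_cst.
  exact: neumann_cvg.
rewrite -(cvg_lim _ H)//; apply: limr_le; first exact: cvgP H.
near=> k.
have nk : (n <= k)%N by near: k; exact: nbhs_infty_ge.
by have := (neumann_sum_tail n (k - n) C0 hC).2 x; rewrite subnKC.
Unshelve. all: by end_near. Qed.

(** Dominated continuity passes to the sum because the tails are uniformly small
    on a ball of L_w. *)
Lemma woper_neumann : woper w D N.
Proof.
split => //; last first.
  move=> h Lh; apply: (@measurable_fun_cvg _ _ _ _ (fun n => Sn n h)) => [n|x _].
    exact: woper_meas (woper_neumann_sum n) _ Lh.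
  exact: neumann_cvg.
move=> x; split; first exact: mulr_ge0.
- move=> a h g Lh Lg; have Lc : Lw w (a \*o h \+ g) by apply: LwD => //; exact: LwZ.
  have H := @neumann_cvg _ Lc x.
  have H' : Sn n (a \*o h \+ g) x @[n --> \oo] --> a * N h x + N g x.
    rewrite (_ : (fun n => _) = (fun n => a * Sn n h x + Sn n g x)).
      by apply: cvgD; [apply: cvgMr|]; exact: neumann_cvg.
    by apply/funext => n; exact: (wfun_lin (woper_wfun (woper_neumann_sum n) x)).
  by rewrite -(cvg_lim _ H)// -(cvg_lim _ H').
- move=> C h C0 hC; have := neumann_tail 0 x C0 hC.
  by rewrite expr0 mul1r /= subr0 mulrAC.
- move=> u h C C0 uC uh; apply/cvgrPdist_le => e e0.
  have [n Hn] := cvg_geom (D * C * w x) (divr_gt0 e0 (ltr0Sn R 2)).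
  have := wfun_cvg (woper_wfun (woper_neumann_sum n) x) C0 uC uh.
  move=> /cvgrPdist_le /(_ _ (divr_gt0 e0 (ltr0Sn R 2))); apply: filterS => k Hk.
  have hC := bnd_cvg uC uh.
  have H1 := neumann_tail n x C0 hC; have H2 := neumann_tail n x C0 (uC k).
  rewrite (_ : N h x - N (u k) x = (N h x - Sn n h x) - (N (u k) x - Sn n (u k) x) +
     (Sn n h x - Sn n (u k) x)); last by ring.
  rewrite (le_trans (ler_normD _ _))//.
  rewrite (le_trans (lerD (ler_normB _ _) Hk))//.
  by rewrite -mulrA in H1; rewrite -mulrA in H2; lra.
Qed.

Lemma neumannE h : Lw w h -> N h = h \+ T (N h).
Proof.
move=> Lh; have [C C0 hC] := Lh; apply/funext => x /=.
have H := @neumann_cvg _ Lh x; rewrite -(cvg_shiftS (fun n => Sn n h x)) in H.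
have H' : h x + T (Sn n h) x @[n --> \oo] --> h x + T (N h) x.
  apply: cvgD; first exact: cvg_cst.
  apply: (wfun_cvg (woper_wfun wT x) (C := D * C)); first exact: mulr_ge0.
    by move=> n; exact: woper_bnd (woper_neumann_sum n) hC.
  by move=> y; exact: neumann_cvg.
by rewrite -(cvg_lim _ H)// -(cvg_lim _ H').
Qed.

Lemma neumannEr h : Lw w h -> N h = h \+ N (T h).
Proof.
move=> Lh; apply/funext => x /=.
have H := @neumann_cvg _ Lh x; rewrite -(cvg_shiftS (fun n => Sn n h x)) in H.
have H' : Sn n.+1 h x @[n --> \oo] --> h x + N (T h) x.
  rewrite (_ : (fun n => _) = (fun n => h x + Sn n (T h) x)); last first.
    by apply/funext => n; rewrite neumann_sumS.
  by apply: cvgD; [exact: cvg_cst|apply: neumann_cvg; exact: woper_Lw wT Lh].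
by rewrite -(cvg_lim _ H)// -(cvg_lim _ H').
Qed.

Lemma pos_neumann : pos_oper w T -> pos_oper w N.
Proof.
move=> T0 h Lh h0 x; have H := @neumann_cvg _ Lh x.
rewrite -(cvg_lim _ H)//; apply: limr_ge; first exact: cvgP H.
apply: nearW => n; elim: n x {H} => [|n IH] x //=.
rewrite addr_ge0//; apply: T0 => //; exact: woper_Lw (woper_neumann_sum n) Lh.
Qed.

End neumann_series.
End neumann.

(** * Poisson's equation under drift and minorization *)
Section geometric_drift.
Context {d : measure_display} {S : measurableType d} {R : realType}.
Implicit Types (h g u : S -> R).
Variables (w : S -> R) (w1 : forall x, 1 <= w x) (mw : measurable_fun [set: S] w).
Variables (P : (S -> R) -> S -> R) (MP : R).
Hypotheses (wP : woper w MP P) (P_pos : pos_oper w P) (P1 : P (cst 1) = cst 1).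
Variables (r c lam : R) (A : set S) (m : nat).
Hypotheses (r01 : 0 < r < 1) (c0 : 0 < c) (lam0 : 0 < lam) (mA : measurable A).
Hypothesis drift : forall x, P w x <= r * w x + c * \1_A x.
Variables (phi : (S -> R) -> R) (Mphi : R).
Hypotheses (wphi : wfun w Mphi phi) (phi_ge0 : forall B, measurable B -> 0 <= phi \1_B).
Hypothesis phi1 : phi (cst 1) = 1.
Hypothesis minor : forall h, Lw w h -> (forall x, 0 <= h x) ->
  forall x, A x -> lam * phi h <= iter m P h x.

Let w_ge0 x : 0 <= w x. Proof. exact: le_trans (w1 x). Qed.
Let Lww : Lw w w. Proof. exact: Lw_self. Qed.
Let Lcst a : Lw w (cst a). Proof. exact: Lw_cst. Qed.
Let LA : Lw w \1_A. Proof. exact: Lw_indic. Qed.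
(* P has norm at most 1 + c, so that b P has norm at most 1/2 *)
Let b := (2 * (1 + c))^-1.
Let b0 : 0 < b. Proof. by rewrite invr_gt0; have := c0; lra. Qed.
Let b1 : b < 1.
Proof. by rewrite /b invf_lt1; have := c0; lra. Qed.

Let bP h : S -> R := b \*o P h.

Let bP_woper : woper w (2^-1) bP.
Proof.
apply: (pos_woper w1 (woper_scale b wP)) => //; last first.
- move=> x /=.
  have Pw : P w x <= (1 + c) * w x.
    rewrite (le_trans (drift x))// mulrDl; apply: lerD.
      by rewrite ler_wpM2r//; have /andP[_ /ltW] := r01.
    by rewrite ler_wpM2l ?(ltW c0)// (le_trans _ (w1 x))// indicE; case: (x \in A).
  rewrite (le_trans (ler_wpM2l (ltW b0) Pw))// mulrA ler_wpM2r//.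
  by rewrite /b invfM -mulrA mulVf ?mulr1//; have := c0; lra.
- by move=> h Lh h0 x /=; rewrite mulr_ge0 ?(ltW b0)//; exact: P_pos.
Qed.

Let half_lt1 : 2^-1 < 1 :> R. Proof. by lra. Qed.

Let Rs := neumann bP.

Let wR : woper w (1 - 2^-1)^-1 Rs.
Proof. exact: woper_neumann. Qed.

Let LR h : Lw w h -> Lw w (Rs h). Proof. exact: woper_Lw wR. Qed.
Let LP h : Lw w h -> Lw w (P h). Proof. exact: woper_Lw wP. Qed.

Let R_pos : pos_oper w Rs.
Proof.
apply: (pos_neumann w1 bP_woper half_lt1) => h Lh h0 x /=.
by rewrite mulr_ge0 ?(ltW b0)//; exact: P_pos.
Qed.

Let RE h x : Lw w h -> Rs h x = h x + b * P (Rs h) x.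
Proof. by move=> Lh; rewrite {1}/Rs (neumannE w1 bP_woper half_lt1). Qed.

Let REr h x : Lw w h -> Rs h x = h x + b * Rs (P h) x.
Proof.
move=> Lh; rewrite {1}/Rs (neumannEr w1 bP_woper half_lt1 Lh) /= -/Rs.
by rewrite /bP (woperZ w1 wR)//; exact: LP.
Qed.

Let R1 x : Rs (cst 1) x = (1 - b)^-1.
Proof.
have := REr x (Lcst 1); rewrite P1 /= => H.
have nb : 1 - b != 0 by rewrite subr_eq0 gt_eqF.
apply: (mulfI nb); rewrite mulfV//; lra.
Qed.

Let s := Rs \1_A.
Let Ls : Lw w s. Proof. exact: LR. Qed.
Let s_ge0 x : 0 <= s x.
Proof. by apply: R_pos => // y; rewrite indicE. Qed.

(** Averaging P over its powers turns the drift towards A and the minorization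
    on A, which concern different powers of P, into statements about one and
    the same function s. *)
Let K h : S -> R := (1 - b) \*o Rs h.
Let wK := woper_scale (1 - b) wR.
Let LK h : Lw w h -> Lw w (K h). Proof. exact: woper_Lw wK. Qed.

Let R_drift x : (1 - b * r) * Rs w x <= w x + b * c * s x.
Proof.
have /andP[r0 r1] := r01.
have H : Rs (P w) x <= r * Rs w x + c * s x.
  have -> : r * Rs w x + c * s x = Rs (r \*o w \+ c \*o \1_A) x.
    by rewrite (woperD wR) ?(woperZ w1 wR)//; exact: LwZ.
  apply: (pos_oper_mono wR) => //; first exact: LP.
  by apply: LwD; exact: LwZ.
have := REr x Lww; have := ler_wpM2l (ltW b0) H; lra.
Qed.

Let R_minor k h : Lw w h -> (forall x, 0 <= h x) -> forall x,
  b ^+ k * Rs (iter k P h) x <= Rs h x.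
Proof.
move=> Lh h0; have [] : (forall x, b ^+ k * Rs (iter k P h) x <= Rs h x) /\
    (Lw w (iter k P h) /\ forall x, 0 <= iter k P h x).
  elim: k => [|k [IH [Lk k0]]]; first by split => // x; rewrite expr0 mul1r.
  split; last by split; [exact: LP|exact: P_pos].
  move=> x; apply: le_trans (IH x); rewrite exprSr -mulrA iterS.
  rewrite ler_wpM2l ?exprn_ge0 ?(ltW b0)// (REr x Lk).
  by rewrite lerDr.
by [].
Qed.

Let lam' := (1 - b) * b ^+ m * lam.
Let lam'_gt0 : 0 < lam'.
Proof. by rewrite !mulr_gt0 ?subr_gt0// exprn_gt0. Qed.

Let phi_pos h : Lw w h -> (forall x, 0 <= h x) -> 0 <= phi h.
Proof. exact: (wfun_indic_ge0 w1 wphi). Qed.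

(* the terms k >= m of the resolvent dominate b^m R P^m *)
Let K_minor h : Lw w h -> (forall x, 0 <= h x) -> forall x,
  lam' * phi h * s x <= K h x.
Proof.
move=> Lh h0 x; rewrite /K/= /lam' -!mulrA ler_wpM2l ?subr_ge0 ?(ltW b1)//.
apply: le_trans (R_minor m Lh h0 x); rewrite ler_wpM2l ?exprn_ge0 ?(ltW b0)//.
have Lm : Lw w (iter m P h) by elim: (m) => //= k; exact: LP.
have Pm0 y : 0 <= iter m P h y.
  have [] : Lw w (iter m P h) /\ forall y, 0 <= iter m P h y.
    by elim: (m) => //= k [Lk k0]; split; [exact: LP|exact: P_pos].
  by [].
have -> : lam * (phi h * s x) = Rs ((lam * phi h) \*o \1_A) x.
  by rewrite (woperZ w1 wR)//= mulrA.
apply: (pos_oper_mono wR) => //; first exact: LwZ.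
move=> y /=; rewrite indicE; case: (boolP (y \in A)) => yA; last by rewrite mulr0.
by rewrite mulr1; apply: minor => //; exact: set_mem.
Qed.

(** What is left of K once the part regenerating according to phi is removed. *)
Let T h : S -> R := (- lam') \*o (phi h \*o s) \+ K h.

Let TE h x : T h x = K h x - lam' * phi h * s x.
Proof. by rewrite /T /=; ring. Qed.

Let wT0 : exists M, woper w M T.
Proof.
have [C C0 sC] := Ls.
exists (`|- lam'| * (C * Mphi) + `|1 - b| * (1 - 2^-1)^-1).
exact: woper_lin (woper_rank1 C0 sC wphi) wK.
Qed.

Let T_pos : pos_oper w T.
Proof. by move=> h Lh h0 x; rewrite TE subr_ge0; exact: K_minor. Qed.

Let r' := (1 - b) / (1 - b * r).
Let c' := (1 - b) * (b * c) / (1 - b * r).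
Let br : 0 < 1 - b * r.
Proof. by have /andP[r0 r1] := r01; rewrite subr_gt0 (lt_trans _ b1)// gtr_pMr. Qed.
Let r'_gt0 : 0 < r'.
Proof. by rewrite divr_gt0// subr_gt0. Qed.
Let r'_lt1 : r' < 1.
Proof.
have /andP[r0 r1] := r01.
by rewrite ltr_pdivrMr// mul1r ltrD2l ltrN2 gtr_pMr.
Qed.
Let c'_gt0 : 0 < c'.
Proof. by rewrite divr_gt0// !mulr_gt0// subr_gt0. Qed.

Let K_drift x : K w x <= r' * w x + c' * s x.
Proof.
have -> : r' * w x + c' * s x = (1 - b) * ((w x + b * c * s x) / (1 - b * r)).
  by rewrite /r' /c'; field; rewrite gt_eqF.
rewrite /K /= ler_wpM2l ?subr_ge0 ?(ltW b1)// ler_pdivlMr// mulrC.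
exact: R_drift.
Qed.

Let K1 x : K (cst 1) x = 1.
Proof. by rewrite /K/= R1 mulfV// subr_eq0 gt_eqF. Qed.

Let D := c' / lam'.
Let D_gt0 : 0 < D. Proof. exact: divr_gt0. Qed.

(** Adding a constant to w compensates c' s by the mass lam' s that T loses. *)
Let V x := w x + D.
Let V1 x : 1 <= V x. Proof. by rewrite /V (le_trans (w1 x))// lerDl ltW. Qed.
Let mV : measurable_fun [set: S] V.
Proof. exact: measurable_funD. Qed.
Let q := (r' + D) / (1 + D).
Let q_ge0 : 0 <= q.
Proof. by rewrite divr_ge0// addr_ge0// ltW. Qed.
Let q_lt1 : q < 1.
Proof.
have D1 : 0 < 1 + D by rewrite addr_gt0.
by rewrite ltr_pdivrMr// mul1r ltrD2r.
Qed.

Let V_le x : V x <= (1 + D) * w x.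
Proof. by rewrite /V mulrDl mul1r lerD2l ler_peMr// ltW. Qed.
Let le_V x : w x <= 1 * V x.
Proof. by rewrite mul1r lerDl ltW. Qed.

Let LV h : Lw w h <-> Lw V h.
Proof.
split => [|[C C0 [mh hC]]]; first by apply: Lw_le => x; rewrite -[leRHS]mul1r.
exists (C * (1 + D)); first by rewrite mulr_ge0// addr_ge0// ltW.
by split => // x; rewrite (le_trans (hC x))// -mulrA ler_wpM2l.
Qed.

Let T1 x : T (cst 1) x = 1 - lam' * s x.
Proof. by rewrite TE K1 phi1 mulr1. Qed.

Let T_drift x : T V x <= q * V x.
Proof.
have [M wT] := wT0.
have -> : T V x = T w x + D * T (cst 1) x.
  rewrite -[V]/(w \+ cst D) (woperD wT)//= (_ : cst D = D \*o cst 1); last first.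
    by apply/funext => y /=; rewrite mulr1.
  by rewrite (woperZ w1 wT).
have D1 : 0 < 1 + D by rewrite addr_gt0.
have phiw : 0 <= lam' * phi w * s x.
  by rewrite mulr_ge0// mulr_ge0 ?(ltW lam'_gt0)//; exact: phi_pos.
have Tw : T w x <= r' * w x + c' * s x.
  by rewrite TE (le_trans _ (K_drift x))// gerBl.
have DT : D * T (cst 1) x = D - c' * s x.
  by rewrite T1 /D; field; rewrite gt_eqF.
have qE : q * (1 + D) = r' + D by rewrite /q mulfVK// gt_eqF.
have qr : 0 <= q - r'.
  rewrite subr_ge0 /q ler_pdivlMr// mulrDr mulr1 lerD2l ger_pMl//; exact: ltW.
have := ler_wpM2l qr (w1 x).
rewrite DT /V; lra.
Qed.

Let wT : woper V q T.
Proof.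
have [M wT] := wT0.
apply: (pos_woper V1 (woper_weight wT (addr_ge0 ler01 (ltW D_gt0)) ler01 V_le le_V)) => //.
by move=> h /LV Lh; exact: T_pos.
Qed.

Let N := neumann T.

Let wN : exists M, woper w M N.
Proof.
eexists; apply: (woper_weight (woper_neumann V1 wT q_lt1) ler01 (addr_ge0 ler01 (ltW D_gt0))).
  exact: le_V.
exact: V_le.
Qed.

Let LN h : Lw w h -> Lw w (N h).
Proof. by case: wN => M; exact: woper_Lw. Qed.

Let N_pos : pos_oper w N.
Proof.
move=> h /LV Lh; apply: (pos_neumann V1 wT q_lt1) => // g /LV Lg.
exact: T_pos.
Qed.

Let NE h x : Lw w h -> N h x = h x + T (N h) x.
Proof. by move=> /LV Lh; rewrite {1}/N (neumannE V1 wT q_lt1). Qed.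

Let NEr h x : Lw w h -> N h x = h x + N (T h) x.
Proof. by move=> /LV Lh; rewrite {1}/N (neumannEr V1 wT q_lt1). Qed.

Let ND h g x : Lw w h -> Lw w g -> N (h \+ g) x = N h x + N g x.
Proof. by move=> Lh Lg; have [M wN'] := wN; rewrite (woperD wN'). Qed.

Let NZ a h x : Lw w h -> N (a \*o h) x = a * N h x.
Proof. by move=> Lh; have [M wN'] := wN; rewrite (woperZ w1 wN'). Qed.

Let LT h : Lw w h -> Lw w (T h).
Proof. by move=> Lh; have [M wT'] := wT0; exact: woper_Lw wT' Lh. Qed.

(* N applied to (I - T) 1 = lam' s *)
Let Ns x : lam' * N s x = 1.
Proof.
have := NEr x (Lcst 1).
rewrite (_ : T (cst 1) = (- lam') \*o s \+ cst 1); last first.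
  by apply/funext => y; rewrite T1 /=; ring.
rewrite ND//; last exact: LwZ.
by rewrite NZ//=; lra.
Qed.

Let NK h x : Lw w h -> N (K h) x = N h x - h x + phi h.
Proof.
move=> Lh; have -> : K h = T h \+ (lam' * phi h) \*o s.
  by apply/funext => y /=; rewrite TE; ring.
rewrite ND ?NZ//; [|exact: LT|exact: LwZ].
have -> : lam' * phi h * N s x = phi h by rewrite mulrAC Ns mul1r.
by have := NEr x Lh; lra.
Qed.

(** The expected occupation measure of a regeneration cycle. *)
Let psi h := phi (N h).

Let wpsi : exists M, wfun w M psi.
Proof. by have [M wN'] := wN; eexists; exact: wfun_comp wphi wN'. Qed.

Let psi_indic B : measurable B -> 0 <= psi \1_B.
Proof.
move=> mB; have LB : Lw w \1_B by exact: Lw_indic.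
by apply: phi_pos; [exact: LN|apply: N_pos => // x; rewrite indicE; case: (x \in B)].
Qed.

Let psi1 : 1 <= psi (cst 1).
Proof.
rewrite -[X in X <= _]phi1; apply: (wfun_mono w1 wphi) => //; first exact: LN.
move=> x; rewrite NE// lerDl; apply: T_pos; first exact: LN.
by apply: N_pos => // y.
Qed.

Let psiK h : Lw w h -> psi (K h) = psi h.
Proof.
move=> Lh; rewrite /psi (_ : N (K h) = (N h \- h) \+ cst (phi h)); last first.
  by apply/funext => x /=; rewrite NK.
have LNh := LN Lh.
by rewrite (wfunD wphi) ?(wfunB wphi) ?(wfun_cst w1 wphi (phi h)) ?phi1 ?mulr1 ?subrK//; exact: LwB.
Qed.

(* psi is invariant under K by NK, and K is a function of P *)
Let psiP h : Lw w h -> psi (P h) = psi h.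
Proof.
move=> Lh; have [M wp] := wpsi.
have LPh := LP Lh.
have H : psi (Rs h) = psi h + b * psi (Rs (P h)).
  rewrite (_ : Rs h = h \+ b \*o Rs (P h)); last by apply/funext => x; exact: REr.
  by rewrite (wfunD wp) ?(wfunZ w1 wp)//; [exact: LR|apply: LwZ; exact: LR].
have Kh := psiK Lh; have KPh := psiK LPh.
rewrite /K (wfunZ w1 wp) in Kh; last exact: LR.
rewrite /K (wfunZ w1 wp) in KPh; last exact: LR.
have : b * psi (P h) = b * psi h.
  by have := congr1 (fun t => (1 - b) * t) H; have := congr1 (fun t => b * t) KPh; lra.
by move/mulfI; apply; rewrite gt_eqF.
Qed.

Let pi h := (psi (cst 1))^-1 * psi h.

Let wpi : exists M, wfun w M pi.
Proof.
have [M wp] := wpsi; have := wfunl_lin (psi (cst 1))^-1 wp (wfun_zero w).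
by move=> H; eexists; move: H; congr wfun; apply/funext => h; rewrite addr0.
Qed.

Let pi1 : pi (cst 1) = 1.
Proof. by rewrite /pi mulVf// gt_eqF// (lt_le_trans ltr01). Qed.

Let Z0 h : S -> R := b \*o Rs (N h).

Let wZ0 : exists M, woper w M Z0.
Proof. by have [M wN'] := wN; eexists; exact: woper_scale (woper_comp wR wN'). Qed.

Let Z0E h x : Lw w h -> pi h = 0 -> Z0 h x - P (Z0 h) x = h x.
Proof.
move=> Lh /eqP; rewrite mulf_eq0 invr_eq0 gt_eqF ?(lt_le_trans ltr01)//= => /eqP psih.
have LNh := LN Lh.
rewrite /Z0 (woperZ w1 wP)/=; last exact: LR.
have := RE x LNh; have := NE x LNh; have := NE x Lh; rewrite TE /K /= -/(psi h) psih.
lra.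
Qed.

(** P h = h implies K h = h, so that T h differs from h by the regeneration term
    only, and N maps this term to the constant phi h. *)
Let P_fix h : Lw w h -> P h = h -> h = cst (phi h).
Proof.
move=> Lh Ph; apply/funext => x /=.
have Kh y : K h y = h y.
  by have := REr y Lh; rewrite Ph /K/=; lra.
have := NK x Lh; rewrite (_ : K h = h); last exact/funext.
by lra.
Qed.

Let G_inj u : Lw w u -> (forall x, u x - P u x + pi u = 0) -> u = cst 0.
Proof.
move=> Lu Eu; have [M wp] := wpi.
have piP h : Lw w h -> pi (P h) = pi h by move=> Lh; rewrite /pi psiP.
have LPu := LP Lu.
have piu : pi u = 0.
  have : pi (u \- P u \+ cst (pi u)) = 0.
    rewrite (_ : _ \+ _ = cst 0); last exact/funext.
    by rewrite (wfun_cst w1 wp) mul0r.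
  have LB := LwB Lu LPu; have Lc := Lcst (pi u).
  rewrite (wfunD wp LB Lc) (wfunB wp Lu LPu) (wfun_cst w1 wp (pi u)) pi1 piP//; lra.
have Pu : P u = u by apply/funext => x; have := Eu x; rewrite piu; lra.
have uE := P_fix Lu Pu.
have : pi (cst (phi u)) = 0 by rewrite -uE.
by rewrite (wfun_cst w1 wp) pi1 mulr1 => phiu; rewrite uE phiu.
Qed.

(** Z solves Poisson's equation for the centred function h - pi h, with the
    constant adjusted so that pi (Z h) = pi h; it is a left inverse of
    I - P + Pi too because this operator is injective. *)
Lemma drift_poisson : exists (pi : (S -> R) -> R) (Z : (S -> R) -> S -> R) (Mpi MZ : R),
  [/\ wfun w Mpi pi, (forall B, measurable B -> 0 <= pi \1_B), pi (cst 1) = 1 &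
      forall h, Lw w h -> pi (P h) = pi h] /\
  [/\ woper w MZ Z, (forall h, Lw w h -> Z h \- P (Z h) \+ cst (pi (Z h)) = h) &
      (forall h, Lw w h -> Z (h \- P h \+ cst (pi h)) = h)].
Proof.
have [Mp wp] := wpi; have [M0 w0] := wZ0; have [Mq wq] := wpsi.
have [C1 C10 b1C] := Lcst 1.
pose pr h : S -> R := (-1) \*o (pi h \*o cst 1) \+ h.
have wpr := woper_lin (-1) (woper_rank1 C10 b1C wp) (woper_id w1).
have prE h : pr h = h \- cst (pi h) by apply/funext => x; rewrite /pr/=; ring.
have Lpr h : Lw w h -> Lw w (pr h) by exact: woper_Lw wpr.
have pipr h : Lw w h -> pi (pr h) = 0.
  by move=> Lh; rewrite prE (wfunB wp)// (wfun_cst w1 wp) pi1; ring.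
have wk := wfunl_sub wp (wfun_comp wp (woper_comp w0 wpr)).
pose Z h : S -> R := 1 \*o ((pi h - pi (Z0 (pr h))) \*o cst 1) \+ Z0 (pr h).
have wZ := woper_lin 1 (woper_rank1 C10 b1C wk) (woper_comp w0 wpr).
have ZE h : Z h = Z0 (pr h) \+ cst (pi h - pi (Z0 (pr h))).
  by apply/funext => x; rewrite /Z/=; ring.
have LZ0 h : Lw w h -> Lw w (Z0 (pr h)).
  by move=> Lh; apply: woper_Lw w0 _; exact: Lpr.
have piP h : Lw w h -> pi (P h) = pi h by move=> Lh; rewrite /pi psiP.
have GZ h : Lw w h -> Z h \- P (Z h) \+ cst (pi (Z h)) = h.
  move=> Lh; apply/funext => x /=; rewrite ZE.
  have L0 := LZ0 _ Lh.
  rewrite (wfunD wp)// (woperD wP)//= (wfun_cst w1 wp) pi1.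
  set a := pi h - _; rewrite (_ : cst a = a \*o cst 1); last first.
    by apply/funext => y /=; rewrite mulr1.
  rewrite (woperZ w1 wP a (Lcst 1)) P1 /=.
  have := Z0E x (Lpr _ Lh) (pipr _ Lh); rewrite [in RHS]prE /= /a.
  lra.
exists pi, Z; do 2 eexists; split; split.
- exact: wp.
- move=> B mB; rewrite /pi mulr_ge0 ?psi_indic// invr_ge0 (le_trans ler01)//.
- exact: pi1.
- exact: piP.
- exact: wZ.
- exact: GZ.
move=> h Lh; set g := _ \+ _.
have Lg : Lw w g by apply: LwD => //; apply: LwB => //; exact: LP.
have LZg : Lw w (Z g) by exact: woper_Lw wZ Lg.
have GZg := GZ _ Lg.
pose u := Z g \- h.
have Lu : Lw w u by exact: LwB.
have Eu x : u x - P u x + pi u = 0.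
  rewrite /u (woperB wP)// (wfunB wp)//=.
  have gx : g x = h x - P h x + pi h by [].
  have /= := congr1 (fun f => f x) GZg; rewrite gx => E.
  lra.
have u0 : u = cst 0 by exact: G_inj Lu Eu.
by apply/funext => x; have := congr1 (fun f => f x) u0; rewrite /u /=; lra.
Qed.

(** Applying N to u <= K u bounds u by phi u; as u vanishes on B this bound
    improves itself. *)
Lemma drift_subharmonic_eq0 B u : measurable B -> 0 < phi \1_B -> Lw w u ->
  (forall x, 0 <= u x) -> (forall x, u x <= P u x) -> (forall x, B x -> u x = 0) ->
  forall x, u x = 0.
Proof.
move=> mB phiB Lu u0 uP uB.
have LPu := LP Lu.
have uK x : u x <= K u x.
  have := REr x Lu; have : Rs u x <= Rs (P u) x by apply: (pos_oper_mono wR).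
  move=> /(ler_wpM2l (ltW b0)); rewrite /K /=; lra.
have uphi x : u x <= phi u.
  have [M wN'] := wN.
  have : N u x <= N (K u) x by apply: (pos_oper_mono wN') => //; exact: LK.
  by rewrite NK//; lra.
have phiu0 : 0 <= phi u by exact: phi_pos.
have LB : Lw w \1_B by exact: Lw_indic.
have : phi u <= phi (phi u \*o (cst 1 \- \1_B)).
  apply: (wfun_mono w1 wphi) => //; first by apply: LwZ; exact: LwB.
  move=> x /=; rewrite indicE; case: (boolP (x \in B)) => [/set_mem xB|_].
    by rewrite subrr mulr0 uB.
  by rewrite subr0 mulr1.
rewrite (wfunZ w1 wphi); last exact: LwB.
rewrite (wfunB wphi)// phi1 => H.
have phiu : phi u = 0 by apply/eqP; rewrite eq_le phiu0 andbT; nra.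
by move=> x; apply/eqP; rewrite eq_le u0 andbT -phiu.
Qed.

End geometric_drift.

(** * Probability kernels and their stationary distributions *)
Section probability_kernels.
Context {d : measure_display} {S : measurableType d} {R : realType}.
Implicit Types (w h g u : S -> R) (M : R) (B : set S) (Q : R.-pker S ~> S).

Definition kop Q h x : R := rint (Q x) h.

Lemma kop_indic Q B x : measurable B -> Q x B = (kop Q \1_B x)%:E.
Proof.
move=> mB; rewrite /kop rint_indic// fineK//.
exact: (fin_num_measure (charge_of_kernel Q x)).
Qed.

Lemma krepresents_kop Q : krepresents (kop Q) (skernel_of Q).
Proof. by move=> x B mB; exact: kop_indic. Qed.

Lemma kop_cst1 Q : kop Q (cst 1) = cst 1.
Proof.
by apply/funext => x /=; rewrite /kop -indicT rint_indic// prob_kernel.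
Qed.

Lemma pos_kop w Q : pos_oper w (kop Q).
Proof. by move=> h _ h0 x; apply: Rintegral_ge0 => y _. Qed.

Lemma woper_kop w Q M : (forall x, 1 <= w x) -> measurable_fun [set: S] w -> 0 <= M ->
  (forall x, \int[Q x]_y (w y)%:E <= (M * w x)%:E)%E -> woper w M (kop Q).
Proof.
move=> w1 mw M0 QM; apply: woper_indic_meas => // [x|B mB]; first exact: wfun_rint.
rewrite (_ : kop Q _ = fine \o (Q ^~ B)).
  by apply: measurableT_comp => //; exact: measurable_kernel.
by apply/funext => x; rewrite /= kop_indic.
Qed.

Lemma woper1_kop Q : woper (cst 1) 1 (kop Q).
Proof.
apply: woper_kop => // x.
by rewrite (_ : (fun x => _) = cst 1%E)// integral_cst// mul1e mulr1 prob_kernel.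
Qed.

Lemma calLw_kop (w : S -> R) Q (x0 : S) M : (forall x, 1 <= w x) -> measurable_fun [set: S] w ->
  0 <= M -> skernel_measurable (skernel_of Q) ->
  (wnorm_skernel w (skernel_of Q) <= M%:E)%E -> woper w M (kop Q).
Proof.
move=> w1 mw M0 mQ QM; have [wQ rQ] := wnorm_skernel_woper w1 mw x0 M0 mQ QM.
apply: woper_kop => // x.
apply: (represented_weight_le w1 mw (woper_wfun wQ x)) => [|B mB]; last exact: rQ.
by rewrite prob_kernel.
Qed.

Lemma kernel_powE Q k x B : measurable B ->
  Lw (cst 1) (iter k (kop Q) \1_B) /\
  kernel_pow Q k x B = (iter k (kop Q) \1_B x)%:E.
Proof.
move=> mB; elim: k x => [|k IH] x /=.
  by split; [exact: Lw_indic|rewrite diracE indicE].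
have [Lk _] := IH x; split; first exact: woper_Lw (woper1_kop Q) Lk.
under eq_integral do rewrite (IH _).2.
apply: (@rintE _ _ _ _ (cst 1)) => //.
by rewrite (_ : (fun x => _) = cst 1%E)// integral_cst// mul1e prob_kernel ltry.
Qed.

Lemma woper_iter w M (T : (S -> R) -> S -> R) k :
  (forall x, 1 <= w x) -> woper w M T -> woper w (M ^+ k) (iter k T).
Proof.
move=> w1 wT; elim: k => [|k IH]; first exact: woper_id.
by rewrite exprS; exact: (woper_comp wT IH).
Qed.

Lemma rint_prob w M l (mu : probability S R) : (forall x, 1 <= w x) ->
  measurable_fun [set: S] w -> wfun w M l ->
  (forall B, measurable B -> mu B = (l \1_B)%:E) ->
  (\int[mu]_x (w x)%:E <= M%:E)%E /\ (forall h, Lw w h -> rint mu h = l h).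
Proof.
move=> w1 mw wl mul.
have muM : (\int[mu]_x (w x)%:E <= M%:E)%E.
  by apply: (represented_weight_le w1 mw wl) => //; rewrite fin_num_measure.
split => //; apply: (wfun_eq w1 (wfun_rint w1 mw muM) wl) => B mB.
by rewrite rint_indic//; exact: (congr1 fine (mul B mB)).
Qed.

Lemma prob_cst1_lty (mu : probability S R) : (\int[mu]_x (cst 1 x : R)%:E <= 1%:E)%E.
Proof. by rewrite (_ : (fun x => _) = cst 1%E)// integral_cst// mul1e; exact: probability_le1. Qed.

Lemma wfun1_prob (mu : probability S R) : wfun (cst 1) 1 (rint mu).
Proof. by apply: wfun_rint => //; exact: prob_cst1_lty. Qed.

Lemma rint_prob_cst1 (mu : probability S R) : rint mu (cst 1) = 1.
Proof. by rewrite -indicT rint_indic//; exact: (congr1 fine (probability_setT mu)). Qed.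

Lemma stationaryP Q (mu : probability S R) : stationary Q mu <->
  forall h, Lw (cst 1) h -> rint mu (kop Q h) = rint mu h.
Proof.
have c1 : (\int[mu]_x (cst 1 x : R)%:E < +oo)%E.
  by rewrite (le_lt_trans (prob_cst1_lty mu))// ltry.
have E B : measurable B -> (\int[mu]_x Q x B = (rint mu (kop Q \1_B))%:E)%E.
  move=> mB; have LQ := woper_Lw (woper1_kop Q) (Lw_indic (w := cst 1) (fun=> lexx 1) mB).
  rewrite -(rintE _ _ c1 LQ)//.
  by apply: eq_integral => x _; exact: kop_indic.
have muE B : measurable B -> mu B = (rint mu \1_B)%:E.
  by move=> mB; rewrite rint_indic// fineK// fin_num_measure.
split=> [st|st B mB]; last by rewrite E// st ?muE//; exact: Lw_indic.
apply: (wfun_eq _ (wfun_comp (wfun1_prob mu) (woper1_kop Q)) (wfun1_prob mu)) => // B mB.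
by apply/EFin_inj; rewrite /= -muE// -st// E.
Qed.

(** Integrating w - P w against mu and dropping both terms, as mu P = mu,
    is legitimate after truncation only. *)
Lemma stationary_weight_le (w : S -> R) Q MQ (mu : probability S R) (r c : R) :
  (forall x, 1 <= w x) -> measurable_fun [set: S] w -> woper w MQ (kop Q) ->
  r < 1 -> 0 <= r -> 0 <= c -> (forall x, kop Q w x <= r * w x + c) -> stationary Q mu ->
  (\int[mu]_x (w x)%:E <= (c / (1 - r))%:E)%E.
Proof.
move=> w1 mw wQ r1 r0 c0 drift /stationaryP st.
have w0 x : 0 <= w x by exact: le_trans (w1 x).
have wmu := wfun1_prob mu.
have muoo : (mu [set: S] < +oo)%E by rewrite probability_setT ltry.
have mu_ge0 B : measurable B -> 0 <= rint mu \1_B.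
  by move=> mB; rewrite rint_indic// fine_ge0.
have bL (h : S -> R) C : measurable_fun [set: S] h -> (forall x, `|h x| <= C) -> Lw (cst 1) h.
  by move=> mh hC; exact: bounded_Lw hC.
pose v x := r * w x + c.
have mv : measurable_fun [set: S] v.
  apply: measurable_funD; last exact: measurable_cst.
  by apply: measurable_funM => //; exact: measurable_cst.
have v0 x : 0 <= v x by rewrite addr_ge0// mulr_ge0.
pose tw (n : nat) x := Num.min (w x) n%:R.
pose tv (n : nat) x := Num.min (v x) n%:R.
have tw0 n x : 0 <= tw n x by rewrite le_min w0/=.
have tv0 n x : 0 <= tv n x by rewrite le_min v0/=.
have mtw n : measurable_fun [set: S] (tw n) by exact: measurable_minr.
have mtv n : measurable_fun [set: S] (tv n) by exact: measurable_minr.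
have btw n x : `|tw n x| <= n%:R by rewrite ger0_norm// ge_min lexx orbT.
have btv n x : `|tv n x| <= n%:R by rewrite ger0_norm// ge_min lexx orbT.
have Ltw n : Lw (cst 1) (tw n) := bL _ _ (mtw n) (btw n).
have Ltv n : Lw (cst 1) (tv n) := bL _ _ (mtv n) (btv n).
have Lww : Lw w w by exact: Lw_self.
have up (h : S -> R) : Lw (cst 1) h -> Lw w h by exact: Lw_le.
have Ptw n x : kop Q (tw n) x <= tv n x.
  rewrite le_min; apply/andP; split.
    apply: le_trans (drift x); apply: (pos_oper_mono wQ) => //; first exact: pos_kop.
      exact: up.
    by move=> y; rewrite ge_min lexx.
  have -> : n%:R = kop Q (n%:R \*o cst 1) x.
    rewrite (woperZ _ (woper1_kop Q))//; last exact: Lw_cst.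
    by rewrite kop_cst1 /= mulr1.
  apply: (pos_oper_mono (woper1_kop Q)) => //; first exact: pos_kop.
    by apply: LwZ; exact: Lw_cst.
  by move=> y /=; rewrite mulr1 ge_min lexx orbT.
have tle n : rint mu (tw n) <= rint mu (tv n).
  rewrite -st//; apply: (wfun_mono _ wmu) => //.
  exact: woper_Lw (woper1_kop Q) (Ltw n).
pose f (n : nat) x := tw n x - tv n x.
have f_ge n x : - c <= f n x.
  rewrite /f /tw /tv; have vw : v x <= w x + c.
    by rewrite lerD2r ler_piMl// ltW.
  have n0 : 0 <= n%:R :> R by [].
  by case: (leP (w x) n%:R) => ?; case: (leP (v x) n%:R) => ?; lra.
pose g (k : nat) x := Num.min ((1 - r) * w x - c) k%:R.
have g_le (k : nat) : rint mu (g k) <= 0.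
  have mf n : measurable_fun [set: S] (f n) by exact: measurable_funB.
  pose fk n x := Num.min (f n x) k%:R.
  have mfk n : measurable_fun [set: S] (fk n).
    by apply: measurable_minr => //; exact: measurable_cst.
  have bfk n x : `|fk n x| <= c + k%:R.
    have := f_ge n x; have k0 : 0 <= k%:R :> R by [].
    rewrite ler_norml /fk; case: (leP (f n x)) => ? ?; apply/andP; split; lra.
  have Lfk n : Lw (cst 1) (fk n) := bL _ _ (mfk n) (bfk n).
  have fk_le n : rint mu (fk n) <= 0.
    have := tle n; rewrite -subr_le0 -(wfunB wmu)//; apply: le_trans.
    apply: (wfun_mono _ wmu) => //; first exact: LwB.
    by move=> x; rewrite /fk ge_min lexx.
  have lim : rint mu (fk n) @[n --> \oo] --> rint mu (g k).
    apply: (wfun_cvg wmu (C := c + k%:R)); first by rewrite addr_ge0.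
      by move=> n; split => // x; rewrite mulr1.
    move=> x; apply: cvg_near_cst; near=> n.
    have wn : w x <= n%:R.
      apply: (@le_trans _ _ (Num.bound (w x))%:R); first exact/ltW/archi_boundP.
      by rewrite ler_nat; near: n; exact: nbhs_infty_ge.
    have vn : v x <= n%:R.
      apply: (@le_trans _ _ (Num.bound (v x))%:R); first exact/ltW/archi_boundP.
      by rewrite ler_nat; near: n; exact: nbhs_infty_ge.
    rewrite /fk /g /f /tw /tv (min_idPl wn) (min_idPl vn) /v.
    by congr Num.min; ring.
  by rewrite -(cvg_lim _ lim)//; apply: limr_le; [exact: cvgP lim|exact: nearW].
apply: measure_weight_le => // j.
have r1' : 0 < 1 - r by rewrite subr_gt0.
rewrite ler_pdivlMr// mulrC -subr_le0; apply: le_trans (g_le j).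
have Lc : Lw (cst 1) (cst c : S -> R) by exact: Lw_cst.
have rc : rint mu (cst c : S -> R) = c.
  by rewrite (wfun_cst _ wmu)// rint_prob_cst1 mulr1.
have LZ := LwZ (1 - r) (Ltw j).
rewrite -[X in _ - X]rc -(wfunZ _ wmu (1 - r) (Ltw j))// -(wfunB wmu LZ Lc).
apply: (wfun_mono _ wmu) => //; first exact: LwB.
  apply: (bL _ (c + j%:R)).
    apply: measurable_minr; last exact: measurable_cst.
    apply: measurable_funB; last exact: measurable_cst.
    by apply: measurable_funM => //; exact: measurable_cst.
  move=> x; have := w0 x => wx; have j0 : 0 <= j%:R :> R by [].
  have rw0 : 0 <= (1 - r) * w x by rewrite mulr_ge0// ltW.
  by rewrite ler_norml /g; case: (leP ((1 - r) * w x - c) j%:R) => ?; apply/andP; split; lra.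
move=> x; have j0 : 0 <= j%:R :> R by [].
rewrite /= le_min; apply/andP; split.
  by rewrite lerD2r ler_wpM2l ?(ltW r1')// ge_min lexx.
have : (1 - r) * tw j x <= 1 * j%:R.
  apply: ler_pM; [exact: ltW|exact: tw0|lra|by rewrite ge_min lexx orbT].
by lra.
Unshelve. all: by end_near. Qed.

End probability_kernels.

(** * Harris recurrence *)
Section harris.
Context {d : measure_display} {S : measurableType d} {R : realType}.
Implicit Types (h g u : S -> R) (B : set S).

(** Conditional statements about a random variable Y on an event F become
    statements about forms on S, which may be checked on indicators. *)
Lemma wfun_pull {d' : measure_display} {O : measurableType d'} (Y : O -> S) (F : set O)
    M (l : (O -> R) -> R) : measurable_fun [set: O] Y -> measurable F ->
  wfun (cst 1) M l -> wfun (cst 1) M (fun g => l (\1_F \* (g \o Y))).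
Proof.
move=> mY mF [M0 lin b c].
have bF C g : bnd (cst 1) C g -> bnd (cst 1) C (\1_F \* (g \o Y)).
  move=> [mg gC]; split.
    by apply: measurable_funM; [exact: measurable_indic|exact: measurableT_comp].
  move=> o /=; rewrite normrM (le_trans _ (gC (Y o)))// ler_piMl//.
  by rewrite indicE; case: (o \in F); rewrite ?normr1 ?normr0.
split => //.
- move=> a h g [C C0 hC] [D D0 gD]; rewrite -lin.
  + by congr l; apply/funext => o /=; ring.
  + by exists C => //; exact: bF.
  + by exists D => //; exact: bF.
- by move=> C h C0 hC; apply: b => //; exact: bF.
- move=> u h C C0 uC uh; apply: (c _ _ C) => // [n|o]; first exact: bF.
  by apply: cvgMr; exact: uh.
Qed.

Section chain.
Variables (Q : R.-pker S ~> S) (x : S) (d' : measure_display) (O : measurableType d').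
Variables (Pr : probability O R) (X : nat -> O -> S).
Hypothesis chainX : markov_chain Q x Pr X.

Let mX n : measurable_fun [set: O] (X n). Proof. by case: chainX. Qed.

Lemma history_measurable n F : history X n F -> measurable F.
Proof.
move=> hF; apply: hF; split; first exact: sigma_algebra_measurable.
by move=> _ [k [B [_ mB ->]]]; rewrite -[X in measurable X]setTI; exact: mX.
Qed.

Lemma historyS n F : history X n F -> history X n.+1 F.
Proof.
apply: sub_sigma_algebra2 => _ [k [B [kn mB ->]]].
by exists k, B; split => //; exact: leqW.
Qed.

Lemma history_preimage n F B : history X n F -> measurable B ->
  history X n (F `&` X n @^-1` B).
Proof.
move=> hF mB.
have hX : history X n (X n @^-1` B) by apply: sub_gen_smallest; exists n, B.
have -> : F `&` X n @^-1` B =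
    [set: O] `\` \bigcup_i (if i == 0%N then setT `\` F else setT `\` X n @^-1` B).
  apply/seteqP; split=> [t [Fo Xo]|t [_ Ho]].
    by split=> //; case; case=> [|i] _ /= [].
  split; apply: contrapT => nH; apply: Ho; [by exists 0%N|by exists 1%N].
by apply: sigma_algebraCD; apply: sigma_algebra_bigcup; case=> [|i]; exact: sigma_algebraCD.
Qed.

(** Both sides are forms in g, and they agree on indicators by definition of a
    chain. *)
Lemma markov_property n F g : history X n F -> Lw (cst 1) g ->
  rint Pr (\1_F \* (g \o X n.+1)) = rint Pr (\1_F \* (kop Q g \o X n)).
Proof.
move=> hF; have mF := history_measurable hF.
have w1 := wfun_pull (mX n.+1) mF (wfun1_prob Pr).
have w2 := wfun_comp (wfun_pull (mX n) mF (wfun1_prob Pr)) (woper1_kop Q).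
apply: (wfun_eq _ w1 w2) => // B mB.
have mXB : measurable (X n.+1 @^-1` B) by rewrite -[X in measurable X]setTI; exact: mX.
have -> : \1_F \* ((\1_B : S -> R) \o X n.+1) = \1_(F `&` X n.+1 @^-1` B).
  by rewrite -indicM; apply/funext => o.
rewrite rint_indic; last exact: measurableI.
have [_ _ H] := chainX; apply: (etrans (congr1 fine (H n F B hF mB))).
rewrite /rint /Rintegral integral_mkcond; congr fine.
apply: eq_integral => o _ /=; rewrite patchE indicE; case: ifPn => _.
  by rewrite mul1r kop_indic.
by rewrite mul0r.
Qed.

End chain.

Section avoiding.
Variables (Q : R.-pker S ~> S) (B : set S) (mB : measurable B).

(** The probability that the chain started at x stays out of B from time 1 to
    time n, computed from the kernel alone. *)
Fixpoint avoid n : S -> R :=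
  if n is k.+1 then kop Q (\1_(~` B) \* avoid k) else cst 1.

Let mBC : measurable (~` B). Proof. exact: measurableC. Qed.

Lemma avoid_bnd n : bnd (cst 1) 1 (avoid n) /\ forall x, 0 <= avoid n x.
Proof.
elim: n => [|n [IH IH0]] /=.
  by split => //; split; [exact: measurable_cst|move=> x; rewrite normr1 mulr1].
have wm := woper_mul_indic (w := (cst 1 : S -> R)) (fun=> lexx 1) mBC.
have b' := woper_bnd ler01 wm IH; rewrite mul1r in b'.
have b2 := woper_bnd ler01 (woper1_kop Q) b'; rewrite mul1r in b2.
split => // x; apply: (pos_kop (w := (cst 1 : S -> R))); first by exists 1.
by move=> y /=; rewrite mulr_ge0// indicE; case: (y \in _).
Qed.

Lemma avoid_Lw n : Lw (cst 1) (avoid n).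
Proof. by exists 1 => //; exact: (avoid_bnd n).1. Qed.

Lemma avoid_mul_Lw g : Lw (cst 1) g -> Lw (cst 1) (\1_(~` B) \* g).
Proof. by move=> Lg; exact: woper_Lw (woper_mul_indic (w := (cst 1 : S -> R)) (fun=> lexx 1) mBC) Lg. Qed.

Lemma avoid_decr n x : avoid n.+1 x <= avoid n x.
Proof.
elim: n x => [|n IH] x.
  rewrite [leRHS]/= -[leRHS]/(cst 1 x) -(kop_cst1 Q).
  apply: (pos_oper_mono (woper1_kop Q)).
  - exact: pos_kop.
  - by apply: avoid_mul_Lw; exact: (avoid_Lw 0).
  - exact: Lw_cst.
  - by move=> y /=; rewrite mulr1 indicE; case: (y \in _).
rewrite [leRHS]/= [leLHS]/=.
apply: (pos_oper_mono (woper1_kop Q)).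
- exact: pos_kop.
- by apply: avoid_mul_Lw; exact: (avoid_Lw n.+1).
- by apply: avoid_mul_Lw; exact: avoid_Lw.
- by move=> y; rewrite ler_wpM2l//; exact: IH.
Qed.

Definition avoid_forever x := limn (avoid ^~ x).

Lemma avoid_cvg x : avoid n x @[n --> \oo] --> avoid_forever x.
Proof.
apply: nonincreasing_is_cvgn.
  by apply/nonincreasing_seqP => n; exact: avoid_decr.
by exists 0 => _ [n _ <-]; exact: (avoid_bnd n).2.
Qed.

Lemma avoid_forever_bnd : bnd (cst 1) 1 avoid_forever.
Proof. by apply: (bnd_cvg (u := avoid)) => [n|x]; [exact: (avoid_bnd n).1|exact: avoid_cvg]. Qed.

Lemma avoid_forever_ge0 x : 0 <= avoid_forever x.
Proof.
apply: limr_ge; first exact: cvgP (@avoid_cvg x).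
by apply: nearW => n; exact: (avoid_bnd n).2.
Qed.

Lemma avoid_foreverE : avoid_forever = kop Q (\1_(~` B) \* avoid_forever).
Proof.
apply/funext => x.
have H := @avoid_cvg x; rewrite -(cvg_shiftS (avoid ^~ x)) in H.
have wQ := wfun_comp (woper_wfun (woper1_kop Q) x)
  (woper_mul_indic (w := (cst 1 : S -> R)) (fun=> lexx 1) mBC).
have H' : avoid n.+1 x @[n --> \oo] --> kop Q (\1_(~` B) \* avoid_forever) x.
  apply: (wfun_cvg wQ (C := 1)) => // [n|y]; first exact: (avoid_bnd n).1.
  exact: avoid_cvg.
by rewrite -(cvg_lim _ H)// -(cvg_lim _ H').
Qed.

End avoiding.

Section chain_avoiding.
Variables (Q : R.-pker S ~> S) (x : S) (d' : measure_display) (O : measurableType d').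
Variables (Pr : probability O R) (X : nat -> O -> S).
Hypothesis chainX : markov_chain Q x Pr X.
Variables (B : set S) (mB : measurable B).

Let mX n : measurable_fun [set: O] (X n). Proof. by case: chainX. Qed.

Fixpoint out n k : set O :=
  if k is j.+1 then X n.+1 @^-1` (~` B) `&` out n.+1 j else setT.

Lemma measurable_out n k : measurable (out n k).
Proof.
elim: k n => [|k IH] n //=; apply: measurableI => //.
by rewrite -[X in measurable X]setTI; apply: mX => //; exact: measurableC.
Qed.

(** Conditioning on the first step and absorbing it into the event F. *)
Lemma prob_out k n F : history X n F ->
  rint Pr \1_(F `&` out n k) = rint Pr (\1_F \* (avoid Q B k \o X n)).
Proof.
elim: k n F => [|k IH] n F hF /=.
  by rewrite setIT; congr rint; apply/funext => o /=; rewrite mulr1.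
rewrite setIA IH; last first.
  by apply: history_preimage; [exact: historyS|exact: measurableC].
rewrite -(markov_property chainX hF); last exact: avoid_mul_Lw (avoid_Lw _ _ _).
by congr rint; rewrite -indicM; apply/funext => o /=; rewrite mulrA.
Qed.

Lemma prob_hit n : (forall y, avoid_forever Q B y = 0) ->
  Pr (\bigcup_(j >= n) X j @^-1` B) = 1%E.
Proof.
move=> av0.
have mXB j : measurable (X j @^-1` B) by rewrite -[X in measurable X]setTI; exact: mX.
set H := \bigcup_(_ >= _) _.
have mH : measurable H by exact: bigcup_measurable.
have mHC : measurable (~` H) by exact: measurableC.
have outH k : ~` H `<=` out n k.
  have : forall i, (n <= i)%N -> ~` H `<=` out i k.
    elim: k => [|k IH] i ni //= o Ho; split; last exact: (IH i.+1 (leqW ni)).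
    by move=> /= XB; apply: Ho; exists i.+1 => //=; exact: leqW.
  exact.
have hT : history X n setT.
  by rewrite -setC0 -setTD; apply: sigma_algebraCD; exact: sigma_algebra0.
have le k : fine (Pr (~` H)) <= rint Pr (avoid Q B k \o X n).
  have -> : avoid Q B k \o X n = \1_setT \* (avoid Q B k \o X n).
    by rewrite indicT; apply/funext => o /=; rewrite mul1r.
  rewrite -(prob_out k hT) setTI rint_indic; last exact: measurable_out.
  rewrite fine_le ?fin_num_measure//; first exact: measurable_out.
  by apply: le_measure => //; rewrite inE//; exact: measurable_out.
have lim0 : rint Pr (avoid Q B k \o X n) @[k --> \oo] --> rint Pr (cst 0).
  apply: (wfun_cvg (wfun1_prob Pr) (C := 1)) => // [k|o].
    split; first by apply: measurableT_comp => //; exact: (avoid_bnd Q mB k).1.1.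
    by move=> o; exact: (avoid_bnd Q mB k).1.2.
  by rewrite /= -(av0 (X n o)); exact: avoid_cvg.
have PrH0 : fine (Pr (~` H)) <= 0.
  rewrite (_ : 0 = rint Pr (cst 0)); last by rewrite (wfun0 _ (wfun1_prob Pr)).
  rewrite -(cvg_lim _ lim0)//; apply: limr_ge; first exact: cvgP lim0.
  exact: nearW.
have PrHC : Pr (~` H) = 0%E.
  apply/eqP; rewrite eq_le measure_ge0 andbT -[leLHS]fineK ?fin_num_measure//.
by rewrite -[H]setCK probability_setC// PrHC sube0.
Qed.

End chain_avoiding.

(** Harris recurrence follows from a Liouville property: the probability v of
    never visiting B satisfies v = Q (1_(~ B) v), so that u = 1_(~ B) v is
    subharmonic, bounded, and vanishes on B. *)
Lemma harris_recurrence (Q : R.-pker S ~> S) (phi : probability S R) :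
  (forall B u, measurable B -> 0 < fine (phi B) -> bnd (cst 1) 1 u ->
     (forall x, 0 <= u x) -> (forall x, u x <= kop Q u x) ->
     (forall x, B x -> u x = 0) -> forall x, u x = 0) ->
  harris_recurrent Q.
Proof.
move=> liouville; exists (phi : {measure set S -> \bar R}); split.
- exact: sigma_finiteT.
- by have /eqP := probability_setT phi; rewrite /= => /eqP ->; exact: oner_neq0.
move=> B mB phiB x d' O Pr X chainX.
have mBC : measurable (~` B) by exact: measurableC.
pose v := avoid_forever Q B.
have v0 : forall y, v y = 0.
  pose u := \1_(~` B) \* v.
  have bv : bnd (cst 1) 1 v by exact: avoid_forever_bnd.
  have bu := woper_bnd ler01 (woper_mul_indic (w := (cst 1 : S -> R)) (fun=> lexx 1) mBC) bv.
  rewrite mul1r in bu.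
  have vE : v = kop Q u by exact: avoid_foreverE.
  have i01 y : 0 <= (\1_(~` B) y : R) <= 1 by rewrite indicE; case: (y \in _); rewrite ?lexx ler01.
  have vge0 y : 0 <= v y by exact: avoid_forever_ge0.
  have u0 : forall y, u y = 0.
    apply: (liouville B u) => //.
    + by rewrite fine_gt0// phiB/= ltey_eq fin_num_measure.
    + by move=> y; have /andP[] := i01 y; rewrite /u /= => *; rewrite mulr_ge0.
    + by move=> y; rewrite -vE /u/= ler_piMl//; have /andP[] := i01 y.
    + by move=> y By; rewrite /u/= indicE memNset ?mul0r.
  rewrite vE => y; rewrite (_ : u = cst 0); last exact/funext.
  by rewrite (woper0 _ (woper1_kop Q)).
have mXB j : measurable (X j @^-1` B).
  by rewrite -[X in measurable X]setTI; case: chainX => mX _ _; exact: mX.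
have H := lim_sup_set_cvg Pr (fun n => X n @^-1` B) mXB.
have {}H := H (le_lt_trans (probability_le1 _ (bigcup_measurable (fun k _ => mXB k))) (ltry 1)).
rewrite -(cvg_lim (@ereal_hausdorff R) H).
rewrite (_ : (fun n => _) = cst 1%E); first exact: lim_cst.
by apply/funext => n; exact: (prob_hit chainX).
Qed.

End harris.

(** * Ergodicity of a single kernel *)
Section one_kernel.
Context {d : measure_display} {S : measurableType d} {R : realType}.
Implicit Types (h g u : S -> R) (B : set S).
Variables (w : S -> R) (w1 : forall x, 1 <= w x) (mw : measurable_fun [set: S] w).
Variables (Q : R.-pker S ~> S) (MQ : R) (wQ : woper w MQ (kop Q)).
Variables (r c lam : R) (A : set S) (m : nat) (phi : probability S R) (x0 : S).
Hypotheses (r01 : 0 < r < 1) (c0 : 0 < c) (lam0 : 0 < lam) (mA : measurable A).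
Hypothesis drift : forall x, kop Q w x <= r * w x + c * \1_A x.
Hypothesis minor : forall x B, A x -> measurable B ->
  (lam%:E * phi B <= kernel_pow Q m x B)%E.

(** Otherwise P would be a contraction of L_w, while it fixes the constants. *)
Lemma drift_set_nonempty : exists x, A x.
Proof.
apply: contrapT => nA; have /andP[r0 r1] := r01.
have wr : woper w r (kop Q).
  apply: (pos_woper w1 wQ) => //; [exact: pos_kop|exact: ltW|].
  move=> x; rewrite (le_trans (drift x))// indicE memNset ?mulr0 ?addr0// => Ax.
  by apply: nA; exists x.
have := congr1 (fun f => f x0) (neumannEr w1 wr r1 (Lw_cst 1 w1)).
by rewrite kop_cst1 /=; lra.
Qed.

Lemma minor_indic x B : A x -> measurable B ->
  lam * rint phi \1_B <= iter m (kop Q) \1_B x.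
Proof.
move=> Ax mB; have := minor Ax mB; rewrite (kernel_powE Q m x mB).2.
by rewrite rint_indic// -lee_fin EFinM fineK// fin_num_measure.
Qed.

Let minor_functional x (v : S -> R) Mv Mphi : A x -> (forall x, 1 <= v x) ->
  woper v Mv (kop Q) -> wfun v Mphi (rint phi) ->
  forall h, Lw v h -> (forall y, 0 <= h y) -> lam * rint phi h <= iter m (kop Q) h x.
Proof.
move=> Ax v1 wv wphi h Lh h0.
have wl := wfunl_lin (- lam) wphi (woper_wfun (woper_iter m v1 wv) x).
have := wfun_indic_ge0 v1 wl _ Lh h0; rewrite mulNr addrC subr_ge0; apply => B mB.
by rewrite mulNr addrC subr_ge0; exact: minor_indic.
Qed.

(** phi integrates w because lam phi <= P^m x for one point x of A. *)
Lemma minor_weight : (\int[phi]_x (w x)%:E < +oo)%E.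
Proof.
have [xA AxA] := drift_set_nonempty.
have wk := woper_wfun (woper_iter m w1 wQ) xA.
suff : (\int[phi]_x (w x)%:E <= ((MQ ^+ m * w xA) / lam)%:E)%E.
  by move=> /le_lt_trans; apply; rewrite ltry.
apply: measure_weight_le => // [|k].
  exact: le_lt_trans (probability_le1 _ _) (ltry 1).
rewrite ler_pdivlMr// mulrC.
have mk : measurable_fun [set: S] (fun x => Num.min (w x) k%:R : R) by exact: measurable_minr.
have k0 x : 0 <= Num.min (w x) k%:R by rewrite le_min (le_trans _ (w1 x))/=.
have Lk : Lw (cst 1) (fun x => Num.min (w x) k%:R).
  by apply: (@bounded_Lw _ _ _ _ _ k%:R) => //; exact: min_bounded.
apply: le_trans (minor_functional AxA _ (woper1_kop Q) (wfun1_prob phi) Lk k0) _ => //.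
apply: le_trans (ler_norm _) _; rewrite -[leRHS]mulr1; apply: (wfun_bnd wk) => //.
by split => // x; rewrite mul1r ger0_norm// ge_min lexx.
Qed.

(** A stationary probability integrates w, which makes it a form on L_w; against
    mu = mu Q, Poisson's equation reads mu h = pi (Z h), whence uniqueness. *)
Lemma drift_minorization_ergodic :
  exists (pi : probability S R) (Z : (S -> R) -> S -> R) (Mpi MZ : R),
  [/\ positive_harris_recurrent Q, stationary Q pi &
      forall mu : probability S R, stationary Q mu ->
        forall B, measurable B -> mu B = pi B] /\
  [/\ wfun w Mpi (rint pi), woper w MZ Z,
      (forall h, Lw w h -> Z h \- kop Q (Z h) \+ cst (rint pi (Z h)) = h) &
      (forall h, Lw w h -> Z (h \- kop Q h \+ cst (rint pi h)) = h)].
Proof.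
have w0 x : 0 <= w x by exact: le_trans (w1 x).
have [xA AxA] := drift_set_nonempty.
have phifin : (\int[phi]_x (w x)%:E)%E \is a fin_num.
  rewrite ge0_fin_numE; first exact: minor_weight.
  by apply: integral_ge0 => x _; rewrite lee_fin.
have wphi : wfun w (fine (\int[phi]_x (w x)%:E)) (rint phi).
  by apply: wfun_rint => //; rewrite fineK.
have phi_ge0 B : measurable B -> 0 <= rint phi \1_B.
  by move=> mB; rewrite rint_indic// fine_ge0.
have minorL h : Lw w h -> (forall x, 0 <= h x) -> forall x, A x ->
    lam * rint phi h <= iter m (kop Q) h x.
  by move=> Lh h0 x Ax; exact: (minor_functional Ax w1 wQ wphi).
have [l [Z [Ml [MZ [[wl l_ge0 l1 lP] [wZ GZ ZG]]]]]] :=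
  drift_poisson w1 mw wQ (@pos_kop _ _ _ w Q) (kop_cst1 Q) r01 c0 lam0 mA drift wphi
    phi_ge0 (rint_prob_cst1 phi) minorL.
have [pi piE] := exists_probability w1 wl l_ge0 l1.
have [piM piL] := rint_prob w1 mw wl piE.
have L1 h : Lw (cst 1) h -> Lw w h by exact: Lw_le.
have pist : stationary Q pi.
  apply/stationaryP => h /L1 Lh; rewrite !piL//; first exact: lP.
  exact: woper_Lw wQ Lh.
have uniq (mu : probability S R) : stationary Q mu -> forall B, measurable B -> mu B = pi B.
  move=> must B mB.
  have /andP[r0 r1] := r01.
  have dr x : kop Q w x <= r * w x + c.
    by rewrite (le_trans (drift x))// lerD2l ler_piMr ?(ltW c0).
  have muw := stationary_weight_le w1 mw wQ r1 (ltW r0) (ltW c0) dr must.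
  have wmu := wfun_rint w1 mw muw.
  have muP h : Lw w h -> rint mu (kop Q h) = rint mu h.
    apply: (wfun_eq w1 (wfun_comp wmu wQ) wmu) => D mD.
    by have /stationaryP := must; apply; exact: Lw_indic.
  have muE h : Lw w h -> rint mu h = l (Z h).
    move=> Lh; have LZ := woper_Lw wZ Lh; have LPZ := woper_Lw wQ LZ.
    rewrite -[in LHS](GZ h Lh) (wfunD wmu (LwB LZ LPZ) (Lw_cst _ w1)) (wfunB wmu LZ LPZ).
    by rewrite muP// subrr add0r (wfun_cst w1 wmu) rint_prob_cst1 mulr1.
  have lE h : Lw w h -> l h = l (Z h).
    move=> Lh; have LZ := woper_Lw wZ Lh; have LPZ := woper_Lw wQ LZ.
    rewrite -[in LHS](GZ h Lh) (wfunD wl (LwB LZ LPZ) (Lw_cst _ w1)) (wfunB wl LZ LPZ).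
    by rewrite lP// subrr add0r (wfun_cst w1 wl) l1 mulr1.
  have LB : Lw w \1_B by exact: Lw_indic.
  rewrite piE// lE// -muE// rint_indic// fineK//.
  by rewrite fin_num_measure.
exists pi, Z, Ml, MZ; split; split => //.
- split; last by exists pi.
  apply: (@harris_recurrence _ _ _ Q phi) => B u mB phiB bu u0 uP uB.
  have Lu : Lw w u by apply: L1; exists 1.
  apply: (drift_subharmonic_eq0 w1 mw wQ (@pos_kop _ _ _ w Q) (kop_cst1 Q) r01 c0 lam0
    mA drift wphi phi_ge0 (rint_prob_cst1 phi) minorL mB) => //.
  by rewrite rint_indic.
- exact: wfun_rint.
- by move=> h Lh; rewrite piL ?GZ//; exact: woper_Lw wZ Lh.
- by move=> h Lh; rewrite piL// ZG.
Qed.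

End one_kernel.

(** * Perturbation of Poisson's equation *)
Section perturbation.
Context {d : measure_display} {S : measurableType d} {R : realType}.
Variables (w : S -> R) (w1 : forall x, 1 <= w x).
Implicit Types (h g : S -> R) (e t s M : R).
Implicit Types (l k : R -> (S -> R) -> R) (Q T : R -> (S -> R) -> S -> R).

Let w0 x : 0 <= w x. Proof. exact: le_trans (w1 x). Qed.

Lemma near_all t (A : R -> Prop) : (forall s, A s) -> \forall s \near t, A s.
Proof. by move=> As; near=> s; exact: As. Unshelve. all: by end_near. Qed.

Lemma wfun_ext M (l k : (S -> R) -> R) :
  (forall h, Lw w h -> l h = k h) -> wfun w M l -> wfun w M k.
Proof.
move=> lk [M0 lin b c]; split => //.
- by move=> a h g Lh Lg; rewrite -!lk ?lin//; apply: LwD => //; exact: LwZ.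
- by move=> C h C0 hC; rewrite -lk; [exact: b|exists C].
- move=> u h C C0 uC uh; rewrite -lk; last by exists C => //; exact: bnd_cvg uh.
  rewrite (_ : (fun n => _) = (fun n => l (u n))); first exact: (c u h C).
  by apply/funext => n; rewrite lk//; exists C.
Qed.

Lemma woper_ext M (Q T : (S -> R) -> S -> R) :
  (forall h, Lw w h -> Q h = T h) -> woper w M Q -> woper w M T.
Proof.
move=> QT [M0 wQ mQ]; split => // [x|h Lh]; last by rewrite -QT//; exact: mQ.
by apply: wfun_ext (wQ x) => h Lh; rewrite QT.
Qed.

(** Norm continuity of a family of linear forms, and of operators. *)
Definition fcont l t := (exists M, wfun w M (l t)) /\
  forall e, 0 < e -> \forall s \near t, wfun w e (fun h => l s h - l t h).

Definition ocont Q t := (exists M, woper w M (Q t)) /\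
  forall e, 0 < e -> \forall s \near t, woper w e (fun h => Q s h \- Q t h).

Lemma fcont_wfun l t : fcont l t -> \forall s \near t, exists M, wfun w M (l s).
Proof.
move=> [[M wl] /(_ 1 ltr01)]; apply: filterS => s wd.
exists (`|1| * 1 + M); apply: wfun_ext (wfunl_lin 1 wd wl) => h _; ring.
Qed.

Lemma woper_sub M N (Q T : (S -> R) -> S -> R) : woper w M Q -> woper w N T ->
  woper w (M + N) (fun h => Q h \- T h).
Proof.
move=> wQ wT; have := woper_lin (-1) wT wQ; rewrite normrN1 mul1r addrC.
by apply: woper_ext => h _; apply/funext => x /=; ring.
Qed.

Lemma woper_add M N (Q T : (S -> R) -> S -> R) : woper w M Q -> woper w N T ->
  woper w (M + N) (fun h => Q h \+ T h).
Proof.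
move=> wQ wT; have := woper_lin 1 wQ wT; rewrite normr1 mul1r.
by apply: woper_ext => h _; apply/funext => x /=; ring.
Qed.

Lemma wfun_add M N (l k : (S -> R) -> R) : wfun w M l -> wfun w N k ->
  wfun w (M + N) (fun h => l h + k h).
Proof.
move=> wl wk; have := wfunl_lin 1 wl wk; rewrite normr1 mul1r.
by apply: wfun_ext => h _; ring.
Qed.

Lemma ocont_woper Q t : ocont Q t -> \forall s \near t, exists M, woper w M (Q s).
Proof.
move=> [[M wl] /(_ 1 ltr01)]; apply: filterS => s wd.
exists (1 + M); apply: woper_ext (woper_add wd wl) => h _.
by apply/funext => x /=; ring.
Qed.

Lemma fcont_near l k t : (\forall s \near t, forall h, Lw w h -> l s h = k s h) ->
  fcont l t -> fcont k t.
Proof.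
move=> lk [[M wl] lc]; have lkt := nbhs_singleton lk.
split; first by exists M; exact: wfun_ext wl.
move=> e /lc; move: lk; apply: filterS2 => s lks; apply: wfun_ext => h Lh.
by rewrite lks// lkt.
Qed.

Lemma ocont_cst (Q : (S -> R) -> S -> R) M t : woper w M Q -> ocont (fun=> Q) t.
Proof.
move=> wQ; split; first by exists M.
move=> e e0; apply: near_all => s; apply: (woper_le w0 (ltW e0)).
have := woper_scale 0 wQ; rewrite normr0 mul0r; apply: woper_ext => h _.
by apply/funext => x /=; ring.
Qed.

Lemma fcont_lin a l k t : fcont l t -> fcont k t ->
  fcont (fun s h => a * l s h + k s h) t.
Proof.
move=> [[M wl] lc] [[N wk] kc]; split.
  by exists (`|a| * M + N); exact: wfunl_lin.
move=> e e0; have a1 : 0 < `|a| + 1 by rewrite ltr_wpDl.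
have d0 : 0 < e / (`|a| + 1) by rewrite divr_gt0.
move: (lc _ d0) (kc _ d0); apply: filterS2 => s ls ks.
apply: (wfun_le (M := `|a| * (e / (`|a| + 1)) + e / (`|a| + 1))).
  by rewrite -[X in _ + X]mul1r -mulrDl mulrC divfK// gt_eqF.
by apply: wfun_ext (wfunl_lin a ls ks) => h _; ring.
Qed.

Lemma fcont_zero t : fcont (fun s h => 0) t.
Proof.
split; first by exists 0; exact: wfun_zero.
move=> e e0; apply: near_all => s; apply: wfun_le (ltW e0) _.
by apply: wfun_ext (wfun_zero w) => h _; ring.
Qed.

Lemma fcont_comp l Q t : fcont l t -> ocont Q t -> fcont (fun s => l s \o Q s) t.
Proof.
move=> [[M wl] lc] [[N wQ] Qc]; split; first by exists (M * N); exact: wfun_comp.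
move=> e e0; have M0 := wfun_ge0 wl; have N0 := woper_ge0 wQ.
have D0 : 0 < M + N + 1 by rewrite ltr_wpDl// addr_ge0.
pose del := Num.min 1 (e / (M + N + 1)).
have del0 : 0 < del by rewrite lt_min ltr01 divr_gt0.
have del1 : del <= 1 by rewrite ge_min lexx.
have dele : del * (M + N + 1) <= e.
  by rewrite -ler_pdivlMr// ge_min lexx orbT.
move: (lc _ del0) (Qc _ del0); apply: filterS2 => s ls Qs.
have wQs : woper w (del + N) (Q s).
  by apply: woper_ext (woper_add Qs wQ) => h _; apply/funext => x /=; ring.
have := wfun_add (wfun_comp ls wQs) (wfun_comp wl Qs).
move=> H; apply: (wfun_le (M := del * (del + N) + M * del)).
  by apply: le_trans dele; rewrite [M * _]mulrC -mulrDr ler_pM2l//; lra.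
apply: wfun_ext H => h Lh /=.
rewrite (wfunB wl); [by ring|exact: woper_Lw wQs Lh|exact: woper_Lw wQ Lh].
Qed.

Lemma fcont_sum (I : Type) (r : seq I) (F : I -> R -> (S -> R) -> R) t :
  (forall i, fcont (F i) t) -> fcont (fun s h => \sum_(i <- r) F i s h) t.
Proof.
move=> Fc; elim: r => [|i r IH].
  by apply: fcont_near (fcont_zero t); apply: near_all => s h _; rewrite big_nil.
apply: fcont_near (fcont_lin 1 (Fc i) IH); apply: near_all => s h _.
by rewrite big_cons mul1r.
Qed.

(** Differentiability in Caratheodory's form: the difference quotient, extended
    by the derivative at t, is continuous at t.  It turns product rules into
    continuity of products. *)
Definition fslope l (l' : (S -> R) -> R) t s h :=
  if s == t then l' h else (s - t)^-1 * (l s h - l t h).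

Definition oslope Q (Q' : (S -> R) -> S -> R) t s h : S -> R :=
  if s == t then Q' h else (s - t)^-1 \*o (Q s h \- Q t h).

Definition fdiff l t (l' : (S -> R) -> R) := (exists M, wfun w M (l t)) /\ fcont (fslope l l' t) t.

Definition odiff Q t (Q' : (S -> R) -> S -> R) := (exists M, woper w M (Q t)) /\ ocont (oslope Q Q' t) t.

Lemma fslopeE l (l' : (S -> R) -> R) t s h : l s h = l t h + (s - t) * fslope l l' t s h.
Proof.
rewrite /fslope; have [->|st] := eqVneq s t; first by rewrite subrr mul0r addr0.
by rewrite mulrA mulfV ?subr_eq0// mul1r; ring.
Qed.

Lemma oslopeE Q (Q' : (S -> R) -> S -> R) t s h : Q s h = Q t h \+ (s - t) \*o oslope Q Q' t s h.
Proof.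
apply/funext => x; rewrite /oslope /=; have [->|st] := eqVneq s t.
  by rewrite subrr mul0r addr0.
by rewrite /= mulrA mulfV ?subr_eq0// mul1r; ring.
Qed.

Lemma near_dist t e : 0 < e -> \forall s \near t, `|s - t| <= e.
Proof.
move=> e0; near=> s; rewrite distrC; near: s.
by have /cvgrPdist_le := @cvg_id _ (nbhs t); exact.
Unshelve. all: by end_near. Qed.

Lemma fdiff_fcont l t (l' : (S -> R) -> R) : fdiff l t l' -> fcont l t.
Proof.
move=> [[M wl] [[N wl'] sc]]; split; first by exists M.
move=> e e0; have N0 := wfun_ge0 wl'.
have N1 : 0 < N + 1 by rewrite ltr_wpDl.
have d0 : 0 < e / (N + 1) by rewrite divr_gt0.
move: (near_dist t d0) (sc _ ltr01); apply: filterS2 => s st ws.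
have wss : wfun w (1 + N) (fslope l l' t s).
  by apply: wfun_ext (wfun_add ws wl') => h _; ring.
have := wfunl_lin (s - t) wss (wfun_zero w); rewrite addr0 => H.
apply: (wfun_le (M := `|s - t| * (1 + N))).
  by rewrite [1 + N]addrC -ler_pdivlMr.
by apply: wfun_ext H => h _; rewrite [l s h](fslopeE _ l' t); ring.
Qed.

Lemma odiff_ocont Q t (Q' : (S -> R) -> S -> R) : odiff Q t Q' -> ocont Q t.
Proof.
move=> [[M wl] [[N wl'] sc]]; split; first by exists M.
move=> e e0; have N0 := woper_ge0 wl'.
have N1 : 0 < N + 1 by rewrite ltr_wpDl.
have d0 : 0 < e / (N + 1) by rewrite divr_gt0.
move: (near_dist t d0) (sc _ ltr01); apply: filterS2 => s st ws.
have wss : woper w (1 + N) (oslope Q Q' t s).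
  by apply: woper_ext (woper_add ws wl') => h _; apply/funext => x /=; ring.
apply: (woper_le w0 (M := `|s - t| * (1 + N))).
  by rewrite [1 + N]addrC -ler_pdivlMr.
apply: woper_ext (woper_scale (s - t) wss) => h _.
by rewrite [Q s h](oslopeE _ Q' t); apply/funext => x /=; ring.
Qed.

Lemma fdiff_near l k t (l' k' : (S -> R) -> R) : (\forall s \near t, forall h, Lw w h -> l s h = k s h) ->
  (forall h, Lw w h -> l' h = k' h) -> fdiff l t l' -> fdiff k t k'.
Proof.
move=> lk lk' [[M wl] sc]; have lkt := nbhs_singleton lk; split.
  by exists M; exact: wfun_ext wl.
apply: fcont_near sc; move: lk; apply: filterS => s lks h Lh.
by rewrite /fslope lk'// lks// lkt.
Qed.

Lemma fdiff_lin a l k t (l' k' : (S -> R) -> R) : fdiff l t l' -> fdiff k t k' ->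
  fdiff (fun s h => a * l s h + k s h) t (fun h => a * l' h + k' h).
Proof.
move=> [[M wl] sl] [[N wk] sk]; split.
  by exists (`|a| * M + N); exact: wfunl_lin.
apply: fcont_near (fcont_lin a sl sk); apply: near_all => s h _.
by rewrite /fslope; case: eqP => // _; ring.
Qed.

Lemma fdiff_zero t : fdiff (fun s h => 0) t (fun h => 0).
Proof.
split; first by exists 0; exact: wfun_zero.
apply: fcont_near (fcont_zero t); apply: near_all => s h _.
by rewrite /fslope; case: eqP => // _; ring.
Qed.

Lemma fdiff_sum (I : Type) (r : seq I) (F : I -> R -> (S -> R) -> R) (F' : I -> (S -> R) -> R) t :
  (forall i, fdiff (F i) t (F' i)) ->
  fdiff (fun s h => \sum_(i <- r) F i s h) t (fun h => \sum_(i <- r) F' i h).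
Proof.
move=> Fc; elim: r => [|i r IH].
  apply: fdiff_near (fdiff_zero t); last by move=> h _; rewrite big_nil.
  by apply: near_all => s h _; rewrite big_nil.
apply: fdiff_near (fdiff_lin 1 (Fc i) IH).
  by apply: near_all => s h _; rewrite big_cons mul1r.
by move=> h _; rewrite big_cons mul1r.
Qed.

Lemma fdiff_comp l Q t (l' : (S -> R) -> R) (Q' : (S -> R) -> S -> R) : fdiff l t l' -> odiff Q t Q' ->
  fdiff (fun s => l s \o Q s) t (fun h => l' (Q t h) + l t (Q' h)).
Proof.
move=> dl dQ; have lc := fdiff_fcont dl; have Qc := odiff_ocont dQ.
have [[M wl] sl] := dl; have [[N wQ] sQ] := dQ.
split; first by exists (M * N); exact: wfun_comp.
have H := fcont_lin 1 (fcont_comp sl (ocont_cst t wQ)) (fcont_comp lc sQ).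
apply: fcont_near H.
move: (fcont_wfun lc) (ocont_woper Qc) (ocont_woper sQ).
apply: filterS3 => s [Ms wls] [Ns wQs] [Ks wsQ] h Lh; rewrite /fslope mul1r /=.
have LQ := woper_Lw wQ Lh; have LQs := woper_Lw wQs Lh.
have [->|st] := eqVneq s t; first by rewrite /oslope eqxx.
rewrite /oslope (negbTE st) (wfunZ w1 wls); last exact: LwB.
by rewrite (wfunB wls)//; ring.
Qed.

(** A norm N with N <= a + N / 2 is at most 2 a; iterating the improvement of the
    bounds avoids introducing the norm itself. *)
Lemma wfun_self_bound M a (l : (S -> R) -> R) : wfun w M l -> 0 <= a ->
  (forall N, wfun w N l -> wfun w (a + N / 2) l) -> wfun w (2 * a) l.
Proof.
move=> wl a0 step.
have wk n : wfun w (2 * a + 2^-1 ^+ n * M) l.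
  elim: n => [|n /step].
    by rewrite expr0 mul1r; apply: wfun_le wl; rewrite lerDr mulr_ge0.
  by congr wfun; rewrite exprS; field.
have [M0 lin b c] := wl; split => //; first exact: mulr_ge0.
move=> C h C0 hC; apply/ler_addgt0Pr => e e0.
have q1 : 2^-1 < 1 :> R by lra.
have wid : woper w (2^-1) (fun h => 2^-1 \*o h).
  have := woper_scale (2^-1) (woper_id w1).
  by rewrite mulr1 ger0_norm// invr_ge0.
have [n Hn] := cvg_geom wid q1 (M * C) e0.
by have := wfun_bnd (wk n) C0 hC; rewrite mulrDl -mulrA; lra.
Qed.

Section poisson_equation.
Variables (P : R -> (S -> R) -> S -> R) (t : R) (Z : (S -> R) -> S -> R) (MZ : R).
Variables (pit : (S -> R) -> R) (kap : R).
Hypotheses (wZ : woper w MZ Z).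
Hypothesis GZ : forall h, Lw w h -> Z h \- P t (Z h) \+ cst (pit (Z h)) = h.
Variables (mu rho : R -> (S -> R) -> R).
Hypothesis muw : \forall s \near t, exists M, wfun w M (mu s).
Hypothesis mu1 : \forall s \near t, mu s (cst 1) = kap.
Hypothesis muP : \forall s \near t, forall h, Lw w h -> mu s (h \- P s h) = rho s h.
Hypothesis Pw : \forall s \near t, exists M, woper w M (P s).

(** The equation satisfied by mu s for P s, read for P t and solved by Z. *)
Lemma poisson_difference : \forall s \near t, forall h, Lw w h ->
  mu s h - mu t h = rho s (Z h) - rho t (Z h) + mu s (P s (Z h) \- P t (Z h)).
Proof.
have mu1t := nbhs_singleton mu1; have muPt := nbhs_singleton muP.
have [Mt wmut] := nbhs_singleton muw; have [Nt wPt] := nbhs_singleton Pw.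
near=> s => h Lh.
have [Ms wmus] : exists M, wfun w M (mu s) by near: s.
have [Ns wPs] : exists M, woper w M (P s) by near: s.
have mu1s : mu s (cst 1) = kap by near: s.
have muPs : forall h, Lw w h -> mu s (h \- P s h) = rho s h by near: s.
have LZ := woper_Lw wZ Lh.
have LPt := woper_Lw wPt LZ; have LPs := woper_Lw wPs LZ.
have E M (k : (S -> R) -> R) : wfun w M k -> k (cst 1) = kap ->
    k h = k (Z h) - k (P t (Z h)) + pit (Z h) * kap.
  move=> wk k1; rewrite -[in LHS](GZ Lh) (wfunD wk (LwB LZ LPt) (Lw_cst _ w1)).
  by rewrite (wfunB wk LZ LPt) (wfun_cst w1 wk) k1.
rewrite (E _ _ wmus mu1s) (E _ _ wmut mu1t) -muPs// -muPt//.
rewrite (wfunB wmus LZ LPs) (wfunB wmut LZ LPt) (wfunB wmus LPs LPt).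
ring.
Unshelve. all: by end_near. Qed.

(** In [poisson_difference] the norm of mu s is not known to be bounded near t;
    writing it as that of mu t plus that of mu s - mu t gives a bound on the
    latter that improves itself. *)
Lemma poisson_fcont : fcont rho t -> ocont P t -> fcont mu t.
Proof.
move=> rc Pc; have [Mt wmut] := nbhs_singleton muw; split; first by exists Mt.
move=> e e0; have M0 := wfun_ge0 wmut; have Z0 := woper_ge0 wZ.
have D0 : 0 < (2 * (1 + Mt)) * (MZ + 1) + 2 * (MZ + 1).
  by rewrite addr_gt0// mulr_gt0// ?ltr_wpDl// ?mulr_gt0// ltr_wpDr.
pose del := Num.min (2 * (MZ + 1))^-1 (e / ((2 * (1 + Mt)) * (MZ + 1) + 2 * (MZ + 1))).
have Z1 : 0 < MZ + 1 by rewrite ltr_wpDl.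
have del0 : 0 < del by rewrite lt_min invr_gt0 mulr_gt0//= divr_gt0.
have delZ : del * MZ <= 2^-1.
  have : del * (2 * (MZ + 1)) <= 1.
    by rewrite -ler_pdivlMr ?mulr_gt0// mul1r ge_min lexx.
  by have := ltW del0; lra.
have dele : del * ((2 * (1 + Mt)) * (MZ + 1) + 2 * (MZ + 1)) <= e.
  by rewrite -ler_pdivlMr// ge_min lexx orbT.
have [rct rcn] := rc; have [Pct Pcn] := Pc.
have pd := poisson_difference.
have rn := rcn _ del0; have Pn := Pcn _ del0.
near=> s.
have rs : wfun w del (fun h => rho s h - rho t h) by near: s.
have Ps : woper w del (fun h => P s h \- P t h) by near: s.
have [Ms wmus] : exists M, wfun w M (mu s) by near: s.
have pds : forall h, Lw w h ->
  mu s h - mu t h = rho s (Z h) - rho t (Z h) + mu s (P s (Z h) \- P t (Z h)) by near: s.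
pose a := del * MZ + Mt * (del * MZ).
have dZ0 : 0 <= del * MZ by rewrite mulr_ge0// ltW.
have a0 : 0 <= a by rewrite addr_ge0// mulr_ge0.
apply: (wfun_le (M := 2 * a)).
  apply: le_trans dele; rewrite /a.
  have : 0 <= del * Mt by rewrite mulr_ge0// ltW.
  have := ltW del0; lra.
apply: (wfun_self_bound (wfunl_sub wmus wmut)) => // N wN.
have wPZ := woper_comp Ps wZ.
have H := wfun_add (wfun_comp rs wZ) (wfun_add (wfun_comp wmut wPZ) (wfun_comp wN wPZ)).
have N0 := wfun_ge0 wN.
apply: (wfun_le (M := del * MZ + (Mt * (del * MZ) + N * (del * MZ)))).
  by rewrite /a addrA lerD2l ler_wpM2l.
by apply: wfun_ext H => h Lh; rewrite pds//=; ring.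
Unshelve. all: by end_near. Qed.

Lemma poisson_fdiff rho' P' : fdiff rho t rho' -> odiff P t P' ->
  fdiff mu t (fun h => rho' (Z h) + mu t (P' (Z h))).
Proof.
move=> dr dP; have rc := fdiff_fcont dr; have Pc := odiff_ocont dP.
have mc := poisson_fcont rc Pc; have [Mt wmut] := nbhs_singleton muw.
split; first by exists Mt.
have cZ := ocont_cst t wZ.
have H := fcont_lin 1 (fcont_comp dr.2 cZ) (fcont_comp (fcont_comp mc dP.2) cZ).
apply: fcont_near H.
have cP := ocont_woper Pc; have sP := ocont_woper dP.2.
have pd := poisson_difference.
near=> s.
have [Ms wmus] : exists M, wfun w M (mu s) by near: s.
have [Ns wPs] : exists M, woper w M (P s) by near: s.
have pds : forall h, Lw w h ->
  mu s h - mu t h = rho s (Z h) - rho t (Z h) + mu s (P s (Z h) \- P t (Z h)) by near: s.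
have [[Nt wPt] _] := Pc.
move=> h Lh; have LZ := woper_Lw wZ Lh.
rewrite mul1r /= /fslope /oslope; have [->//|st] := eqVneq s t.
rewrite (wfunZ w1 wmus); last exact: LwB (woper_Lw wPs LZ) (woper_Lw wPt LZ).
by rewrite pds//; ring.
Unshelve. all: by end_near. Qed.

(** The derivative solves an equation of the same kind.  It kills constants, being
    a limit of difference quotients that do. *)
Lemma poisson_derivative rho' P' Mrho' : wfun w Mrho' rho' ->
  fdiff rho t rho' -> odiff P t P' ->
  (forall h, Lw w h -> Z (h \- P t h \+ cst (pit h)) = h) ->
  let mu' h := rho' (Z h) + mu t (P' (Z h)) in
  mu' (cst 1) = 0 /\ forall h, Lw w h -> mu' (h \- P t h) = rho' h + mu t (P' h).
Proof.
move=> wrho' dr dP ZG mu'; have dm := poisson_fdiff dr dP.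
have [[M wmu] [[M' wmu'] sm]] := dm.
have {}wmu' : wfun w M' mu' by apply: wfun_ext wmu' => h _; rewrite /fslope eqxx.
have mu'1 : mu' (cst 1) = 0.
  apply/eqP; rewrite -normr_le0; apply/ler_addgt0Pr => e e0; rewrite add0r.
  have H := sm _ e0; have mu1t := nbhs_singleton mu1.
  have {}H : \forall s \near t^', wfun w e (fun h => fslope mu mu' t s h - fslope mu mu' t t h).
    exact: cvg_within.
  have mu1' : \forall s \near t^', mu s (cst 1) = kap by exact: cvg_within mu1.
  have st : \forall s \near t^', s != t by exact: nbhs_dnbhs_neq.
  near (t^')%R => s.
  have He : wfun w e (fun h => fslope mu mu' t s h - fslope mu mu' t t h) by near: s.
  have mus1 : mu s (cst 1) = kap by near: s.
  have snt : s != t by near: s.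
  have b1 : bnd w 1 (cst 1 : S -> R).
    by split; [exact: measurable_cst|move=> x; rewrite mul1r normr1].
  have := wfun_bnd He ler01 b1; rewrite /fslope eqxx (negbTE snt) mus1 mu1t subrr mulr0.
  by rewrite sub0r normrN mulr1.
split => // h Lh.
have [Nt wPt] := nbhs_singleton Pw.
have LP := woper_Lw wPt Lh.
have -> : mu' (h \- P t h) = mu' (h \- P t h \+ cst (pit h)).
  rewrite (wfunD wmu' (LwB Lh LP) (Lw_cst _ w1)) (wfun_cst w1 wmu') mu'1.
  by rewrite mulr0 addr0.
by rewrite /mu' ZG.
Unshelve. all: by end_near. Qed.

End poisson_equation.

End perturbation.

(** * Higher derivatives *)
Section higher_derivatives.
Context {d : measure_display} {S : measurableType d} {R : realType}.
Variables (w : S -> R) (w1 : forall x, 1 <= w x).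
Implicit Types (h g : S -> R) (e t s M : R) (n j : nat).

Let w0 x : 0 <= w x. Proof. exact: le_trans (w1 x). Qed.

Fixpoint fndiff n (L : nat -> R -> (S -> R) -> R) t : Prop :=
  if n is k.+1 then (\forall s \near t, fndiff k L s) /\ fdiff w (L k) t (L k.+1 t)
  else True.

Fixpoint ondiff n (D : nat -> R -> (S -> R) -> S -> R) t : Prop :=
  if n is k.+1 then (\forall s \near t, ondiff k D s) /\ odiff w (D k) t (D k.+1 t)
  else True.

Lemma fndiff_lt n L t j : fndiff n L t -> (j < n)%N -> fdiff w (L j) t (L j.+1 t).
Proof.
elim: n => // n IH [/nbhs_singleton Ln Lnt]; rewrite ltnS leq_eqVlt => /orP[/eqP ->//|].
exact: IH.
Qed.

Lemma ondiff_lt n D t j : ondiff n D t -> (j < n)%N -> odiff w (D j) t (D j.+1 t).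
Proof.
elim: n => // n IH [/nbhs_singleton Ln Lnt]; rewrite ltnS leq_eqVlt => /orP[/eqP ->//|].
exact: IH.
Qed.

(** The passage from the n-th to the next derivative in Leibniz' rule. *)
Lemma pascal_sum (a : nat -> R) n :
  \sum_(j < n) 'C(n, j)%:R * (a j.+1 + a j) + a n = \sum_(j < n.+1) 'C(n.+1, j)%:R * a j.
Proof.
have E : \sum_(j < n.+1) 'C(n, j)%:R * a j = \sum_(j < n) 'C(n, j)%:R * a j + a n.
  by rewrite big_ord_recr /= binn mul1r.
rewrite [RHS]big_ord_recl /= bin0 mul1r.
have -> : \sum_(i < n) 'C(n.+1, bump 0 i)%:R * a (bump 0 i) =
    \sum_(i < n) 'C(n, i.+1)%:R * a i.+1 + \sum_(i < n) 'C(n, i)%:R * a i.+1.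
  by rewrite -big_split; apply: eq_bigr => i _; rewrite /bump/= add1n binS natrD mulrDl.
rewrite addrA [in RHS]addrC.
have -> : a 0%N + \sum_(i < n) 'C(n, i.+1)%:R * a i.+1 =
    \sum_(j < n) 'C(n, j)%:R * a j + a n.
  by rewrite -E big_ord_recl /= bin0 mul1r.
by rewrite addrA -big_split; congr (_ + _); apply: eq_bigr => j _ /=; ring.
Qed.

Variables (D : nat -> R -> (S -> R) -> S -> R) (mu0 : R -> (S -> R) -> R).
Variables (Z : R -> (S -> R) -> S -> R).

(** Each derivative is defined from all the earlier ones, hence a recursion on
    the list of the first n + 1 of them. *)
Fixpoint derivatives s n : seq ((S -> R) -> R) :=
  if n is k.+1 then
    rcons (derivatives s k) (fun h => \sum_(j < k.+1) 'C(k.+1, j)%:R *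
      nth (fun=> 0) (derivatives s k) j (D (k.+1 - j)%N s (Z s h)))
  else [:: mu0 s].

Definition derivative n s : (S -> R) -> R := nth (fun=> 0) (derivatives s n) n.
Local Notation mu := derivative.

Lemma size_derivatives s n : size (derivatives s n) = n.+1.
Proof. by elim: n => //= n IH; rewrite size_rcons IH. Qed.

Lemma nth_derivatives s n j : (j <= n)%N -> nth (fun=> 0) (derivatives s n) j = mu j s.
Proof.
elim: n => [|n IH]; first by rewrite leqn0 => /eqP ->.
rewrite leq_eqVlt => /orP[/eqP ->//|]; rewrite ltnS => jn.
by rewrite /= nth_rcons size_derivatives ltnS jn IH.
Qed.

(** Right-hand side of the equation mu_n (I - P) = rho_n obtained by
    differentiating mu_0 (I - P) = 0 by Leibniz' rule. *)
Definition rho n s h : R := \sum_(j < n) 'C(n, j)%:R * mu j s (D (n - j)%N s h).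

Lemma derivativeS n s h : mu n.+1 s h = rho n.+1 s (Z s h).
Proof.
rewrite {1}/mu /= nth_rcons size_derivatives ltnn eqxx /rho.
by apply: eq_bigr => j _; rewrite nth_derivatives// -ltnS.
Qed.

(** The hypotheses under which the perturbation lemmas apply to mu_n. *)
Definition regular n s :=
  [/\ exists M, wfun w M (mu n s), mu n s (cst 1) = (n == 0%N)%:R &
      forall h, Lw w h -> mu n s (h \- D 0%N s h) = rho n s h].

Variable (U : set R).
Hypothesis U_open : forall t, U t -> \forall s \near t, U s.
Hypothesis U_regular : forall s, U s -> regular 0 s.
Hypothesis D0w : forall s, U s -> exists M, woper w M (D 0%N s).
Hypothesis Zw : forall s, U s -> exists M, woper w M (Z s).
Hypothesis GZ : forall s, U s -> forall h, Lw w h ->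
  Z s h \- D 0%N s (Z s h) \+ cst (mu0 s (Z s h)) = h.
Hypothesis ZG : forall s, U s -> forall h, Lw w h ->
  Z s (h \- D 0%N s h \+ cst (mu0 s h)) = h.

(** The derivative of rho n by the product rule. *)
Definition drho n s h : R := \sum_(j < n) 'C(n, j)%:R *
  (mu j.+1 s (D (n - j)%N s h) + mu j s (D (n - j).+1 s h)).

Lemma fdiff_rho n t : fndiff n mu t -> ondiff n.+1 D t -> fdiff w (rho n) t (drho n t).
Proof.
move=> mun Dn; apply: (fdiff_sum _ (F := fun (j : 'I_n) s h =>
  'C(n, j)%:R * mu j s (D (n - j)%N s h)) (F' := fun (j : 'I_n) h =>
  'C(n, j)%:R * (mu j.+1 t (D (n - j)%N t h) + mu j t (D (n - j).+1 t h)))) => j.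
have dj := fndiff_lt mun (ltn_ord j).
have dD := ondiff_lt Dn (leq_ltn_trans (leq_subr j n) (ltnSn n)).
have := fdiff_lin ('C(n, j)%:R) (fdiff_comp w1 dj dD) (fdiff_zero w t).
apply: fdiff_near; first by apply: near_all => s h _; rewrite addr0.
by move=> h _; rewrite addr0.
Qed.

Lemma drhoE n s h : drho n s h + mu n s (D 1%N s h) = rho n.+1 s h.
Proof.
rewrite /drho /rho.
rewrite -(pascal_sum (fun j => mu j s (D (n.+1 - j)%N s h))) /= subSn// subnn.
congr (_ + _); apply: eq_bigr => j _.
by rewrite subSS (subSn (ltnW (ltn_ord j))).
Qed.

Lemma derivative_step n t : U t -> ondiff n.+1 D t -> fndiff n mu t ->
  (\forall s \near t, regular n s) ->
  fdiff w (mu n) t (mu n.+1 t) /\ regular n.+1 t.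
Proof.
move=> Ut Dt mut reg; have [M wZ] := Zw Ut.
have muw : \forall s \near t, exists M, wfun w M (mu n s) by apply: filterS reg => s [].
have mu1 : \forall s \near t, mu n s (cst 1) = (n == 0%N)%:R by apply: filterS reg => s [].
have muP : \forall s \near t, forall h, Lw w h -> mu n s (h \- D 0%N s h) = rho n s h.
  by apply: filterS reg => s [].
have Pw : \forall s \near t, exists M, woper w M (D 0%N s).
  by apply: filterS (U_open Ut) => s; exact: D0w.
have dr := fdiff_rho mut Dt; have dP := ondiff_lt Dt (ltn0Sn n).
have dm := poisson_fdiff w1 wZ (GZ Ut) muw mu1 muP Pw dr dP.
have [_ [[Mr wr] _]] := dr.
have {}wr : wfun w Mr (drho n t) by apply: wfun_ext wr => h _; rewrite /fslope eqxx.
have [d1 dE] := poisson_derivative w1 wZ (GZ Ut) muw mu1 muP Pw wr dr dP (ZG Ut).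
have muE h : drho n t (Z t h) + mu n t (D 1%N t (Z t h)) = mu n.+1 t h.
  by rewrite drhoE derivativeS.
have dm' : fdiff w (mu n) t (mu n.+1 t).
  by apply: fdiff_near dm; [apply: near_all|move=> h _; exact: muE].
split => //; split.
- have [_ [[M' wm] _]] := dm'; exists M'.
  by apply: wfun_ext wm => h _; rewrite /fslope eqxx.
- by rewrite -muE d1.
- by move=> h Lh; rewrite -muE dE// drhoE.
Qed.

Lemma derivatives_exist n t : U t -> ondiff n D t ->
  fndiff n mu t /\ forall k, (k <= n)%N -> regular k t.
Proof.
elim: n t => [|n IH] t Ut Dt.
  by split => // k; rewrite leqn0 => /eqP ->; exact: U_regular.
have near_n : \forall s \near t, fndiff n mu s /\ forall k, (k <= n)%N -> regular k s.
  have := Dt.1; move: (U_open Ut); apply: filterS2 => s Us Ds; exact: IH.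
have [mun regn] := nbhs_singleton near_n.
have [dmu reg] : fdiff w (mu n) t (mu n.+1 t) /\ regular n.+1 t.
  apply: derivative_step => //.
  by apply: filterS near_n => s [_ H]; exact: H.
split; first by split => //; apply: filterS near_n => s [].
by move=> k; rewrite leq_eqVlt => /orP[/eqP ->//|]; rewrite ltnS; exact: regn.
Qed.

(** Continuity of the last derivative: here D n.+1 is only continuous at t, and
    rho n.+1 is still continuous because it involves no further derivative. *)
Lemma derivative_fcont n t : U t -> (\forall s \near t, ondiff n.+1 D s) ->
  ocont w (D n.+1) t -> fcont w (mu n.+1) t.
Proof.
move=> Ut Dn Dc; have [M wZ] := Zw Ut.
have near_n : \forall s \near t, fndiff n.+1 mu s /\ forall k, (k <= n.+1)%N -> regular k s.
  by move: (U_open Ut) Dn; apply: filterS2 => s; exact: derivatives_exist.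
have [mun regn] := nbhs_singleton near_n; have Dt := nbhs_singleton Dn.
have reg : \forall s \near t, regular n.+1 s by apply: filterS near_n => s [_ H]; exact: H.
have muw : \forall s \near t, exists M, wfun w M (mu n.+1 s) by apply: filterS reg => s [].
have mu1 : \forall s \near t, mu n.+1 s (cst 1) = 0 by apply: filterS reg => s [].
have muP : \forall s \near t, forall h, Lw w h -> mu n.+1 s (h \- D 0%N s h) = rho n.+1 s h.
  by apply: filterS reg => s [].
have Pw : \forall s \near t, exists M, woper w M (D 0%N s).
  by apply: filterS (U_open Ut) => s; exact: D0w.
have Dci i : (i <= n.+1)%N -> ocont w (D i) t.
  rewrite leq_eqVlt => /orP[/eqP ->//|ilt].
  exact: odiff_ocont w1 _ _ _ (ondiff_lt Dt ilt).
apply: (poisson_fcont w1 wZ (GZ Ut) muw mu1 muP Pw); last exact: Dci.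
apply: (fcont_sum _ (F := fun (j : 'I_n.+1) s h =>
  'C(n.+1, j)%:R * mu j s (D (n.+1 - j)%N s h))) => j.
have cj := fdiff_fcont (fndiff_lt mun (ltn_ord j)).
have := fcont_lin ('C(n.+1, j)%:R) (fcont_comp cj (Dci _ (leq_subr j _))) (fcont_zero w t).
by apply: fcont_near; apply: near_all => s h _; rewrite addr0.
Qed.

End higher_derivatives.

(** * Derivatives in the spaces of measures and kernels *)
Section translation.
Context {d : measure_display} {S : measurableType d} {R : realType}.
Implicit Types (h g : S -> R) (e t s M : R) (n j : nat).

Lemma probability_inhabited (mu : probability S R) : exists x : S, True.
Proof.
apply: contrapT => nS; have : mu [set: S] = 1%E by exact: probability_setT.
rewrite (_ : [set: S] = set0) ?measure0.
  by move=> /esym/eqP; rewrite onee_eq0.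
by apply/seteqP; split => // x _; apply: nS; exists x.
Qed.

Lemma lty_bound (x : \bar R) : (x < +oo)%E -> exists2 M, 0 <= M & (x <= M%:E)%E.
Proof.
case: x => [x _| |_] //; last by exists 0; rewrite ?leNye.
by exists `|x| => //; rewrite lee_fin ler_norm.
Qed.

Lemma ereal_cvg0_le {T : Type} {F : set_system T} {FF : Filter F} (f : T -> \bar R) :
  f x @[x --> F] --> 0%E -> forall e, 0 < e -> \forall x \near F, (f x <= e%:E)%E.
Proof.
move=> /fine_cvgP[ffin /cvgrPdist_le f0] e e0.
move: ffin (f0 e e0); apply: filterS2 => x fx /=.
rewrite sub0r normrN => H; rewrite -(fineK fx) lee_fin.
exact: le_trans (ler_norm _) H.
Qed.

Lemma le_ereal_cvg0 {T : Type} {F : set_system T} {FF : Filter F} (f : T -> \bar R) :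
  (forall x, 0 <= f x)%E -> (forall e, 0 < e -> \forall x \near F, (f x <= e%:E)%E) ->
  f x @[x --> F] --> 0%E.
Proof.
move=> f0 fe; have H := fe 1 ltr01; apply/fine_cvgP; split.
  by apply: filterS H => x fx; rewrite ge0_fin_numE// (le_lt_trans fx)// ltry.
apply/cvgrPdist_le => e e0; move: H (fe e e0); apply: filterS2 => x fx fxe /=.
have fxfin : f x \is a fin_num by rewrite ge0_fin_numE// (le_lt_trans fx)// ltry.
by rewrite sub0r normrN ger0_norm ?fine_ge0// -lee_fin fineK.
Qed.

Lemma near_increment t (A : R -> Prop) :
  (\forall h \near 0^', A h) -> \forall s \near t, s != t -> A (s - t).
Proof.
move=> A0; have {}A0 : \forall h \near (0 : R), h != 0 -> A h by exact: A0.
have c : s - t @[s --> t] --> (0 : R).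
  by rewrite -(subrr t); apply: cvgB; [exact: cvg_id|exact: cvg_cst].
have H : \forall s \near t, s - t != 0 -> A (s - t) by exact: (c _ A0).
by apply: filterS H => s; rewrite subr_eq0.
Qed.

Lemma near_point t (A : R -> Prop) :
  (\forall s \near t, s != t -> A s) -> \forall h \near 0^', A (t + h).
Proof.
move=> At; have c : t + h @[h --> (0 : R)] --> t.
  by rewrite -[X in _ --> X]addr0; apply: cvgD; [exact: cvg_cst|exact: cvg_id].
have H : \forall h \near (0 : R), t + h != t -> A (t + h) by exact: (c _ At).
have {}H : \forall h \near (0 : R), h != 0 -> A (t + h).
  by apply: filterS H => h; rewrite -subr_eq0 addrAC subrr add0r.
exact: H.
Qed.

Variables (w : S -> R) (w1 : forall x, 1 <= w x) (mw : measurable_fun [set: S] w).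
Variable (x0 : S).

Lemma calLw_woper Q : ns_mem (n := calLw w) Q ->
  (exists M, woper w M (kint Q)) /\ krepresents (kint Q) Q.
Proof.
move=> [mQ /lty_bound[M M0 QM]]; have [wQ rQ] := wnorm_skernel_woper w1 mw x0 M0 mQ QM.
by split => //; exists M.
Qed.

Lemma wnorm_skernel_le_woper Q T M e : woper w M T -> krepresents T Q -> 0 <= e ->
  (wnorm_skernel w Q <= e%:E)%E -> woper w e T.
Proof.
move=> wT TQ e0 Qe.
have [wQ _] := wnorm_skernel_woper w1 mw x0 e0 (krepresents_measurable w1 wT TQ) Qe.
apply: woper_ext wQ => h Lh; apply/funext => x.
by rewrite /kint /cint (represents_cint w1 mw (woper_wfun wT x) (TQ x) Lh).
Qed.

Lemma krepresents_sub T U Q Q' : krepresents T Q -> krepresents U Q' ->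
  krepresents (fun h => T h \- U h) (skernel_sub Q Q').
Proof. by move=> TQ UQ x; exact: represents_sub (TQ x) (UQ x). Qed.

Lemma krepresents_scale a T Q : krepresents T Q ->
  krepresents (fun h => a \*o T h) (skernel_scale a Q).
Proof. by move=> TQ x; exact: represents_scale (TQ x). Qed.

Lemma norm_cvg_ocont (G : R -> signed_kernel S R) t :
  (\forall s \near t, ns_mem (n := calLw w) (G s)) ->
  wnorm_skernel w (skernel_sub (G s) (G t)) @[s --> t] --> 0%E ->
  ocont w (fun s => kint (G s)) t.
Proof.
move=> Gmem Gt; have [[Mt wGt] rGt] := calLw_woper (nbhs_singleton Gmem).
split; first by exists Mt.
move=> e e0; have Ge := @ereal_cvg0_le _ _ (nbhs_filter t) _ Gt _ e0.
near=> s.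
have /calLw_woper[[Ms wGs] rGs] : ns_mem (n := calLw w) (G s) by near: s.
have Gse : (wnorm_skernel w (skernel_sub (G s) (G t)) <= e%:E)%E by near: s.
exact: wnorm_skernel_le_woper (woper_sub wGs wGt) (krepresents_sub rGs rGt) (ltW e0) Gse.
Unshelve. all: by end_near. Qed.

Lemma diff_at_odiff (F : R -> signed_kernel S R) t v :
  @diff_at R (calLw w) F t v -> odiff w (fun s => kint (F s)) t (kint v).
Proof.
move=> [Fmem vmem Fv]; have [[Mt wFt] rFt] := calLw_woper (nbhs_singleton Fmem).
have [[Mv wv] rv] := calLw_woper vmem.
split; first by exists Mt.
split; first by exists Mv; apply: woper_ext wv => h _; rewrite /oslope eqxx.
move=> e e0; have Fe := near_increment t (@ereal_cvg0_le _ _ (dnbhs_filter _) _ Fv _ e0).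
near=> s.
have /calLw_woper[[Ms wFs] rFs] : ns_mem (n := calLw w) (F s) by near: s.
have H : s != t -> (wnorm_skernel w (skernel_sub (skernel_scale (s - t)^-1%R
    (skernel_sub (F (t + (s - t))%R) (F t))) v) <= e%:E)%E by near: s.
have [->|st] := eqVneq s t.
  apply: (woper_le (fun x => le_trans ler01 (w1 x)) (ltW e0)).
  have := woper_scale 0 wv; rewrite normr0 mul0r; apply: woper_ext => h _.
  by apply/funext => x /=; ring.
have wd := woper_sub (woper_scale (s - t)^-1 (woper_sub wFs wFt)) wv.
have rd := krepresents_sub (krepresents_scale (s - t)^-1 (krepresents_sub rFs rFt)) rv.
have := H st; rewrite (addrC t) subrK => Hn.
have := wnorm_skernel_le_woper wd rd (ltW e0) Hn.
by apply: woper_ext => h _; rewrite /oslope eqxx (negbTE st).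
Unshelve. all: by end_near. Qed.

Lemma ndiff_at_ondiff n (D : nat -> R -> signed_kernel S R) t :
  @ndiff_at R (calLw w) n D t -> ondiff w n (fun k s => kint (D k s)) t.
Proof.
elim: n t => //= n IH t [Dn Dt]; split; last exact: diff_at_odiff.
by apply: filterS Dn => s; exact: IH.
Qed.

Lemma ndiff_at_mem n (D : nat -> R -> signed_kernel S R) t j :
  @ndiff_at R (calLw w) n D t -> (0 < j <= n)%N -> ns_mem (n := calLw w) (D j t).
Proof.
elim: n => [|n IH] /=; first by case: j.
move=> [/nbhs_singleton Dn [_ Dmem _]] /andP[j0].
rewrite leq_eqVlt => /orP[/eqP ->//|jn]; by apply: IH => //; rewrite j0.
Qed.

Lemma wnorm_charge_ge0 (nu : {charge set S -> \bar R}) : (0 <= wnorm_charge w nu)%E.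
Proof.
have : (`|cintegral nu (EFin \o (cst 0%R : S -> R))| <= wnorm_charge w nu)%E; last first.
  by apply: le_trans; exact: abse_ge0.
apply: ereal_sup_ubound; exists (cst 0) => //; split.
  by apply/(in_LwE w1); exact: Lw_cst.
by apply: (wnorm_fun_le w1) => x; rewrite mul1r normr0 (le_trans _ (w1 x)).
Qed.

Lemma Mw_mem M l nu : wfun w M l -> represents l nu -> ns_mem (n := Mw w) nu.
Proof. by move=> wl lnu; rewrite /= (le_lt_trans (wnorm_charge_le w1 mw wl lnu))// ltry. Qed.

Lemma fcont_norm_cvg (G : R -> {charge set S -> \bar R}) (l : R -> (S -> R) -> R) t :
  (\forall s \near t, represents (l s) (G s)) -> fcont w l t ->
  wnorm_charge w (csub (G s) (G t)) @[s --> t] --> 0%E.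
Proof.
move=> rG [_ lc]; have rGt := nbhs_singleton rG.
apply: le_ereal_cvg0 => [s|e e0]; first exact: wnorm_charge_ge0.
move: rG (lc e e0); apply: filterS2 => s rGs ws.
exact: (wnorm_charge_le w1 mw ws (represents_sub rGs rGt)).
Qed.

Lemma fdiff_diff_at (G : R -> {charge set S -> \bar R}) (l : R -> (S -> R) -> R) l' t v :
  (\forall s \near t, represents (l s) (G s)) -> represents l' v ->
  fdiff w l t l' -> @diff_at R (Mw w) G t v.
Proof.
move=> rG rv dl; have rGt := nbhs_singleton rG; split.
- move: rG (fcont_wfun (fdiff_fcont dl)); apply: filterS2 => s rGs [M ws].
  exact: Mw_mem ws rGs.
- have [_ [[M wl'] _]] := dl; apply: Mw_mem rv.
  by apply: wfun_ext wl' => h _; rewrite /fslope eqxx.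
- have [_ [[M wl'] sc]] := dl.
  apply: le_ereal_cvg0 => [s|e e0]; first exact: wnorm_charge_ge0.
  have H : \forall s \near t, s != t ->
      (wnorm_charge w (csub (cscale (s - t)^-1%R (csub (G s) (G t))) v) <= e%:E)%E.
    move: rG (sc e e0); apply: filterS2 => s rGs ws st.
    have r := represents_sub (represents_scale (s - t)^-1 (represents_sub rGs rGt)) rv.
    apply: (wnorm_charge_le w1 mw _ r); apply: wfun_ext ws => h _.
    by rewrite /fslope eqxx (negbTE st).
  have := near_point H; apply: filterS => h; have -> : t + h - t = h by ring.
  by [].
Qed.

Lemma fndiff_ndiff_at n (L : nat -> R -> (S -> R) -> R)
    (G : nat -> R -> {charge set S -> \bar R}) t :
  (forall k s M, wfun w M (L k s) -> represents (L k s) (G k s)) ->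
  fndiff w n L t -> @ndiff_at R (Mw w) n G t.
Proof.
move=> LG; elim: n t => //= n IH t [Ln dLt]; split.
  by apply: filterS Ln => s; exact: IH.
apply: (fdiff_diff_at _ _ dLt).
  have Lw' := fcont_wfun (fdiff_fcont dLt).
  by near=> s; have [M] : exists M, wfun w M (L n s) by [near: s]; exact: LG.
have [_ [[M wl'] _]] := dLt; apply: (LG _ _ M).
by apply: wfun_ext wl' => h _; rewrite /fslope eqxx.
Unshelve. all: by end_near. Qed.

Lemma kint_kop (Q : R.-pker S ~> S) : ns_mem (n := calLw w) (skernel_of Q) ->
  (exists M, woper w M (kop Q)) /\ forall h, Lw w h -> kint (skernel_of Q) h = kop Q h.
Proof.
move=> [mQ /lty_bound[M M0 QM]]; have wQ := calLw_kop x0 w1 mw M0 mQ QM.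
split; first by exists M.
move=> h Lh; apply/funext => x; rewrite /kint /cint.
by rewrite (represents_cint w1 mw (woper_wfun wQ x) (@krepresents_kop _ _ _ Q x) Lh).
Qed.

End translation.

Local Open Scope ereal_scope.

(** * Smoothness of the stationary distributions *)
Theorem theorem2p3 (R : realType) (d : measure_display) (S : measurableType d)
  (cont : bool)
  (a b theta0 : R) (htheta0 : (a < theta0 < b)%R)
  (P : R -> R.-pker S ~> S)
  (A : set S) (mA : measurable A)
  (epsilon c lambda r : R)
  (hepsilon : (0 < epsilon)%R) (hc : (0 < c)%R)
  (hlambda : (0 < lambda < 1)%R) (hr : (0 < r < 1)%R)
  (m : nat) (hm : (1 <= m)%N)
  (phi : probability S R)
  (w : S -> R) (mw : measurable_fun [set: S] w) (w_ge1 : forall x, (1 <= w x)%R)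
  (P' : R -> signed_kernel S R)
  (drift : forall x,
    \int[P theta0 x]_y (w y)%:E <= (r * w x + c * \1_A x)%:E)
  (minorization : forall theta x B, (a < theta < b)%R ->
    (`|theta - theta0| < epsilon)%R -> A x -> measurable B ->
    lambda%:E * phi B <= kernel_pow (P theta) m x B)
  (derivP : @deriv_at R (calLw w) cont
    (fun theta => skernel_of (P theta)) theta0 P') :
  exists (pi : R -> probability S R) (pi' : R -> {charge set S -> \bar R})
    (Z : signed_kernel S R),
    [/\ \forall theta \near theta0,
          positive_harris_recurrent (P theta) /\
          stationary (P theta) (pi theta) /\
          (forall mu : probability S R, stationary (P theta) mu ->
             forall B, measurable B -> mu B = pi theta B),
        \forall theta \near theta0,
          ns_mem (n := Mw w) (charge_of_prob (pi theta)),
        @deriv_at R (Mw w) cont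
          (fun theta => charge_of_prob (pi theta)) theta0 pi',
        let G := skernel_add
                   (skernel_sub skernel_id (skernel_of (P theta0)))
                   (skernel_cst (charge_of_prob (pi theta0))) in
        [/\ ns_mem (n := calLw w) Z,
            skernel_eq (skernel_comp G Z) skernel_id &
            skernel_eq (skernel_comp Z G) skernel_id] &
        charge_eq (pi' theta0)
          (skernel_act
            (skernel_act (charge_of_prob (pi theta0)) (P' theta0)) Z)]
    /\
    forall (n : nat) (DP : nat -> R -> signed_kernel S R), (1 <= n)%N ->
      (forall theta, DP 0%N theta = skernel_of (P theta)) ->
      @nderiv_at R (calLw w) cont n DP theta0 ->
      exists Dpi : nat -> R -> {charge set S -> \bar R},
        [/\ forall theta, Dpi 0%N theta = charge_of_prob (pi theta),
            @nderiv_at R (Mw w) cont n Dpi theta0 &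
            forall B, measurable B ->
              Dpi n theta0 B =
              \sum_(0 <= j < n) ('C(n, j)%:R)%:E *
                skernel_act
                  (skernel_act (Dpi j theta0) (DP (n - j)%N theta0)) Z B].
Proof.
have [x0 _] := probability_inhabited phi.
have /andP[r0 r1] := hr; have /andP[lam0 _] := hlambda.
have w_ge0 x : (0 <= w x)%R by exact: le_trans (w_ge1 x).
have Lww : Lw w w by exact: Lw_self.
pose K s := kint (skernel_of (P s)).
have dP : @diff_at R (calLw w) (fun theta => skernel_of (P theta)) theta0 (P' theta0).
  by move: derivP; rewrite /deriv_at; case: (cont) => [[/nbhs_singleton]|].
have [_ Kc] : ocont w K theta0 := odiff_ocont w_ge1 (diff_at_odiff w_ge1 mw x0 dP).
have [Pmem _ _] := dP.
have drift0 x : (kop (P theta0) w x <= r * w x + c * \1_A x)%R.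
  rewrite -lee_fin; apply: le_trans (drift x); rewrite /kop -(rintE w_ge1 mw _ Lww)//.
  exact: le_lt_trans (drift x) (ltry _).
(* norm (1 - r) / 2 keeps the drift rate of P s below (1 + r) / 2 *)
pose good s := [/\ (a < s < b)%R, (`|s - theta0| < epsilon)%R,
  ns_mem (n := calLw w) (skernel_of (P s)) &
  woper w ((1 - r) / 2)%R (fun h => (K s h \- K theta0 h)%R)].
have good_near : \forall s \near theta0, good s.
  have /andP[a0 b0] := htheta0.
  have ha : (0 < (theta0 - a) / 2)%R by lra.
  have hb : (0 < (b - theta0) / 2)%R by lra.
  have he : (0 < epsilon / 2)%R by lra.
  have hr1 : (0 < (1 - r) / 2)%R by lra.
  have na := near_dist theta0 ha; have nb := near_dist theta0 hb.
  have ne := near_dist theta0 he; have nK := Kc _ hr1.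
  near=> s.
  have sa : (`|s - theta0| <= (theta0 - a) / 2)%R by near: s.
  have sb : (`|s - theta0| <= (b - theta0) / 2)%R by near: s.
  have se : (`|s - theta0| <= epsilon / 2)%R by near: s.
  split; [| |by near: s|by near: s]; last by lra.
  move: sa sb; rewrite !ler_norml => /andP[sa1 sa2] /andP[sb1 sb2].
  by apply/andP; split; lra.
(* the induction on derivatives differentiates at points near theta0, and so
   needs an open set of good parameters *)
pose U : set R := interior [set s | good s].
have U0 : U theta0 by exact: good_near.
have U_open t : U t -> \forall s \near t, U s by exact: nbhs_interior.
have U_good s : U s -> good s by exact: nbhs_singleton.
pose ergodic s (pZ : probability S R * ((S -> R) -> S -> R)) :=
  [/\ positive_harris_recurrent (P s), stationary (P s) pZ.1 &
      forall mu : probability S R, stationary (P s) mu ->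
        forall B, measurable B -> mu B = pZ.1 B] /\
  [/\ exists M, wfun w M (rint pZ.1), exists M, woper w M pZ.2,
      (forall h, Lw w h -> pZ.2 h \- K s (pZ.2 h) \+ cst (rint pZ.1 (pZ.2 h)) = h)%R &
      (forall h, Lw w h -> pZ.2 (h \- K s h \+ cst (rint pZ.1 h)) = h)%R].
have /boolp.choice[f f_ergodic] : forall s, exists pZ, U s -> ergodic s pZ.
  move=> s; have [Us|nUs] := pselect (U s); last by exists (phi, id).
  have [sab seps smem sK] := U_good _ Us.
  have [[M wQ] KE] := kint_kop w_ge1 mw x0 smem.
  have [_ _ mem0 _] := U_good _ U0.
  have [_ KE0] := kint_kop w_ge1 mw x0 mem0.
  have r'01 : (0 < (1 + r) / 2 < 1)%R by apply/andP; split; lra.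
  have drifts x : (kop (P s) w x <= (1 + r) / 2 * w x + c * \1_A x)%R.
    have b1 : bnd w 1 w by split => // y; rewrite mul1r ger0_norm.
    have := (woper_bnd ler01 sK b1).2 x; rewrite /K/= KE// KE0// mulr1 ler_norml.
    by move=> /andP[_]; have := drift0 x; lra.
  have minors x B : A x -> measurable B ->
      lambda%:E * phi B <= kernel_pow (P s) m x B by exact: minorization.
  have [pi [Z [Mpi [MZ [H [wpi wZ GZ ZG]]]]]] :=
    drift_minorization_ergodic w_ge1 mw wQ x0 r'01 hc lam0 mA drifts minors.
  exists (pi, Z) => _; split => //; split; [by exists Mpi|by exists MZ| |] => h Lh /=.
    by rewrite /K KE ?GZ//; exact: woper_Lw wZ Lh.
  by rewrite /K KE ?ZG.
pose pi s := (f s).1; pose Zo s := (f s).2.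
(* the first derivative is the case n = 0, with DP made of P and P' *)
have higher n (DP : nat -> R -> signed_kernel S R) :
    (forall theta, DP 0%N theta = skernel_of (P theta)) ->
    @nderiv_at R (calLw w) cont n.+1 DP theta0 ->
    exists Dpi : nat -> R -> {charge set S -> \bar R},
    [/\ forall theta, Dpi 0%N theta = charge_of_prob (pi theta),
        @nderiv_at R (Mw w) cont n.+1 Dpi theta0 &
        forall Z : signed_kernel S R, krepresents (Zo theta0) Z ->
        forall B, measurable B -> Dpi n.+1 theta0 B =
          \sum_(0 <= j < n.+1) ('C(n.+1, j)%:R)%:E *
            skernel_act (skernel_act (Dpi j theta0) (DP (n.+1 - j)%N theta0)) Z B].
  move=> DP0 DPn.
  pose D k s := kint (DP k s).
  have D0 s : D 0%N s = K s by rewrite /D DP0.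
  pose mu0 s := rint (pi s).
  pose mu := derivative D mu0 Zo.
  have D0w s : U s -> exists M, woper w M (D 0%N s).
    by move=> /U_good[_ _ /(calLw_woper w_ge1 mw x0)[wK _] _]; rewrite D0.
  have Zw s : U s -> exists M, woper w M (Zo s) by move=> /f_ergodic[_ []].
  have GZ s : U s -> forall h, Lw w h ->
      (Zo s h \- D 0%N s (Zo s h) \+ cst (mu0 s (Zo s h)) = h)%R.
    by move=> /f_ergodic[_ [_ _ GZ _]] h Lh; rewrite D0; exact: GZ.
  have ZG s : U s -> forall h, Lw w h ->
      (Zo s (h \- D 0%N s h \+ cst (mu0 s h)) = h)%R.
    by move=> /f_ergodic[_ [_ _ _ ZG]] h Lh; rewrite D0; exact: ZG.
  have U_regular s : U s -> regular w D mu0 Zo 0 s.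
    move=> Us; have [[_ st _] [[M wpi] _ _ _]] := f_ergodic _ Us.
    have [_ _ smem _] := U_good _ Us.
    have [[N wQ] KE] := kint_kop w_ge1 mw x0 smem.
    split; [by exists M|exact: rint_prob_cst1|] => h Lh.
    have LQ := woper_Lw wQ Lh.
    rewrite /rho big_ord0 D0 /K KE// -[LHS]/(rint (pi s) (h \- kop (P s) h)%R).
    rewrite (wfunB wpi Lh LQ); apply/eqP; rewrite subr_eq0; apply/eqP/esym.
    apply: (wfun_eq w_ge1 (wfun_comp wpi wQ) wpi) Lh => B mB.
    by have /stationaryP := st; apply; exact: Lw_indic.
  pose Dpi k s := if k is 0%N then charge_of_prob (pi s)
    else charge_of (fun B => (mu k s \1_B)%:E).
  have rDpi k s M : wfun w M (mu k s) -> represents (mu k s) (Dpi k s).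
    case: k => [_ B mB|k wm]; last exact: charge_ofP wm _.
    rewrite -[RHS]/((rint (pi s) \1_B)%:E) rint_indic// fineK//.
    exact: (fin_num_measure (pi s)).
  have ex k s := @derivatives_exist _ _ _ w w_ge1 D mu0 Zo U U_open U_regular D0w Zw GZ ZG k s.
  have [DPnear DPderiv] := DPn.
  have DPdiff : @diff_at R (calLw w) (DP n) theta0 (DP n.+1 theta0).
    by move: DPderiv; rewrite /deriv_at; case: (cont) => [[/nbhs_singleton]|].
  have DPn1 : @ndiff_at R (calLw w) n.+1 DP theta0 := conj DPnear DPdiff.
  have [mun1 regn1] := ex _ _ U0 (ndiff_at_ondiff w_ge1 mw x0 DPn1).
  have Dpin1 := fndiff_ndiff_at w_ge1 mw rDpi mun1.
  exists Dpi; split => //.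
    have [Dpinear Dpidiff] := Dpin1.
    split; first exact: Dpinear.
    move: DPderiv; rewrite /deriv_at; case: (cont) => [[DPd DPc]|_]; last exact: Dpidiff.
    have DPn1s : \forall s \near theta0, @ndiff_at R (calLw w) n.+1 DP s.
      have DPnn := nbhs_interior DPnear.
      by move: DPnn DPd; apply: filterS2 => s DPns DPds; exact: (conj DPns DPds).
    have on1 : \forall s \near theta0, ondiff w n.+1 D s.
      by apply: filterS DPn1s => s; exact: ndiff_at_ondiff.
    have Dc : ocont w (D n.+1) theta0.
      apply: (norm_cvg_ocont w_ge1 mw x0) DPc.
      by apply: filterS DPd => s [].
    have muc := derivative_fcont w_ge1 U_open U_regular D0w Zw GZ ZG U0 on1 Dc.
    split.
      move: (U_open _ U0) on1; apply: filterS2 => s Us os.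
      by have [] := fndiff_ndiff_at w_ge1 mw rDpi (ex _ _ Us os).1.
    apply: (fcont_norm_cvg w_ge1 mw _ muc).
    by apply: filterS (fcont_wfun muc) => s [M]; exact: rDpi.
  move=> Z ZoZ B mB.
  have [Mz wZ] := Zw _ U0.
  have [[M wm] _ _] := regn1 n.+1 (leqnn _).
  rewrite (rDpi _ _ _ wm B mB) -/mu /mu derivativeS -/mu /rho -sumEFin big_mkord.
  apply: eq_bigr => j _; rewrite EFinM; congr (_ * _).
  have [[Mj wj] _ _] := regn1 j (ltnW (ltn_ord j)).
  have Dmem : ns_mem (n := calLw w) (DP (n.+1 - j)%N theta0).
    by apply: (ndiff_at_mem DPn1); rewrite subn_gt0 ltn_ord leq_subr.
  have [[Md wD] rD] := calLw_woper w_ge1 mw x0 Dmem.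
  have r1' := represents_act w_ge1 mw wj wD (rDpi _ _ _ wj) rD.
  exact/esym/(represents_act w_ge1 mw (wfun_comp wj wD) wZ r1' ZoZ).
have [_ [[Mpi wpi] [MZ wZ] GZ ZG]] := f_ergodic _ U0.
have [Z ZoZ] := exists_skernel w_ge1 wZ.
have [|Dpi1 [Dpi10 Dpi1d Dpi1E]] := higher 0%N (fun k => if k is 0%N then
    (fun theta => skernel_of (P theta)) else P') (fun=> erefl).
  by split => //; near=> s.
exists pi, (Dpi1 1%N), Z; split; last first.
  move=> [//|n] DP _ DP0 DPn; have [Dpi [Dpi0 Dpid DpiE]] := higher n DP DP0 DPn.
  by exists Dpi; split => //; exact: DpiE.
have [_ _ mem0 _] := U_good _ U0.
have [[MK wK] rK] := calLw_woper w_ge1 mw x0 mem0.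
have nU := U_open _ U0.
have rpi s : represents (rint (pi s)) (charge_of_prob (pi s)).
  by move=> B mB; rewrite rint_indic// fineK//; exact: (fin_num_measure (pi s)).
split.
- near=> s; have Us : U s by near: s.
  by have [[phr st uniq] _] := f_ergodic _ Us.
- near=> s; have Us : U s by near: s.
  have [_ [[M ws] _ _ _]] := f_ergodic _ Us.
  exact: Mw_mem ws (rpi s).
- move: Dpi1d => [_]; rewrite (_ : Dpi1 0%N = fun s => charge_of_prob (pi s))//.
  exact/funext.
- move=> G; pose Gop h := (h \- K theta0 h \+ cst (rint (pi theta0) h))%R.
  have rid : krepresents id (skernel_id : signed_kernel S R).
    by move=> x B mB; rewrite -[LHS]/(\d_x B : \bar R) diracE indicE.
  have rG : krepresents Gop G.
    move=> x; exact: represents_add (represents_sub (rid x) (rK x)) (rpi theta0).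
  have [M1 wG] : exists M, woper w M Gop.
    have [C1 C10 b1C] := Lw_cst 1 w_ge1.
    have wr := woper_rank1 C10 b1C wpi.
    eexists; apply: woper_ext (woper_add (woper_sub (woper_id w_ge1) wK) wr) => h _.
    by apply/funext => x; rewrite /Gop /= mulr1.
  split.
  + split; first exact: (krepresents_measurable w_ge1 wZ ZoZ).
    by rewrite (le_lt_trans (wnorm_skernel_le w_ge1 mw x0 wZ ZoZ))// ltry.
  + move=> x B mB; rewrite (krepresents_comp w_ge1 mw wG wZ rG ZoZ x mB) (rid x B mB).
    by rewrite /= -[in RHS](GZ _ (Lw_indic w_ge1 mB)).
  + move=> x B mB; rewrite (krepresents_comp w_ge1 mw wZ wG ZoZ rG x mB) (rid x B mB).
    by rewrite /= -[in RHS](ZG _ (Lw_indic w_ge1 mB)).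
- move=> B mB; rewrite (Dpi1E Z ZoZ B mB) big_nat1 bin0 mul1e.
  by rewrite Dpi10.
Unshelve. all: by end_near.
Qed.
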